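(* Let $\Omega\subset\mathbb{R}^n$ be a bounded domain and $\mu\in\mathcal{M}(\Omega)$. Then there exists a SOLA $u$ to the problem $-\mathcal{L}_\Phi u=\mu$ in $\Omega$, $u=0$ in $\mathbb{R}^n\setminus\Omega$, satisfying, for any $q\in(0,\bar q)$ and $h\in(0,s)$, where $\bar q=\frac{n(p-1)}{n-s}$, $$\left(\int_{\mathbb{R}^n}\int_{\mathbb{R}^n}\frac{|u(x)-u(y)|^q}{|x-y|^{n+hq}}\,dx\,dy\right)^{1/q}\le c\,[\mathrm{diam}(\Omega)]^{\frac nq-h}\left(\frac{|\mu|(\Omega)}{[\mathrm{diam}(\Omega)]^{n-sp}}\right)^{1/(p-1)}$$ with a constant $c=c(n,s,p,\Lambda,h,q)>0$.
   Context: Standing assumptions: $n\ge2$, $0<s<1$, $1<p<n/s$, $\Lambda\ge1$. $\Phi:\mathbb{R}\to\mathbb{R}$ is continuous with $\Lambda^{-1}|t|^p\le\Phi(t)t\le\Lambda|t|^p$ for all $t\in\mathbb{R}$. $K:\mathbb{R}^n\times\mathbb{R}^n\to\mathbb{R}$ is measurable with $\Lambda^{-1}|x-y|^{-(n+sp)}\le K(x,y)\le\Lambda|x-y|^{-(n+sp)}$ for all $x\ne y$. The operator is defined by $$\langle-\mathcal{L}_\Phi u,\varphi\rangle=\int_{\mathbb{R}^n}\int_{\mathbb{R}^n}\Phi(u(x)-u(y))(\varphi(x)-\varphi(y))K(x,y)\,dx\,dy,\qquad \varphi\in C_c^\infty(\Omega).$$ $\mathcal{M}(\Omega)$ is the set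 of (signed) Radon measures on $\Omega$ with finite total mass, extended to $\mathbb{R}^n$ by $|\mu|(\mathbb{R}^n\setminus\Omega)=0$. Spaces: for $U\subseteq\mathbb{R}^n$ open, $h\in(0,1)$, $q\in(0,\infty)$, $W^{h,q}(U)$ is the set of $f$ with $\int_U|f|^q\,dx+\int_U\int_U\frac{|f(x)-f(y)|^q}{|x-y|^{n+hq}}\,dx\,dy<\infty$. $\mathbb{W}^{s,p}(U)$ is the set of $f:\mathbb{R}^n\to\mathbb{R}$ with $f|_U\in L^p(U)$ and $\iint_{(\mathbb{R}^n\times\mathbb{R}^n)\setminus((\mathbb{R}^n\setminus U)\times(\mathbb{R}^n\setminus U))}\frac{|f(x)-f(y)|^p}{|x-y|^{n+sp}}\,dx\,dy<\infty$. A weak solution to $-\mathcal{L}_\Phi v=f$ in $U$, $v=0$ in $\mathbb{R}^n\setminus U$, is $v\in\mathbb{W}^{s,p}(U)$ with $v=0$ a.e. in $\mathbb{R}^n\setminus U$ and $\langle-\mathcal{L}_\Phi v,\varphi\rangle=\int f\varphi\,dx$ for all $\varphi\in C_c^\infty(U)$. SOLA (bounded $\Omega$): a function $u$ with $u=0$ in $\mathbb{R}^n\setminus\Omega$ and $u\in W^{h,q}(\Omega)$ for all $h\in(0,s)$ and $p-1\le q<\bar q$, such that $\langle-\mathcal{L}_\Phi u,\varphi\rangle=\int_\Omega\varphi\,d\mu$ for all $\varphi\in C_c^\infty(\Omega)$, and such that there are weak solutions $u_j$ to $-\mathcal{L}_\Phi u_j=\mu_j$ in $\Omega$, $u_j=0$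 in $\mathbb{R}^n\setminus\Omega$, with $u_j\to u$ a.e. in $\Omega$ and locally in $L^q(\mathbb{R}^n)$ for such $q$, where $\{\mu_j\}\subset L^\infty(\Omega)$ converges to $\mu$ weakly in the sense of measures in $\Omega$ and $\limsup_{j\to\infty}|\mu_j|(B)\le|\mu|(\overline B)$ for every ball $B\subset\mathbb{R}^n$. *)

(* Defs.v *)
From HB Require Import structures.
From mathcomp Require Import all_boot all_order all_algebra.
From mathcomp Require Import all_classical all_reals all_analysis.
From mathcomp Require Import measurable_realfun.

Set Implicit Arguments.
Unset Strict Implicit.
Unset Printing Implicit Defensive.
Import Order.TTheory GRing.Theory Num.Theory.
Import numFieldNormedType.Exports.

Local Open Scope classical_set_scope.
Local Open Scope ring_scope.

(* 'rV[R]_n carries its Borel sigma-algebra. *)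
Fact Rn_display : measure_display. Proof. exact: default_measure_display. Qed.

HB.instance Definition _ (R : realType) (n : nat) :=
  @isMeasurable.Build Rn_display 'rV[R]_n <<s (@open 'rV[R]_n) >>
    (@sigma_algebra0 _ _ _) (@sigma_algebraC _ _) (@sigma_algebra_bigcup _ _ _).

Section lebesgue_rV.
Context {R : realType}.

Lemma open_measurable_rV n (A : set 'rV[R]_n) : open A -> measurable A.
Proof. exact: sub_sigma_algebra. Qed.

Lemma ball_rat_rV n (e : R) (x : 'rV[R]_n) : 0 < e ->
  exists v : 'rV[rat]_n, ball (\row_i ratr (v ord0 i) : 'rV[R]_n) e x.
Proof.
move=> e0.
have /choice [f fP] : forall i : 'I_n, exists q : rat, `|ratr q - x ord0 i| < e.
  move=> i; have [|q] := @rat_in_itvoo R (x ord0 i - e) (x ord0 i + e).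
    by rewrite ltrBlDr -addrA ltrDl addr_gt0.
  by rewrite in_itv/= => qi; exists q; rewrite ltr_distl.
exists (\row_i f i); split => // i j; by rewrite (ord1 i) !mxE -ball_normE/=; exact: fP.
Qed.

Lemma measurable_open_prod n (W : set (R * 'rV[R]_n)) : open W -> measurable W.
Proof.
move=> oW.
pose B (i : rat * 'rV[rat]_n * nat) : set (R * 'rV[R]_n) :=
  ball (ratr i.1.1 : R) i.2.+1%:R^-1
    `*` ball (\row_j ratr (i.1.2 ord0 j) : 'rV[R]_n) i.2.+1%:R^-1.
rewrite (_ : W = \bigcup_i (if `[< B i `<=` W >] then B i else set0)).
  apply: countable_bigcupT_measurable; first exact: countableP.
  move=> i; case: ifPn => // _; apply: measurableX.
    by apply: open_measurable; exact: ball_open.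
  by apply: open_measurable_rV; exact: ball_open.
rewrite eqEsubset; split => [[x v] Wxv|x [i _]]; last first.
  by case: ifPn => // /asboolP; exact.
have /nbhs_ballP[e/= e0 eW] : nbhs (x, v) W by exact: open_nbhs_nbhs.
pose k := Num.truncn (2 / e).
have k0 : 0 < k.+1%:R^-1 :> R by rewrite invr_gt0.
have ke : k.+1%:R^-1 + k.+1%:R^-1 <= e :> R.
  rewrite [leRHS]splitr lerD//.
    by rewrite -[leRHS]invf_div lef_pV2 ?posrE ?divr_gt0// ltW// truncnS_gt.
  by rewrite -[leRHS]invf_div lef_pV2 ?posrE ?divr_gt0// ltW// truncnS_gt.
have [q xq] : exists q : rat, ball (ratr q : R) k.+1%:R^-1 x.
  have [|q] := @rat_in_itvoo R (x - k.+1%:R^-1) (x + k.+1%:R^-1).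
    by rewrite ltrBlDr -addrA ltrDl addr_gt0.
  by rewrite in_itv/= => qi; exists q; rewrite -ball_normE/= ltr_distl.
have [w vw] := ball_rat_rV v k0.
exists (q, w, k) => //; rewrite ifT//; apply/asboolP => -[y u]/= [qy wu].
apply: eW; split => /=.
  by apply: le_ball ke _ _; apply: (ball_triangle (ball_sym xq)).
by apply: le_ball ke _ _; apply: (ball_triangle (ball_sym vw)).
Qed.

Lemma continuous_measurable_rV n (f : 'rV[R]_n -> R) :
  continuous f -> measurable_fun setT f.
Proof.
move=> /continuousP cf; apply: (measurability _ (RGenOpens.measurableE R)).
move=> _ [_ [a [b ->]] <-]; rewrite setTI.
by apply: open_measurable_rV; apply: cf; exact: interval_open.
Qed.

Definition cons_rV n (z : R * 'rV[R]_n) : 'rV[R]_n.+1 :=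
  \row_i oapp (z.2 ord0) z.1 (unlift ord0 i).

Definition uncons_rV n (v : 'rV[R]_n.+1) : R * 'rV[R]_n :=
  (v ord0 ord0, \row_i v ord0 (lift ord0 i)).

Lemma uncons_rVK n : cancel (@uncons_rV n) (@cons_rV n).
Proof.
by move=> v; apply/rowP => i; rewrite mxE; case: unliftP => [j|] ->//=; rewrite mxE.
Qed.

Lemma cons_rVK n : cancel (@cons_rV n) (@uncons_rV n).
Proof.
move=> [x v]; rewrite /uncons_rV /cons_rV !mxE unlift_none/=; congr pair.
by apply/rowP => i; rewrite !mxE liftK.
Qed.

Lemma continuous_cons_rV n : continuous (@cons_rV n).
Proof.
move=> [x v]; apply/cvg_ballP => e e0.
exists (ball x e, ball v e) => /=; first by split; exact: nbhsx_ballx.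
move=> [y w] [/= xy [_ vw]]; split => // i j; rewrite !mxE.
by case: unliftP => [k|] _ //=; exact: vw.
Qed.

Lemma continuous_uncons_rV n : continuous (@uncons_rV n).
Proof.
move=> v; have FF := nbhs_filter (v : 'rV[R]_n.+1).
apply/(@cvg_ballP _ _ _ (nbhs v) FF (@uncons_rV n) (uncons_rV v)) => e e0.
exists (fun i j => ball (v i j) e) => /=; first by move=> *; exact: nbhsx_ballx.
move=> w vw; split => /=; first exact: vw.
by split => // i j; rewrite !mxE; exact: vw.
Qed.

Lemma measurable_cons_rV n : measurable_fun setT (@cons_rV n).
Proof.
apply: (@measurability _ _ _ _ _ _ (@open 'rV[R]_n.+1)) => //.
move=> _ [A oA <-]; rewrite setTI; apply: measurable_open_prod.
by move/continuousP : (@continuous_cons_rV n); exact.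
Qed.

Lemma measurable_uncons_rV n : measurable_fun setT (@uncons_rV n).
Proof.
apply: measurable_fun_pair => /=.
  by apply: continuous_measurable_rV; exact: coord_continuous.
apply: (@measurability _ _ _ _ _ _ (@open 'rV[R]_n)) => //.
move=> _ [A oA <-]; rewrite setTI; apply: open_measurable_rV.
have /continuousP : continuous (snd \o @uncons_rV n); last exact.
move=> v; apply: (@continuous_comp _ _ _ (@uncons_rV n) snd v).
  exact: continuous_uncons_rV.
by case: (uncons_rV v) => x w; exact: cvg_snd.
Qed.

Section succ.
Variables (n : nat) (mu : {sigma_finite_measure set 'rV[R]_n -> \bar R}).
Local Open Scope ereal_scope.

Definition lebesgue_rV_succ : set 'rV[R]_n.+1 -> \bar R :=
  pushforward (@lebesgue_measure R \x mu) (@cons_rV n).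

Let M := measure_function_pushforward__canonical__measure_function_Measure
  (@lebesgue_measure R \x mu) (@measurable_cons_rV n).

HB.instance Definition _ := isMeasure.Build _ _ _ lebesgue_rV_succ
  (measure0 M) (measure_ge0 M) (@measure_semi_sigma_additive _ _ _ M).

Let lebesgue_rV_succ_sigma_finite : sigma_finite setT lebesgue_rV_succ.
Proof.
have /sigma_finiteP[F [TF ndF Foo]] := sigma_finiteT (@lebesgue_measure R).
have /sigma_finiteP[G [TG ndG Goo]] := sigma_finiteT mu.
exists (fun k => @uncons_rV n @^-1` (F k `*` G k)).
  rewrite -preimage_bigcup (_ : \bigcup_k _ = setT) ?preimage_setT//.
  apply/seteqP; split => // -[x v] _.
  have [i _ Fix] : (\bigcup_i F i) x by rewrite -TF.
  have [j _ Gjv] : (\bigcup_i G i) v by rewrite -TG.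
  exists (maxn i j) => //; split => /=.
    by move: Fix; exact/subsetPset/ndF/leq_maxl.
  by move: Gjv; exact/subsetPset/ndG/leq_maxr.
move=> k; have [mF Fk] := Foo k; have [mG Gk] := Goo k; split.
  by rewrite -[X in measurable X]setTI; apply: measurable_uncons_rV => //;
    exact: measurableX.
rewrite /lebesgue_rV_succ /pushforward -comp_preimage.
rewrite (_ : _ \o _ = id); last by apply/funext => z /=; rewrite cons_rVK.
rewrite preimage_id product_measure1E// lte_mul_pinfty//.
by rewrite ge0_fin_numE.
Qed.

HB.instance Definition _ := @Measure_isSigmaFinite.Build _ _ _ lebesgue_rV_succ
  lebesgue_rV_succ_sigma_finite.

End succ.

(* n-dimensional Lebesgue measure, as an n-fold product; see [lebesgue_rV_box]. *)
Fixpoint lebesgue_rV n : {sigma_finite_measure set 'rV[R]_n -> \bar R} :=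
  match n return {sigma_finite_measure set 'rV[R]_n -> \bar R} with
  | 0%N => dirac (0 : 'rV[R]_0)
  | n'.+1 => lebesgue_rV_succ (lebesgue_rV n')
  end.

Lemma lebesgue_rV_box n (A : 'I_n -> set (measurableTypeR R)) :
  (forall i, measurable (A i)) ->
  (lebesgue_rV n [set v : 'rV[R]_n | forall i, A i (v ord0 i)] =
   \prod_(i < n) lebesgue_measure (A i))%E.
Proof.
elim: n A => [|n ih] A mA.
  by rewrite big_ord0 /= diracE mem_set//= => -[].
have mB : measurable [set v : 'rV[R]_n | forall i, A (lift ord0 i) (v ord0 i)].
  rewrite (_ : [set _ | _] = \bigcap_(i in [set: 'I_n])
      (fun v : 'rV[R]_n => v ord0 i) @^-1` A (lift ord0 i)); last first.
    by apply/seteqP; split => v /= vA i => [_|]; exact: vA.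
  apply: fin_bigcap_measurable => // i _; rewrite -[X in measurable X]setTI.
  apply: (continuous_measurable_rV (f := fun v : 'rV[R]_n => v ord0 i)) => //.
    exact: coord_continuous.
  exact: mA.
rewrite big_ord_recl -ih// -product_measure1E//.
rewrite /= /lebesgue_rV_succ /pushforward; congr (_ _).
apply/seteqP; split => -[x v]/=.
  move=> xvA; split => [|i]; first by have := xvA ord0; rewrite mxE unlift_none.
  by have := xvA (lift ord0 i); rewrite mxE liftK.
by move=> [xA vA] i; rewrite mxE; case: unliftP => [j|] ->//=.
Qed.

End lebesgue_rV.

Section notions.
Context {R : realType} {n : nat}.
Implicit Types (x y : 'rV[R]_n) (U Omega A : set 'rV[R]_n).
Implicit Types (f u v phi psi : 'rV[R]_n -> R).

Local Notation leb := (lebesgue_rV n : set 'rV[R]_n -> \bar R).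

(* The library norm on ['rV[R]_n] is the sup norm; it induces the usual
   topology, but the distances and the balls below are Euclidean. *)
Definition enorm x : R := Num.sqrt (\sum_(i < n) x ord0 i ^+ 2).

Definition eball x (r : R) : set 'rV[R]_n := [set y | enorm (y - x) < r].

Definition diam A : R := sup [set enorm (z.1 - z.2) | z in A `*` A].

Definition bounded_domain Omega : Prop :=
  [/\ Omega !=set0, open Omega, connected Omega & bounded_set Omega].

(* Lebesgue measurability: the sigma-algebra on the domain is the completion of
   the Borel sets. The library integral is defined through simple functions
   below the positive and negative parts, hence still computes the Lebesgue
   integral of functions that are only measurable for the completion. *)
Definition Rn_measurable (D : set 'rV[R]_n) f : Prop :=
  @measurable_fun _ _ (g_sigma_algebraType (completed_algebra_gen leb)) R D f.

Definition Rn2_measurable (K : 'rV[R]_n -> 'rV[R]_n -> R) : Prop :=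
  @measurable_fun _ _
    (g_sigma_algebraType (completed_algebra_gen (leb \x leb)%E)) R
    setT (fun z => K z.1 z.2).

(* Iterated partial derivatives in the directions listed in [l]. *)
Definition partials (l : seq 'I_n) f : 'rV[R]_n -> R :=
  foldr (fun i g => 'D_(delta_mx ord0 i) g) f l.

Definition smooth f : Prop := forall l : seq 'I_n,
  continuous (partials l f) /\
  forall i x, derivable (partials l f) x (delta_mx ord0 i).

Definition csupported U f : Prop :=
  let S := closure [set x | f x != 0] in compact S /\ S `<=` U.

Definition test_function U f : Prop := smooth f /\ csupported U f.

Local Open Scope ereal_scope.

(* On the diagonal the integrand is [0 / 0 = 0]; the diagonal is negligible. *)
Definition gagliardo (h q : R) (D : set ('rV[R]_n * 'rV[R]_n)) f : \bar R :=
  \int[leb \x leb]_(z in D)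
    (`|f z.1 - f z.2| `^ q / enorm (z.1 - z.2) `^ (n%:R + h * q))%:E.

Definition sobolev (h q : R) U f : Prop := Rn_measurable U f /\
  \int[leb]_(x in U) (`|f x| `^ q)%:E + gagliardo h q (U `*` U) f < +oo.

Definition sobolev_bb (s p : R) U f : Prop := [/\ Rn_measurable setT f,
  \int[leb]_(x in U) (`|f x| `^ p)%:E < +oo &
  gagliardo s p (~` (~` U `*` ~` U)) f < +oo].

(* The pairing of - L_Phi u with phi. The integral of a function that is not
   integrable is infinite ([+oo - +oo = -oo]), so equating this pairing to a
   finite number contains the absolute convergence of the double integral. *)
Definition nonlocal_form (Phi : R -> R) (K : 'rV[R]_n -> 'rV[R]_n -> R) u phi
    : \bar R :=
  \int[leb \x leb]_z
    (Phi (u z.1 - u z.2) * (phi z.1 - phi z.2) * K z.1 z.2)%:E.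

Definition weak_solution (s p : R) (Phi : R -> R)
    (K : 'rV[R]_n -> 'rV[R]_n -> R) U f v : Prop :=
  [/\ sobolev_bb s p U v,
      {ae leb, forall x, ~ U x -> v x = 0%R} &
      forall phi, test_function U phi ->
        nonlocal_form Phi K v phi = \int[leb]_(x in U) (f x * phi x)%:E].

Definition Linfty U f : Prop := Rn_measurable U f /\
  exists M : R, {ae leb, forall x, U x -> (`|f x| <= M)%R}.

End notions.

(* The Hahn decomposition is unique up to null sets, so the total variation and
   the integral below do not depend on the one chosen. *)
Section signed_measure.
Context {d} {T : measurableType d} {R : realType}.
Variable mu : {charge set T -> \bar R}.

Let P_ex := cid (Hahn_decomposition mu).
Let N_ex := cid (projT2 P_ex).

Definition hahn_pos : set T := projT1 P_ex.
Definition hahn_neg : set T := projT1 N_ex.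
Definition hahnP : hahn_decomposition mu hahn_pos hahn_neg := projT2 N_ex.

Definition charge_tv : set T -> \bar R := charge_variation hahnP.

Definition charge_integral (D : set T) (f : T -> R) : \bar R :=
  (\int[jordan_pos hahnP]_(x in D) (f x)%:E
   - \int[jordan_neg hahnP]_(x in D) (f x)%:E)%E.

End signed_measure.

Definition qbar {R : realType} (n : nat) (s p : R) : R :=
  n%:R * (p - 1) / (n%:R - s).

Section sola.
Context {R : realType} {n : nat}.
Local Notation leb := (lebesgue_rV n : set 'rV[R]_n -> \bar R).

(* Charges are finite signed Borel measures, and finite Borel measures on R^n
   are Radon; the measures on Omega are those carried by Omega. *)
Definition finite_radon_measure (Omega : set 'rV[R]_n)
    (mu : {charge set 'rV[R]_n -> \bar R}) : Prop :=
  charge_tv mu (~` Omega) = 0%E.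

(* [mu_ j] is extended by 0 outside Omega; weak convergence of measures is
   tested against continuous functions with compact support in Omega. *)
Record sola (s p : R) (Phi : R -> R) (K : 'rV[R]_n -> 'rV[R]_n -> R)
    (Omega : set 'rV[R]_n) (mu : {charge set 'rV[R]_n -> \bar R})
    (u : 'rV[R]_n -> R) : Prop := Sola {
  sola_out : forall x, ~ Omega x -> u x = 0 ;
  sola_frac : forall h q, 0 < h < s -> p - 1 <= q < qbar n s p ->
    sobolev h q Omega u ;
  sola_eq : forall phi, test_function Omega phi ->
    nonlocal_form Phi K u phi = charge_integral mu Omega phi ;
  sola_approx : exists u_ mu_ : nat -> 'rV[R]_n -> R,
    [/\ forall j, Linfty Omega (mu_ j),
        forall j, weak_solution s p Phi K Omega (mu_ j) (u_ j),
        {ae leb, forall x, Omega x -> u_ j x @[j --> \oo] --> u x} &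
        [/\ forall q, p - 1 <= q < qbar n s p -> forall C, compact C ->
              (\int[leb]_(x in C) (`|u_ j x - u x| `^ q)%:E)%E @[j --> \oo]
                --> 0%E,
            forall psi, continuous psi -> csupported Omega psi ->
              (\int[leb]_(x in Omega) (psi x * mu_ j x)%:E)%E @[j --> \oo]
                --> charge_integral mu Omega psi &
            forall x r, 0 < r ->
              (limn_esup (fun j =>
                 \int[leb]_(y in Omega `&` eball x r) `|mu_ j y|%:E)
               <= charge_tv mu (closure (eball x r)))%E]]
}.

End sola.

(* Main.v *)
Require Import Defs.
From mathcomp Require Import all_boot all_order all_algebra.
From mathcomp Require Import all_classical all_reals all_analysis.
From mathcomp Require Import measurable_realfun.
From mathcomp Require Import ring lra.

(* Off a null set [K] is a Borel kernel comparable to [|x - y|^-(n + s p)], and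
   [mu] is smoothed by averaging it over small cubes. For a bounded datum [f] the
   equation is the Euler-Lagrange equation of the double integral of
   [F (v x - v y) K x y] minus the integral of [f v], where [F' = Phi]; a minimizer
   exists by Rellich compactness and Fatou's lemma, so neither convexity of [F] nor
   monotonicity of [Phi] is needed.
   Testing with [psi u], for [psi] bounded, nondecreasing and 1-Lipschitz, bounds
   the double integral of [|u x - u y|^(p - 1) |psi (u x) - psi (u y)|] against the
   kernel by [Lambda^2 sup|psi| |mu|(Omega)]. Truncations [psi] give the decay
   [|{|u| > t}| <= C t^-(n (p - 1) / (n - s p))] by induction on dyadic levels;
   [psi' t = (1 + |t|)^-xi] and Young's inequality then give the fractional estimate,
   uniformly in the datum.
   Along the smoothed data, [psi (u_j)] with [psi t = t / (1 + |t|)] has bounded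
   energy, so a subsequence converges almost everywhere; the uniform estimates for
   slightly larger exponents are the equi-integrability needed to pass to the limit
   in the equation and in [L^q] by Vitali's theorem, and Fatou's lemma transfers
   the estimate itself. *)

Set Implicit Arguments.
Unset Strict Implicit.
Unset Printing Implicit Defensive.
Import Order.TTheory GRing.Theory Num.Theory.
Import numFieldNormedType.Exports.

Local Open Scope classical_set_scope.
Local Open Scope ring_scope.

(** For a bounded datum the equation is solved against every function of finite energy that vanishes
    off [Omega], not only against smooth ones; [psi u] is then a legitimate test function with no
    density argument and no regularity of the boundary. Size and length are scaled out once, in
    [normalized]: the datum enters only through a scale [k] and [Omega] only through its diameter,
    so the constants of the a priori estimates depend on the structural parameters alone. The scale
    is merely bounded from below, because its natural value [(|mu|(Omega) / d^(n - s p))^(1 / (p -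
    1))] is [0] when [mu] vanishes. Exponents [q] may lie below [1], so nothing is phrased in normed
    spaces: estimates are integrals of powers and limits are taken pointwise. The origin of [qbar]
    is Young's inequality: it spends a moment of order [xi q / (p - q)] with [xi > 1] arbitrary, and
    the decay of level sets makes it finite exactly in the range [q < qbar]. Neither the
    approximating family nor its limit depends on [h] and [q], so one solution serves all the
    estimates at once. *)

Ltac mfun1 := lazymatch goal with
| |- measurable_fun _ (fun _ => ?c) => exact: measurable_cst
| |- measurable_fun _ (fun x => x) => exact: measurable_id
| |- measurable_fun _ (fun x => fst x) => exact: measurable_fst
| |- measurable_fun _ (fun x => snd x) => exact: measurable_snd
| |- measurable_fun _ (fun x => EFin (@?f x)) => apply/measurable_EFinP; change (measurable_fun setT f)
| |- measurable_fun _ (fun x => GRing.add (@?f x) (GRing.opp (@?g x))) => apply: (measurable_funB (f := f) (g := g))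
| |- measurable_fun _ (fun x => GRing.add (@?f x) (@?g x)) => apply: (measurable_funD (f := f) (g := g))
| |- measurable_fun _ (fun x => GRing.opp (@?g x)) => apply: (measurable_funN (f := g))
| |- measurable_fun _ (fun x => GRing.mul (@?f x) (@?g x)) => apply: (measurable_funM (f := f) (g := g))
| |- measurable_fun _ (fun x => GRing.exp (@?f x) ?k) => apply: (measurable_funX (f := f))
| |- measurable_fun _ (fun x => Num.norm (@?f x)) => apply: (measurableT_comp (@normr_measurable _ setT) (_ : measurable_fun _ f))
| |- measurable_fun _ (fun x => powR (@?f x) ?c) => apply: (measurableT_comp (measurable_powR c) (_ : measurable_fun _ f))
| |- measurable_fun _ (fun x => Order.min (@?f x) (@?g x)) => apply: (measurable_minr (f := f) (g := g))
| |- measurable_fun _ (fun x => Order.max (@?f x) (@?g x)) => apply: (measurable_maxr (f := f) (g := g))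
| |- measurable_fun _ (fun x => Order.le (@?f x) (@?g x)) => apply: (measurable_fun_ler (f := f) (g := g))
| |- measurable_fun _ (fun x => Order.lt (@?f x) (@?g x)) => apply: (measurable_fun_ltr (f := f) (g := g))
| |- measurable_fun _ (fun x => indic ?A x) => apply: measurable_indic
| |- measurable_fun _ (fun x => @indic ?T0 ?R0 ?A (@?f x)) => apply: (measurableT_comp (_ : measurable_fun setT (@indic T0 R0 A)) (_ : measurable_fun _ f))
| |- measurable_fun _ (indic ?A) => apply: measurable_indic
| H : measurable_fun setT ?u |- measurable_fun _ (fun x => ?u x) => exact: H
| H : measurable_fun setT ?u |- measurable_fun _ ?u => exact: H
| H : measurable_fun setT ?u |- measurable_fun _ (fun x => ?u (@?f x)) => apply: (measurableT_comp H (_ : measurable_fun _ f))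
| |- measurable_fun _ _ => apply: measurable_fun_ifT
end.
(** Descends along the syntax of the integrand. The measurability of function variables and kernels
    must be present as closed hypotheses, which is why such facts are often restated just before a
    call. *)
Ltac mfun := repeat mfun1.

Lemma cvg_EFinT (R : realType) (u : nat -> R) (l : R) :
  u j @[j --> \oo] --> l -> (u j)%:E @[j --> \oo] --> l%:E.
Proof. by move=> ul; apply/fine_cvgP; split; [exact: nearW|]. Qed.

(** * Integration *)

Section integration.
Import HBNNSimple.
Context d (T : measurableType d) (R : realType) (mu : {measure set T -> \bar R}).
Local Open Scope ereal_scope.

(** The integral of a nonnegative function, measurable or not, is a supremum over the simple
    functions below it, and that set grows with the function. *)
Lemma ge0_le_integralW (D : set T) (f g : T -> \bar R) :
  (forall x, D x -> 0 <= f x) -> (forall x, D x -> f x <= g x) ->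
  \int[mu]_(x in D) f x <= \int[mu]_(x in D) g x.
Proof.
move=> f0 fg; have g0 x : D x -> 0 <= g x by move=> Dx; exact: le_trans (f0 _ Dx) (fg _ Dx).
rewrite !ge0_integralE//; apply: ereal_sup_le => _ [h hf <-]; exists h => //= x.
apply: (le_trans (hf x)); rewrite /patch; case: ifPn => //; rewrite inE; exact: fg.
Qed.

(** A simple function below [f], cut off on [N], lies below [g], and the cut costs nothing. This
    covers integrands that are measurable only for the completion, such as those containing the
    original kernel. *)
Lemma integral_eq_off_null (N : set T) (f g : T -> \bar R) :
  measurable N -> mu N = 0 -> (forall x, ~ N x -> f x = g x) ->
  \int[mu]_x f x = \int[mu]_x g x.
Proof.
move=> mN N0 fg.
have H (f1 g1 : T -> \bar R) : (forall x, 0 <= f1 x) -> (forall x, 0 <= g1 x) ->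
    (forall x, ~ N x -> f1 x = g1 x) -> \int[mu]_x f1 x <= \int[mu]_x g1 x.
  move=> f10 g10 fg1; rewrite [leLHS]ge0_integralTE//; apply: ge_ereal_sup => _ [h hf <-].
  rewrite -integralT_nnsfun.
  have mh : measurable_fun setT (fun x => (h x)%:E) by apply/measurable_EFinP.
  rewrite (ge0_negligible_integral mN)//; last by move=> x _; rewrite lee_fin.
  rewrite setTD integral_mkcond; apply: ge0_le_integralW => x _.
    by rewrite patchE; case: ifPn => // _; rewrite lee_fin.
  rewrite patchE; case: ifPn => //; rewrite inE => Nx.
  by rewrite -(fg1 x Nx); exact: hf.
have E (f1 g1 : T -> \bar R) : (forall x, 0 <= f1 x) -> (forall x, 0 <= g1 x) ->
    (forall x, ~ N x -> f1 x = g1 x) -> \int[mu]_x f1 x = \int[mu]_x g1 x.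
  by move=> f10 g10 fg1; apply/eqP; rewrite eq_le !H// => x Nx; rewrite fg1.
rewrite integralE [in RHS]integralE.
by rewrite (E f^\+ g^\+) ?(E f^\- g^\-)// => x Nx; rewrite ?funeposE ?funenegE fg.
Qed.

Lemma integral_eq_ae (f g : T -> \bar R) :
  {ae mu, forall x, f x = g x} -> \int[mu]_x f x = \int[mu]_x g x.
Proof.
move=> [N [mN N0 NS]]; apply: (integral_eq_off_null mN N0) => x Nx.
by apply: contrapT => fg; apply: Nx; apply: NS.
Qed.

(** The bounds vary with [j] because a minimizing sequence is controlled only by values that
    converge to the infimum. *)
Lemma fatou_le (f_ : nat -> T -> R) (f : T -> R) (c_ : nat -> R) (c : R) :
  (forall j, measurable_fun setT (f_ j)) -> (forall j x, (0 <= f_ j x)%R) ->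
  {ae mu, forall x, f_ j x @[j --> \oo] --> f x} ->
  (forall j, \int[mu]_x (f_ j x)%:E <= (c_ j)%:E) -> (c_ j @[j --> \oo] --> c)%R ->
  \int[mu]_x (f x)%:E <= c%:E.
Proof.
move=> mf f0 fc fi cc.
rewrite (@integral_eq_ae _ (fun x => limn_einf (fun j => (f_ j x)%:E))); last first.
  apply: filterS fc => x fx; by rewrite (cvg_limn_einf_sup (cvg_EFinT fx)).1.
apply: (@le_trans _ _ (limn_einf (fun j => \int[mu]_x (f_ j x)%:E))).
  apply: (@fatou _ _ _ mu setT measurableT (fun j x => (f_ j x)%:E)).
    by move=> j; exact/measurable_EFinP.
  by move=> j x _; rewrite lee_fin.
have -> : c%:E = limn_einf (fun j => (c_ j)%:E).
  by rewrite (cvg_limn_einf_sup (cvg_EFinT cc)).1.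
rewrite !limn_einf_lim; apply: lee_lim; try exact: is_cvg_einfs.
apply: nearW => m; apply: le_ereal_inf_tmp => _ [k /= mk <-].
by apply: le_trans (fi k); apply: ereal_inf_lbound; exists k.
Qed.

(* Vitali's theorem: [N w + e b_j] encodes uniform integrability. *)
Lemma equiintegrable_cvg0 (h_ b_ : nat -> T -> R) (w : T -> R) (C : R) :
  (forall j, measurable_fun setT (h_ j)) -> (forall j, measurable_fun setT (b_ j)) ->
  measurable_fun setT w ->
  (forall j x, (0 <= h_ j x)%R) -> (forall j x, (0 <= b_ j x)%R) -> (forall x, (0 <= w x)%R) ->
  {ae mu, forall x, (h_ j x @[j --> \oo] --> 0)%R} ->
  (forall e : R, (0 < e)%R -> exists2 N : R, (0 <= N)%R &
    forall j x, (h_ j x <= N * w x + e * b_ j x)%R) ->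
  \int[mu]_x (w x)%:E < +oo ->
  (forall j, \int[mu]_x (b_ j x)%:E <= C%:E) ->
  \int[mu]_x (h_ j x)%:E @[j --> \oo] --> 0.
Proof.
move=> mh mb mw h0 b0 w0 hc hN wi bC.
have C0 : (0 <= C)%R by rewrite -lee_fin; apply: le_trans (bC 0%N); apply: integral_ge0 => x _; rewrite lee_fin.
suff H (e : R) : (0 < e)%R -> \forall j \near \oo, \int[mu]_x (h_ j x)%:E <= e%:E.
  apply/fine_cvgP; split.
    have := H _ ltr01; apply: filterS => j hj.
    rewrite ge0_fin_numE; first exact: le_lt_trans hj (ltry _).
    by apply: integral_ge0 => x _; rewrite lee_fin.
  apply/cvgrPdist_le => e e0; have := H _ e0; apply: filterS => j hj /=.
  have i0 : 0 <= \int[mu]_x (h_ j x)%:E by apply: integral_ge0 => x _; rewrite lee_fin.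
  rewrite sub0r normrN ger0_norm ?fine_ge0// -lee_fin fineK// ge0_fin_numE//.
  exact: le_lt_trans hj (ltry _).
(* The excess of [h_] over the dominated truncation [m_] is at most [e1 * b_], whose integral stays
   below [e / 2]; the summand [1] covers [C = 0]. *)
move=> e0; pose e1 := (e / 2 / (C + 1))%R.
have C1 : (0 < C + 1)%R by rewrite ltr_pwDr.
have e10 : (0 < e1)%R by rewrite !divr_gt0.
have [N N0 HN] := hN _ e10.
pose m_ j x := Num.min (h_ j x) (N * w x)%R.
have m0 j x : (0 <= m_ j x)%R by rewrite le_min h0 mulr_ge0.
have mNw : measurable_fun setT (fun x => N * w x)%R by apply: measurable_funM.
have mm j : measurable_fun setT (m_ j) by exact: measurable_minr.
have Nwi : mu.-integrable setT (EFin \o (fun x => N * w x)%R).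
  rewrite (_ : EFin \o _ = (fun x => N%:E * (w x)%:E)); last by apply/funext => x /=; rewrite EFinM.
  apply: integrableZl => //; apply/integrableP; split; first exact/measurable_EFinP.
  by under eq_integral do rewrite /= ger0_norm//.
have := @dominated_convergence _ _ _ mu setT measurableT (fun j => EFin \o m_ j) (cst 0)
  (EFin \o (fun x => N * w x)%R).
case.
- by move=> j; exact/measurable_EFinP.
- exact: measurable_cst.
- apply: filterS hc => x hx _ /=; apply: cvg_EFinT.
  apply: (@squeeze_cvgr _ _ _ _ (cst 0%R) (h_ ^~ x)) => //; last exact: cvg_cst.
  by apply: nearW => j; rewrite /= m0 ge_min lexx.
- exact: Nwi.
- by apply: nearW => x j _ /=; rewrite lee_fin ger0_norm// /m_ ge_min lexx orbT.
move=> _ _; rewrite integral0 => /fine_cvgP[_ mc].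
have /cvgrPdist_le/(_ (e / 2)%R) := mc; rewrite divr_gt0// => /(_ isT).
apply: filterS => j /=; rewrite sub0r normrN => mj.
have mji : \int[mu]_x (m_ j x)%:E \is a fin_num.
  rewrite ge0_fin_numE; last by apply: integral_ge0 => x _; rewrite lee_fin.
  case/integrableP: Nwi => _; apply: le_lt_trans; apply: ge0_le_integralW => x _.
    by rewrite lee_fin.
  by rewrite /= lee_fin ger0_norm ?mulr_ge0// ge_min lexx orbT.
have {}mj : \int[mu]_x (m_ j x)%:E <= (e / 2)%:E.
  rewrite -(fineK mji) lee_fin (le_trans _ mj)//; exact: ler_norm.
apply: (@le_trans _ _ (\int[mu]_x ((m_ j x)%:E + (e1%:E * (b_ j x)%:E)))).
  apply: ge0_le_integralW => x _; first by rewrite lee_fin.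
  rewrite -EFinM -EFinD lee_fin /m_ addr_minl le_min lerDl mulr_ge0 ?(ltW e10)//=.
rewrite ge0_integralD//; last 4 first.
- by move=> x _; rewrite lee_fin.
- exact/measurable_EFinP.
- by move=> x _; rewrite -EFinM lee_fin mulr_ge0// ltW.
- by apply/measurable_funeM/measurable_EFinP.
rewrite ge0_integralZl//; last 3 first.
- exact/measurable_EFinP.
- by move=> x _; rewrite lee_fin.
- by rewrite lee_fin ltW.
rewrite [e]splitr EFinD leeD//.
apply: (le_trans (lee_wpmul2l _ (bC j))); first by rewrite lee_fin ltW.
rewrite -EFinM lee_fin /e1 mulrAC ler_pdivrMr// ler_wpM2l ?ltW//.
by rewrite divr_gt0.
by rewrite ltrDl.
Qed.

End integration.

(** * Ultrafilters, subsequences and almost everywhere limits *)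

Section extraction.
Context d (T : measurableType d) (R : realType) (mu : {measure set T -> \bar R}).

(* Along an ultrafilter every bounded sequence is Cauchy, so the finitely many
   cell averages in Rellich's theorem need no diagonal extraction. *)
Lemma ultra_bounded_cauchy (U : set_system nat) (a : nat -> R) (B e : R) :
  UltraFilter U -> (forall i, `|a i| <= B) -> 0 < e ->
  exists2 S, U S & forall i j, S i -> S j -> `|a i - a j| <= e.
Proof.
move=> UU aB e0.
have UF : ProperFilter U by exact: ultra_proper.
(* [sup E] is the limit of [a] along the ultrafilter. *)
pose E := [set t : R | U [set i | t <= a i]].
have E0 : E (- B) by rewrite /E/=; apply: filterS filterT => i _ /=; have := aB i; rewrite ler_norml => /andP[].
have Eub : has_ubound E.
  exists B => t Et; rewrite leNgt; apply/negP => Bt.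
  have [i /= ti] := filter_ex Et; have := lt_le_trans Bt (le_trans ti (le_trans (ler_norm _) (aB i))).
  by rewrite ltxx.
have hs : has_sup E by split => //; exists (- B).
have e4 : 0 < e / 2 by rewrite divr_gt0.
have [t Et lt] := sup_adherent e4 hs.
have U2 : U [set i | ~ (sup E + e / 2 <= a i)].
  have [|//] := in_ultra_setVsetC [set i | sup E + e / 2 <= a i] UU.
  move=> h; have : sup E + e / 2 <= sup E by apply: sup_upper_bound.
  by rewrite gerDl leNgt e4.
exists ([set i | t <= a i] `&` [set i | ~ (sup E + e / 2 <= a i)]); first exact: filterI.
move=> i j [/= ti /negP]; rewrite -ltNge => ai [/= tj /negP]; rewrite -ltNge => aj.
rewrite ler_norml; lra.
Qed.

(** Each index is drawn from [S m] and [S m.-1] together, so two consecutive terms share the set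
    [S m] and obey its Cauchy bound; at [m = 0] the predecessor is [0] again. *)
Lemma ultra_subsequence (U : set_system nat) (S : nat -> set nat) :
  ProperFilter U -> \oo `<=` U -> (forall m, U (S m)) ->
  exists s : nat -> nat, [/\ forall m, (s m < s m.+1)%N, forall m, S m (s m)
    & forall m, S m (s m.+1)].
Proof.
move=> UF Uoo US.
have H m k : exists i, [/\ (k < i)%N, S m i & S m.-1 i].
  have UI : U ([set i | (k < i)%N] `&` (S m `&` S m.-1)).
    by apply: filterI; [apply: Uoo; exists k.+1|exact: filterI].
  by have [i [/= ki [? ?]]] := filter_ex UI; exists i.
have /choice[f fP] : forall mk, exists i, [/\ (mk.2 < i)%N, S mk.1 i & S mk.1.-1 i].
  by move=> [m k]; exact: H.
pose s := fix s m := if m is m'.+1 then f (m, s m') else f (0, 0)%N.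
exists s; split=> [m|[|m]|m] /=.
- by have [] := fP (m.+1, s m).
- by have [] := fP (0, 0)%N.
- by have [] := fP (m.+1, s m).
- by have [] := fP (m.+1, s m).
Qed.

Lemma increasing_seq_ge_id (s : nat -> nat) : (forall m, (s m < s m.+1)%N) ->
  forall m, (m <= s m)%N.
Proof. by move=> h; elim=> // m /leq_ltn_trans; apply. Qed.

Lemma cvg_subseq (X : topologicalType) (u : nat -> X) (l : X) (s : nat -> nat) :
  (forall m, (s m < s m.+1)%N) -> u j @[j --> \oo] --> l -> u (s j) @[j --> \oo] --> l.
Proof.
move=> hs ul; have su : s j @[j --> \oo] --> \oo; last exact: (cvg_comp s u su ul).
move=> A [N _ NA]; exists N => // m /= Nm.
apply: NA; exact: leq_trans Nm (increasing_seq_ge_id hs m).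
Qed.

Local Open Scope ereal_scope.

Lemma nneseries_geometric (a z : R) : (0 <= a)%R -> (0 <= z < 1)%R ->
  \sum_(0 <= i <oo) (a * z ^+ i)%:E = (a / (1 - z))%:E.
Proof.
move=> a0 /andP[z0 z1].
have := @cvg_geometric_series R a z; rewrite ger0_norm// z1 => /(_ isT)/cvg_EFinT h.
apply: cvg_lim => //; apply: cvg_trans h; apply: near_eq_cvg; apply: nearW => k /=.
by rewrite /series /geometric /= sumEFin.
Qed.

(** The increments have summable integrals, so the telescoping series converges absolutely almost
    everywhere. Naming the limit through [limn_esup] makes it measurable on the whole space. *)
Lemma ae_cvg_of_summable (v_ : nat -> T -> R) :
  (forall m, measurable_fun setT (v_ m)) ->
  (forall m, \int[mu]_x (`|v_ m.+1 x - v_ m x|)%:E <= ((1 / 2) ^+ m)%:E) ->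
  {ae mu, forall x, v_ m x @[m --> \oo] --> fine (limn_esup (fun m => (v_ m x)%:E))}.
Proof.
move=> mv hv.
pose D m x := (`|v_ m.+1 x - v_ m x|)%:E.
have mD m : measurable_fun setT (D m).
  by apply/measurable_EFinP/measurableT_comp => //; exact: measurable_funB.
have D0 m x : 0 <= D m x by rewrite lee_fin.
have iD : mu.-integrable setT (fun x => \sum_(0 <= m <oo) D m x).
  apply/integrableP; split; first by apply: ge0_emeasurable_sum.
  under eq_integral do rewrite gee0_abs ?nneseries_ge0//.
  rewrite integral_nneseries//.
  apply: (@le_lt_trans _ _ (\sum_(0 <= m <oo) (1 * (1 / 2) ^+ m)%:E)).
    apply: lee_nneseries => [m _ _|m _]; last by rewrite mul1r; exact: hv.
    by apply: integral_ge0 => x _; exact: D0.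
  by rewrite nneseries_geometric ?ltry//; lra.
apply: filterS (integrable_ae measurableT iD) => x /(_ I) fx.
suff : cvg (v_ m x @[m --> \oo]).
  move=> /cvg_ex[l vl]; have := cvg_EFinT vl => /cvg_limn_einf_sup[_ ->] /=; exact: vl.
have : cvgn (series (telescope (v_^~ x))).
  apply: normed_cvg; apply: nondecreasing_is_cvgn.
    by apply: nondecreasing_series => m _ _; rewrite normr_ge0.
  exists (fine (\sum_(0 <= m <oo) D m x)) => _ [k _ <-] /=.
  rewrite -lee_fin fineK// /series/= -sumEFin; apply: nneseries_lim_ge => //.
rewrite telescopeK => h.
rewrite (_ : (fun m => v_ m x) = (fun m => (v_ m x - v_ 0%N x) + v_ 0%N x)%R); last by apply/funext => m; rewrite subrK.
exact: is_cvgD h (is_cvg_cst _).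
Qed.

End extraction.

Section real_integrals.
Context d (T : measurableType d) (R : realType) (mu : {measure set T -> \bar R}).
Local Open Scope ereal_scope.

Lemma integral_fin_ge0 (f : T -> R) : (forall x, (0 <= f x)%R) -> 0 <= \int[mu]_x (f x)%:E.
Proof. by move=> f0; apply: integral_ge0 => x _; rewrite lee_fin. Qed.

Lemma le_integral_fin (f g : T -> R) : (forall x, (0 <= f x)%R) -> (forall x, (f x <= g x)%R) ->
  \int[mu]_x (f x)%:E <= \int[mu]_x (g x)%:E.
Proof. by move=> f0 fg; apply: ge0_le_integralW => x _; rewrite lee_fin. Qed.

Lemma integral_finD (f g : T -> R) : measurable_fun setT f -> measurable_fun setT g ->
  (forall x, (0 <= f x)%R) -> (forall x, (0 <= g x)%R) ->
  \int[mu]_x (f x + g x)%:E = \int[mu]_x (f x)%:E + \int[mu]_x (g x)%:E.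
Proof.
move=> mf mg f0 g0; rewrite -ge0_integralD//; try by move=> x _; rewrite lee_fin.
all: by mfun.
Qed.

Lemma integral_finZ (c : R) (f : T -> R) : measurable_fun setT f ->
  (forall x, (0 <= f x)%R) -> (0 <= c)%R ->
  \int[mu]_x (c * f x)%:E = c%:E * \int[mu]_x (f x)%:E.
Proof.
move=> mf f0 c0; rewrite -ge0_integralZl//; first by mfun.
by move=> x _; rewrite lee_fin.
Qed.

Lemma integral_fin_indic (A : set T) : measurable A -> \int[mu]_x (\1_A x)%:E = mu A.
Proof. by move=> mA; rewrite integral_indic// setIT. Qed.

End real_integrals.

Lemma nneseries_term_le (R : realType) (u : nat -> \bar R) i : (forall k, 0 <= u k)%E ->
  (u i <= \sum_(0 <= k <oo) u k)%E.
Proof.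
move=> u0; apply: (@le_trans _ _ (\sum_(0 <= k < i.+1) u k)%E).
  by rewrite big_nat_recr//= leeDr// sume_ge0.
by apply: nneseries_lim_ge => k _ _.
Qed.

Lemma dyadic_gt1 (R : realType) (t : R) : 1 < t -> exists i : nat, 2 ^+ i < t <= 2 ^+ i.+1.
Proof.
move=> t1; have ex : exists i, t <= 2 ^+ i.
  exists (Num.truncn t).+1; apply/ltW/(lt_trans (truncnS_gt t)).
  rewrite -natrX ltr_nat; exact: ltn_expl.
have [[|i] ti imin] := ex_minnP ex.
  by move: ti; rewrite expr0 leNgt t1.
exists i; rewrite ti andbT ltNge; apply/negP => /imin; by rewrite ltnn.
Qed.

Lemma dyadic_le1 (R : realType) (t : R) : 0 < t <= 1 -> exists i : nat, (1 / 2) ^+ i.+1 < t <= (1 / 2) ^+ i.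
Proof.
move=> /andP[t0 t1]; move: t1; rewrite le_eqVlt => /predU1P[->|t1].
  by exists 0%N; rewrite expr1 expr0 lexx andbT; lra.
have [|i /andP[i1 i2]] := @dyadic_gt1 _ t^-1; first by rewrite invf_gt1.
(* Inversion exchanges the open and the closed end of the interval, so a power of [1 / 2] moves to
   the next index. *)
have [i3|i3] := leP t ((1/2) ^+ i.+1); last first.
  exists i; rewrite i3/= div1r exprVn -[leLHS]invrK lef_pV2 ?posrE ?exprn_gt0 ?invr_gt0//; exact: ltW.
exists i.+1; rewrite i3 andbT div1r exprVn -[ltRHS]invrK ltf_pV2 ?posrE ?exprn_gt0 ?invr_gt0//.
apply: le_lt_trans i2 _; rewrite [ltRHS]exprS ltr_pMl ?exprn_gt0//; lra.
Qed.

(** * Euclidean space and cubes *)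

Section geometry.
Context {R : realType} {n : nat}.
Implicit Types x y : 'rV[R]_n.
Local Notation leb := (@lebesgue_rV R n).

Lemma measurable_coord (i : 'I_n) : measurable_fun setT (fun x : 'rV[R]_n => x ord0 i).
Proof. apply: (continuous_measurable_rV (f := fun v : 'rV[R]_n => v ord0 i)); exact: coord_continuous. Qed.

Lemma enorm_ge0 x : 0 <= enorm x. Proof. exact: sqrtr_ge0. Qed.

Lemma enorm_sym x y : enorm (x - y) = enorm (y - x).
Proof.
rewrite /enorm; congr Num.sqrt; apply: eq_bigr => i _.
by rewrite !mxE -sqrrN opprB.
Qed.

Lemma enorm_eq0 x y : enorm (x - y) = 0 -> x = y.
Proof.
move/eqP; rewrite /enorm sqrtr_eq0 => h; apply/rowP => i.
have h0 : \sum_(i < n) ((x - y) ord0 i) ^+ 2 = 0.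
  by apply/eqP; rewrite eq_le h/= sumr_ge0// => j _; exact: sqr_ge0.
have /(_ i isT)/eqP := (psumr_eq0P (fun j _ => sqr_ge0 _) h0).
by rewrite sqrf_eq0 !mxE subr_eq0 => /eqP.
Qed.

Lemma coord_le_enorm x i : `|x ord0 i| <= enorm x.
Proof.
rewrite -sqrtr_sqr /enorm ler_sqrt; last by apply: sumr_ge0 => j _; exact: sqr_ge0.
by rewrite (bigD1 i)//= lerDl sumr_ge0// => j _; exact: sqr_ge0.
Qed.

Lemma enorm_le_coord x (r : R) : 0 <= r -> (forall i, `|x ord0 i| <= r) -> enorm x <= n%:R * r.
Proof.
move=> r0 h; rewrite -[leRHS]ger0_norm ?mulr_ge0// -sqrtr_sqr /enorm ler_sqrt ?sqr_ge0//.
apply: (@le_trans _ _ (\sum_(i < n) r ^+ 2)).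
  by apply: ler_sum => i _; rewrite -[leLHS]real_normK ?num_real// lerXn2r ?nnegrE.
rewrite sumr_const card_ord -[leLHS]mulr_natl exprMn ler_wpM2r ?sqr_ge0//.
by rewrite -natrX ler_nat; case: (n) => // m; rewrite expnS expn1 leq_pmulr.
Qed.

Lemma measurable_enorm : measurable_fun setT (fun z : 'rV[R]_n * 'rV[R]_n => enorm (z.1 - z.2)).
Proof.
rewrite (_ : (fun z => _) = (fun z : 'rV[R]_n * 'rV[R]_n => (\sum_(i < n) (z.1 - z.2) ord0 i ^+ 2) `^ 2^-1)); last first.
  by apply/funext => z; rewrite powR12_sqrt//; apply: sumr_ge0 => i _; exact: sqr_ge0.
apply: (measurableT_comp (measurable_powR _)); apply: measurable_sum => i.
rewrite (_ : (fun _ => _) = (fun z : 'rV[R]_n * 'rV[R]_n => (z.1 ord0 i - z.2 ord0 i) ^+ 2)); last first.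
  by apply/funext => z; rewrite !mxE.
have mi := measurable_coord i; apply: measurable_funX; apply: measurable_funB.
+ by apply: (measurableT_comp mi); exact: measurable_fst.
+ by apply: (measurableT_comp mi); exact: measurable_snd.
Qed.

(** Cubes stand in for Euclidean balls: their volume is explicit, and passing between the two costs
    at most a factor [n]. *)
Definition box x (r : R) : set 'rV[R]_n := [set y | forall i, `|y ord0 i - x ord0 i| <= r].

Lemma boxE x r : box x r = [set v | forall i, (`[x ord0 i - r, x ord0 i + r]%classic) (v ord0 i)].
Proof. by apply/seteqP; split => v /= h i; have := h i; rewrite /= in_itv/= ler_distl. Qed.

Lemma measurable_box x r : measurable (box x r).
Proof.
rewrite (_ : box x r = \bigcap_(i in [set: 'I_n])
    (fun v : 'rV[R]_n => v ord0 i) @^-1` (`[x ord0 i - r, x ord0 i + r]%classic)); last first.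
  by rewrite boxE; apply/seteqP; split => v /= h i => [_|]; exact: h.
apply: fin_bigcap_measurable => // i _; rewrite -[X in measurable X]setTI.
by apply: measurable_coord => //; exact: measurable_itv.
Qed.

Lemma lebesgue_box x r : 0 <= r -> leb (box x r) = ((2 * r) ^+ n)%:E.
Proof.
move=> r0; rewrite boxE (lebesgue_rV_box (A := fun i => `[x ord0 i - r, x ord0 i + r]%classic)); last first.
  by move=> i; exact: measurable_itv.
rewrite (eq_bigr (fun=> (2 * r)%:E)); last first.
  move=> i _; rewrite /= lebesgue_measure_itv/= lte_fin; case: ltP => h.
    by rewrite -EFinD; congr EFin; ring.
  by congr EFin; lra.
rewrite prodEFin; congr EFin; by rewrite big_const_ord iter_mulr_1.
Qed.

Lemma enorm_le_box x y r : enorm (x - y) <= r -> box x r y.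
Proof. by move=> h i; apply: le_trans h; rewrite enorm_sym; apply: le_trans (coord_le_enorm _ i); rewrite !mxE. Qed.

Lemma box_enorm_le x y r : 0 <= r -> box x r y -> enorm (x - y) <= n%:R * r.
Proof. by move=> r0 h; rewrite enorm_sym; apply: enorm_le_coord => // i; rewrite !mxE; exact: h. Qed.

Lemma measurable_enorm2 x : measurable_fun setT (fun y : 'rV[R]_n => enorm (x - y)).
Proof.
apply: (measurableT_comp measurable_enorm (_ : measurable_fun setT (fun y : 'rV[R]_n => (x, y)))).
exact: measurable_fun_pair.
Qed.

End geometry.

(** * Near and far kernels *)

Section kernels.
Context {R : realType} {n : nat}.
Implicit Types x y : 'rV[R]_n.
Local Notation leb := (@lebesgue_rV R n).

(** Radial profiles of the singular part and of the tail of a kernel at unit scale; [e > 0] is the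
    margin by which each is integrable in dimension [n]. *)
Definition knear (e t : R) : R := if t <= 1 then t `^ (e - n%:R) else 0.
Definition kfar (e t : R) : R := if t <= 1 then 0 else t `^ (- (n%:R + e)).

Lemma knear_ge0 e t : 0 <= knear e t.
Proof. by rewrite /knear; case: ifP => // _; exact: powR_ge0. Qed.
Lemma kfar_ge0 e t : 0 <= kfar e t.
Proof. by rewrite /kfar; case: ifP => // _; exact: powR_ge0. Qed.
Lemma measurable_knear e : measurable_fun setT (knear e).
Proof. rewrite /knear; mfun. Qed.
Lemma measurable_kfar e : measurable_fun setT (kfar e).
Proof. rewrite /kfar; mfun. Qed.

(** Sum of the geometric series of ratio [2^-e] produced by the dyadic shells, with a volume factor
    [4^n] that absorbs the rounding to powers of two. *)
Definition geomc (e : R) : R := 4 ^+ n / (1 - 2 `^ (- e)).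

Lemma powR2N_lt1 (e : R) : 0 < e -> 0 < (2 : R) `^ (- e) < 1.
Proof.
move=> e0; rewrite powR_gt0//= powRN invf_lt1 ?powR_gt0//.
have : (1 : R) `^ e < 2 `^ e by apply: gt0_ltr_powR; rewrite ?nnegrE//; lra.
by rewrite powR1.
Qed.

Lemma geomc_gt0 e : 0 < e -> 0 < geomc e.
Proof. by move=> /powR2N_lt1/andP[_ h]; rewrite divr_gt0 ?exprn_gt0 ?subr_gt0. Qed.

(** The profile is dominated by a series of multiples of indicators of concentric cubes; the last
    hypothesis makes the integrated series geometric. *)
Lemma radial_integral_le (k : R -> R) (c rho : nat -> R) (e : R) x (r : R) :
  0 < r -> 0 < e -> measurable_fun setT k -> (forall t, 0 <= k t) ->
  (forall i, 0 <= c i) -> (forall i, 0 <= rho i) ->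
  (forall t, 0 <= t -> k t != 0 -> exists i, t <= rho i /\ k t <= c i) ->
  (forall i, c i * (2 * (rho i * r)) ^+ n <= (4 * r) ^+ n * (2 `^ (- e)) ^+ i) ->
  (\int[leb]_y (k (enorm (x - y) / r))%:E <= (geomc e * r ^+ n)%:E)%E.
Proof.
move=> r0 e0 mk k0 c0 rho0 kc crho.
have me := measurable_enorm2 x.
have mb i : measurable (box x (rho i * r)) by exact: measurable_box.
apply: (@le_trans _ _ (\int[leb]_y \sum_(0 <= i <oo) (c i * \1_(box x (rho i * r)) y)%:E)%E).
  apply: ge0_le_integralW => y _; first by rewrite lee_fin.
  have s0 i : (0 <= (c i * \1_(box x (rho i * r)) y)%:E)%E by rewrite lee_fin mulr_ge0.
  have [->|kn0] := eqVneq (k (enorm (x - y) / r)) 0; first exact: nneseries_ge0.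
  have [|i [ti ki]] := kc _ _ kn0; first by rewrite divr_ge0 ?enorm_ge0 ?ltW.
  apply: le_trans (nneseries_term_le i s0).
  rewrite lee_fin indicE mem_set ?mulr1//.
  by apply: enorm_le_box; rewrite -ler_pdivrMr.
rewrite integral_nneseries//; last 2 first.
- by move=> i; mfun; exact: mb.
- by move=> i y _; rewrite lee_fin mulr_ge0.
apply: (@le_trans _ _ (\sum_(0 <= i <oo) ((4 * r) ^+ n * (2 `^ (- e)) ^+ i)%:E)%E).
  apply: lee_nneseries => [i _ _|i _].
    by apply: integral_fin_ge0 => y; rewrite mulr_ge0.
  rewrite integral_finZ//.
  rewrite integral_fin_indic// [X in (_ * X)%E](_ : _ = ((2 * (rho i * r)) ^+ n)%:E); last first.
    by apply: lebesgue_box; rewrite mulr_ge0 ?(ltW r0).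
  by rewrite -EFinM lee_fin; exact: crho.
have /andP[z0 z1] := powR2N_lt1 e0.
rewrite nneseries_geometric ?(ltW z0)//; last by rewrite exprn_ge0// mulr_ge0// ltW.
by rewrite lee_fin /geomc exprMn mulrAC.
Qed.

Lemma knear_integral_le (e : R) x (r : R) : 0 < e -> 0 < r ->
  (\int[leb]_y (knear e (enorm (x - y) / r))%:E <= (geomc e * r ^+ n)%:E)%E.
Proof.
move=> e0 r0; set z : R := 2 `^ (- e).
have z0 : 0 < z by exact: powR_gt0.
(* On [2^-(i + 1) < t <= 2^-i] the factor [t^-n] is at most [2^(n (i + 1))] and [t^e] at most [z^i].
   The point [t = 0] is put into the shell [i = 0]. *)
apply: (@radial_integral_le _ (fun i => 2 ^+ n * (2 ^+ n * z) ^+ i) (fun i => (1 / 2) ^+ i)) => //.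
- exact: measurable_knear.
- exact: knear_ge0.
- by move=> i; rewrite mulr_ge0 ?exprn_ge0 ?mulr_ge0 ?(ltW z0)//.
- move=> t; rewrite /knear; case: ifP => [t1|_ _]; last by rewrite eqxx.
  rewrite le_eqVlt => /predU1P[<- _|t0 _].
    exists 0%N; rewrite !expr0 mulr1; split=> //.
    have [->|h] := eqVneq (e - n%:R) 0; first by rewrite powRr0 exprn_ege1//; lra.
    by rewrite powR0// exprn_ge0.
  have [|i /andP[i1 i2]] := @dyadic_le1 _ t; first by rewrite t0.
  exists i; split => //; rewrite powRD; last by apply/implyP => _; rewrite gt_eqF.
  rewrite exprMn [2 ^+ n * _]mulrA -exprS mulrC; apply: ler_pM; rewrite ?powR_ge0//.
    rewrite powRN powR_mulrn ?(ltW t0)// -exprM mulnC exprM -exprVn lerXn2r ?nnegrE ?invr_ge0 ?exprn_ge0 ?(ltW t0)//.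
    by rewrite -[leRHS]invrK lef_pV2 ?posrE ?invr_gt0 ?exprn_gt0// -exprVn -div1r ltW.
  have -> : z ^+ i = ((1 / 2) ^+ i) `^ e.
    have -> : z = (1 / 2) `^ e by rewrite /z div1r -powR_inv1// -powRrM mulN1r.
    by rewrite -powR_mulrn ?powR_ge0// powRAC powR_mulrn// divr_ge0.
  by apply: ge0_ler_powR; rewrite ?nnegrE ?(ltW e0) ?(ltW t0) ?exprn_ge0 ?divr_ge0.
- move=> i; rewrite le_eqVlt; apply/orP; left; apply/eqP.
  have hD : ((1 / 2 : R) ^+ i) ^+ n = ((2 ^+ n) ^+ i)^-1.
    by rewrite -exprM mulnC exprM div1r !exprVn.
  rewrite [(2 ^+ n * z) ^+ i]exprMn [(2 * _) ^+ n]exprMn [((1 / 2) ^+ i * r) ^+ n]exprMn hD [(4 * r) ^+ n]exprMn.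
  have -> : (4 : R) ^+ n = 2 ^+ n * 2 ^+ n by rewrite -exprMn; congr (_ ^+ _); ring.
  have : ((2 : R) ^+ n) ^+ i != 0 by rewrite !expf_neq0//.
  move: (((2 : R) ^+ n) ^+ i) (z ^+ i) ((2 : R) ^+ n) (r ^+ n) => A Z B C A0.
  by field.
Qed.

Lemma kfar_integral_le (e : R) x (r : R) : 0 < e -> 0 < r ->
  (\int[leb]_y (kfar e (enorm (x - y) / r))%:E <= (geomc e * r ^+ n)%:E)%E.
Proof.
move=> e0 r0; set z : R := 2 `^ (- e).
have z0 : 0 < z by exact: powR_gt0.
(* On [2^i < t <= 2^(i + 1)] the profile is at most its value at [2^i], while the cube needs the
   outer radius. *)
apply: (@radial_integral_le _ (fun i => ((2 ^+ n)^-1 * z) ^+ i) (fun i => 2 ^+ i.+1)) => //.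
- exact: measurable_kfar.
- exact: kfar_ge0.
- by move=> i; rewrite exprn_ge0// mulr_ge0 ?invr_ge0 ?exprn_ge0// ltW.
- move=> t t0; rewrite /kfar; case: ifP => [_|/negbT]; first by rewrite eqxx.
  rewrite -ltNge => t1 _; have [i /andP[i1 i2]] := @dyadic_gt1 _ t t1.
  exists i; split => //.
  have -> : ((2 ^+ n)^-1 * z) = 2 `^ (- (n%:R + e)).
    rewrite opprD powRD; last by apply/implyP => _.
    by rewrite powRN powR_mulrn.
  rewrite -powR_mulrn ?powR_ge0// powRAC powR_mulrn// !powRN lef_pV2 ?posrE ?powR_gt0 ?exprn_gt0//; last exact: lt_trans t1.
  by apply: ge0_ler_powR; rewrite ?nnegrE ?exprn_ge0// ?addr_ge0 ?(ltW e0)// ltW.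
- move=> i; rewrite le_eqVlt; apply/orP; left; apply/eqP.
  rewrite !exprMn exprS exprMn -(exprM 2 i n) (mulnC i) exprM exprVn.
  have -> : (4 : R) ^+ n = 2 ^+ n * 2 ^+ n by rewrite -exprMn; congr (_ ^+ _); ring.
  have : ((2 : R) ^+ n) ^+ i != 0 by rewrite !expf_neq0//.
  move: (((2 : R) ^+ n) ^+ i) (z ^+ i) ((2 : R) ^+ n) (r ^+ n) => A Z B C A0.
  by field.
Qed.

(** By Tonelli each summand is integrated first in the variable on which [g] does not depend, where
    the kernel has mass at most [C]. *)
Lemma kernel_double_integral_le (k : R -> R) (C : R) (r : R) (g : 'rV[R]_n -> R) :
  measurable_fun setT k -> (forall t, 0 <= k t) -> 0 <= C ->
  (forall x, (\int[leb]_y (k (enorm (x - y) / r))%:E <= C%:E)%E) ->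
  measurable_fun setT g -> (forall x, 0 <= g x) ->
  (\int[leb \x leb]_z ((g z.1 + g z.2) * k (enorm (z.1 - z.2) / r))%:E <=
    (2 * C)%:E * \int[leb]_x (g x)%:E)%E.
Proof.
move=> mk k0 C0 hk mg g0.
have me := @measurable_enorm R n.
have me2 := @measurable_enorm2 R n.
have H x : (\int[leb]_y ((g x * k (enorm (x - y) / r)))%:E <= C%:E * (g x)%:E)%E.
  have := me2 x => mex; rewrite integral_finZ//; last by mfun.
  by rewrite muleC lee_wpmul2r// lee_fin.
have I : (\int[leb]_x \int[leb]_y ((g x * k (enorm (x - y) / r)))%:E <= C%:E * \int[leb]_x (g x)%:E)%E.
  rewrite -ge0_integralZl//; last 2 first.
  - by mfun.
  - by move=> x _; rewrite lee_fin.
  by apply: ge0_le_integralW => x _ //; apply: integral_fin_ge0 => y; rewrite mulr_ge0.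
under eq_integral do rewrite mulrDl.
rewrite integral_finD; last 4 first.
- by mfun.
- by mfun.
- by move=> z; rewrite mulr_ge0.
- by move=> z; rewrite mulr_ge0.
rewrite (_ : (2 * C)%:E = (C%:E + C%:E))%E; last by rewrite -EFinD; congr EFin; ring.
rewrite ge0_muleDl ?lee_fin//; apply: leeD.
  rewrite fubini_tonelli1; last 2 first.
  - by mfun.
  - by move=> z; rewrite lee_fin mulr_ge0.
  by rewrite /fubini_F; exact: I.
rewrite fubini_tonelli2; last 2 first.
- by mfun.
- by move=> z; rewrite lee_fin mulr_ge0.
rewrite /fubini_G; apply: le_trans I; apply: ge0_le_integralW => x _ /=.
  by apply: integral_fin_ge0 => y; rewrite mulr_ge0.
rewrite le_eqVlt; apply/orP; left; apply/eqP; apply: eq_integral => y _ /=.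
by rewrite enorm_sym.
Qed.

(** The kernel of order [n + a] at distance [n] times the half-side of a cube of volume [2]; no
    point of the cube is farther from its centre. *)
Definition kernc (a : R) : R := ((n%:R * 2 `^ n%:R^-1) / 2) `^ (- (n%:R + a)).

(** A cube around [x] with twice the volume allowed for [E] keeps at least the volume [b r^n]
    outside [E], and there the kernel is at least its value at the largest distance. The powers of
    [b] combine to [b^(1 - (n + a) / n)]. *)
Lemma kernel_outside_ge (E : set 'rV[R]_n) (b r a : R) x :
  (0 < n)%N -> measurable E -> 0 < b -> 0 < r -> 0 < a ->
  (leb E <= (b * r ^+ n)%:E)%E ->
  ((kernc a * b `^ (- (a / n%:R)) * r ^+ n)%:E <=
   \int[leb]_(y in ~` E) ((enorm (x - y) / r) `^ (- (n%:R + a)))%:E)%E.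
Proof.
move=> n0 mE b0 r0 a0 hE.
have n0R : 0 < n%:R :> R by rewrite ltr0n.
pose rho := (2 * b) `^ n%:R^-1 / 2 * r.
have rho0 : 0 < rho by rewrite mulr_gt0// divr_gt0// powR_gt0// mulr_gt0.
have hrho : (2 * rho) ^+ n = 2 * b * r ^+ n.
  rewrite /rho (_ : 2 * _ = (2 * b) `^ n%:R^-1 * r); last by field.
  by rewrite exprMn -[X in X * _ = _]powR_mulrn ?powR_ge0// -powRrM mulVf ?gt_eqF// powRr1// mulr_ge0// ltW.
(* The centre is removed: a negative power of [0] is [0], which would break the lower bound at this
   point. *)
pose B := (box x rho `\` E) `\` box x 0.
have mB0 : measurable (box x rho `\` E) by apply: measurableD => //; exact: measurable_box.
have mB : measurable B by apply: measurableD => //; exact: measurable_box.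
have l0 : leb (box x 0) = 0%E by rewrite lebesgue_box// mulr0 expr0n gtn_eqF.
have hB : ((b * r ^+ n)%:E <= leb B)%E.
  have : (leb (box x rho) <= leb E + leb B)%E.
    apply: (@le_trans _ _ (leb (E `|` B `|` box x 0))).
      apply: le_measure; rewrite ?inE; try exact: measurable_box.
        by apply: measurableU; [exact: measurableU|exact: measurable_box].
      move=> y hy; have [|yE] := pselect (E y); first by left; left.
      by have [|y0] := pselect (box x 0 y); [right|left; right].
    have h1 : (leb (E `|` B `|` box x 0) <= leb (E `|` B) + leb (box x 0))%E.
      by apply: measureU2; [exact: measurableU|exact: measurable_box].
    apply: (le_trans h1); rewrite l0 adde0; exact: measureU2.
  rewrite lebesgue_box ?(ltW rho0)// hrho => h.
  have := le_trans h (leeD2r _ hE); rewrite -leeBlDl//; apply: le_trans.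
  by rewrite -EFinB lee_fin; lra.
have kx : n%:R * rho / r = (n%:R * 2 `^ n%:R^-1) / 2 * b `^ n%:R^-1.
  rewrite /rho powRM ?(ltW b0)//; by field; rewrite ?gt_eqF.
apply: (@le_trans _ _ (\int[leb]_(y in B) (((n%:R * rho / r) `^ (- (n%:R + a)))%:E))%E).
  rewrite integral_cst//; apply: (@le_trans _ _ (((n%:R * rho / r) `^ (- (n%:R + a)))%:E * (b * r ^+ n)%:E)%E); last first.
    by rewrite lee_wpmul2l// lee_fin powR_ge0.
  rewrite -EFinM lee_fin kx powRM ?powR_ge0 ?divr_ge0 ?mulr_ge0 ?powR_ge0 ?(ltW n0R)//.
  rewrite -/(kernc a) mulrA ler_wpM2r ?exprn_ge0 ?(ltW r0)// -mulrA ler_wpM2l ?powR_ge0//.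
  rewrite -powRrM -[X in _ <= _ * X](powRr1 (ltW b0)) -powRD; last by apply/implyP => _; rewrite gt_eqF.
  rewrite le_eqVlt; apply/orP; left; apply/eqP; congr (_ `^ _); by field; rewrite ?gt_eqF.
rewrite integral_mkcond [leRHS]integral_mkcond; apply: ge0_le_integralW => y _.
  by rewrite patchE; case: ifP => // _; rewrite lee_fin powR_ge0.
rewrite !patchE; case: ifPn => [|_]; last by case: ifP => // _; rewrite lee_fin powR_ge0.
rewrite inE => -[[yb yE] y0]; rewrite mem_set// lee_fin.
have e0 : 0 < enorm (x - y).
  rewrite lt_neqAle enorm_ge0 andbT eq_sym; apply/eqP => /enorm_eq0 xy.
  by apply: y0 => i; rewrite xy subrr normr0.
have h1 : 0 < n%:R * rho / r by rewrite divr_gt0 ?r0//; apply: mulr_gt0.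
have h2 : 0 < enorm (x - y) / r by rewrite divr_gt0.
rewrite !powRN lef_pV2 ?posrE; [|exact: powR_gt0|exact: powR_gt0].
have re0 : 0 <= n%:R * rho by rewrite mulr_ge0 ?(ltW n0R) ?(ltW rho0).
apply: ge0_ler_powR.
- by rewrite addr_ge0 ?(ltW n0R) ?(ltW a0).
- by rewrite nnegrE divr_ge0 ?enorm_ge0 ?(ltW r0).
- by rewrite nnegrE divr_ge0 ?re0 ?(ltW r0).

by rewrite ler_pM2r ?invr_gt0//; apply: box_enorm_le => //; exact: ltW.
Qed.

End kernels.

(** * Powers and growth of Phi *)

Section powers.
Context {R : realType}.

(** Above the threshold [e^(-1 / (b - a))] the power [t^a] is below [e t^b]; below the threshold it
    is bounded. This supplies the uniform integrability hypothesis of [equiintegrable_cvg0]. *)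
Lemma powR_le_addZ (a b e : R) : 0 < a < b -> 0 < e ->
  exists2 N : R, 0 <= N & forall t, 0 <= t -> t `^ a <= N + e * t `^ b.
Proof.
move=> /andP[a0 ab] e0; pose N := e^-1 `^ (b - a)^-1.
exists (N `^ a); first exact: powR_ge0.
move=> t t0; have [tN|Nt] := leP t N.
  apply: (@le_trans _ _ (N `^ a)); first by apply: ge0_ler_powR; rewrite ?nnegrE ?powR_ge0// ltW.
  by rewrite lerDl mulr_ge0 ?powR_ge0// ltW.
apply: (@le_trans _ _ (e * t `^ b)); last by rewrite lerDr powR_ge0.
have N0 : 0 < N by rewrite powR_gt0// invr_gt0.
have tp : 0 < t by exact: lt_trans Nt.
rewrite -(subrK a b) powRD; last by apply/implyP => _; rewrite gt_eqF.
rewrite mulrA ler_peMl ?powR_ge0// -ler_pdivrMl// mulr1.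
have -> : e^-1 = N `^ (b - a).
  by rewrite /N -powRrM mulVf ?powRr1 ?invr_ge0 ?(ltW e0)// subr_eq0 gt_eqF.
by apply: ge0_ler_powR; rewrite ?nnegrE ?subr_ge0 ?ltW.
Qed.

(** Either [t <= A] or [t <= A (t / A)^p]. The free threshold lets this take the place of Hölder's
    inequality. *)
Lemma le_add_powR (p A t : R) : 1 <= p -> 0 < A -> 0 <= t -> t <= A + A `^ (1 - p) * t `^ p.
Proof.
move=> p1 A0 t0; have [tA|At] := leP t A.
  by apply: (le_trans tA); rewrite lerDl mulr_ge0 ?powR_ge0.
apply: (@le_trans _ _ (A `^ (1 - p) * t `^ p)); last by rewrite lerDr ltW.
have tp : 0 < t by exact: lt_trans At.
have -> : t `^ p = t * t `^ (p - 1) by rewrite mulr_powRB1//; lra.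
rewrite mulrCA ler_peMr// -[1 - p]opprB powRN mulrC ler_pdivlMr ?powR_gt0// mul1r.
by apply: ge0_ler_powR; rewrite ?nnegrE ?subr_ge0 ?(ltW A0) ?(ltW tp) ?(ltW At).
Qed.

Lemma powR_add_le (p a b : R) : 0 <= p -> 0 <= a -> 0 <= b ->
  (a + b) `^ p <= 2 `^ p * (a `^ p + b `^ p).
Proof.
move=> p0.
have H (x y : R) : 0 <= x -> x <= y -> (x + y) `^ p <= 2 `^ p * (x `^ p + y `^ p).
  move=> x0 xy; have y0 := le_trans x0 xy.
  apply: (@le_trans _ _ ((2 * y) `^ p)).
    by apply: ge0_ler_powR; rewrite ?nnegrE ?addr_ge0 ?mulr_ge0//; lra.
  by rewrite powRM// ler_wpM2l ?powR_ge0// lerDr powR_ge0.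
by move=> a0 b0; have [ab|/ltW ba] := leP a b; [exact: H|rewrite addrC [a `^ p + _]addrC; exact: H].
Qed.

Lemma MVT_line (f df : R -> R) (a b : R) : (forall x : R, is_derive x (1 : R) f (df x)) ->
  exists2 c, (Num.min a b <= c <= Num.max a b) & f b - f a = df c * (b - a).
Proof.
move=> fd; have H x y : x <= y -> exists2 c, x <= c <= y & f y - f x = df c * (y - x).
  move=> xy; have cf : {within `[x, y], continuous f}.
    by apply: derivable_within_continuous => z _; have [] := fd z.
  have [c] := MVT_segment xy (fun z _ => fd z) cf.
  by rewrite in_itv/=; exists c.
have [ab|/ltW ba] := leP a b; first exact: H.
have [c cb e] := H _ _ ba; exists c => //.
by rewrite -[LHS]opprB e -mulrN opprB.
Qed.

(** Vanishing on the left half-line makes [f] integrable from [-oo], so the integral from there is a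
    primitive. *)
Lemma primitive_pos (f : R -> R) : continuous f -> (forall x, x <= 0 -> f x = 0) ->
  exists F : R -> R, forall x : R, is_derive x (1 : R) F (f x).
Proof.
move=> cf f0; exists (fun x => \int[lebesgue_measure]_(t in `]-oo, x]) f t)%R => x.
have i1 : lebesgue_measure.-integrable [set` `]-oo, (x + 1)%R]] (EFin \o f).
  have [x0|x0] := leP (x + 1) 0.
    apply: (@eq_integrable _ _ _ _ _ _ (cst 0%E)) => //; last exact: integrable0.
    by move=> z; rewrite inE/= in_itv/= => zx; rewrite f0//; exact: le_trans x0.
  have : lebesgue_measure.-integrable `[0, x + 1] (EFin \o f).
    apply: continuous_compact_integrable; first exact: segment_compact.
    exact: continuous_subspaceT.
  move/integrable_mkcond => /(_ (measurable_itv _)) h.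
  apply/integrable_mkcond; first exact: measurable_itv.
  apply: eq_integrable h => // z _; rewrite !patchE !mem_setE !in_itv/=.
  case: (leP 0 z) => z0 /=; first by [].
  by case: ifP => // _; rewrite f0// ltW.
have x1 : x < x + 1 by rewrite ltrDl.
have [|D1 D2] := @continuous_FTC1 R f -oo%O x (x + 1) x1 i1 _ (cf x); first by rewrite /Order.lt/=.
by apply: DeriveDef => //; rewrite -D2 derive1E.
Qed.

(** The condition [f 0 = 0] lets [f] be cut at [0] into two continuous halves; the left one is
    reflected to fit [primitive_pos]. *)
Lemma primitive (f : R -> R) : continuous f -> f 0 = 0 ->
  exists F : R -> R, F 0 = 0 /\ forall x : R, is_derive x (1 : R) F (f x).
Proof.
move=> cf f0.
have cmax : continuous (fun x : R => Num.max x 0).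
  by move=> x; apply: continuous_max; [exact: cvg_id|exact: cvg_cst].
have c2 : continuous (fun x : R => - Num.max x 0) by move=> x; apply: cvgN; exact: cmax.
have c1 : continuous (f \o (fun x : R => - Num.max x 0)).
  by move=> x; apply: continuous_comp; [exact: c2|exact: cf].
have c3 : continuous (f \o (fun x : R => Num.max x 0)).
  by move=> x; apply: continuous_comp; [exact: cmax|exact: cf].
have [|x x0|F1 dF1] := @primitive_pos (fun x => f (Num.max x 0)).
- exact: c3.
- by rewrite max_r.
have [|x x0|F2 dF2] := @primitive_pos (fun x => - f (- Num.max x 0)).
- by move=> x; apply: cvgN; exact: c1.
- by rewrite max_r// oppr0 f0 oppr0.
pose F x := F1 x + F2 (- x).
have dF (x : R) : is_derive x (1 : R) F (f x).
  have d2 : is_derive x (1 : R) (F2 \o -%R) (- f (- Num.max (- x) 0) * (-1)).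
    have := is_derive1_comp (dF2 (- x)) (is_deriveN (is_derive_id x (1 : R))); apply.
  apply: (is_derive_eq (is_deriveD (dF1 x) d2)).
  rewrite mulrN1 opprK; case: (leP 0 x) => x0.
    by rewrite max_r ?oppr_le0// oppr0 f0 addr0.
  by rewrite max_l ?oppr_ge0 ?(ltW x0)// opprK f0 add0r.
exists (fun x => F x - F 0); split; first by rewrite subrr.
move=> x; apply: (is_derive_eq (is_deriveD (dF x) (is_derive_cst (- F 0) x 1))).
by rewrite addr0.
Qed.

Section growth.
Variables (Phi : R -> R) (p L : R).
Hypotheses (cPhi : continuous Phi) (p1 : 1 < p) (L1 : 1 <= L)
  (hPhi : forall t, L^-1 * `|t| `^ p <= Phi t * t <= L * `|t| `^ p).
Let p0 : 0 < p. Proof. exact: lt_trans p1. Qed.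
Let L0 : 0 < L. Proof. exact: lt_le_trans L1. Qed.

Lemma growth_sign t : 0 <= Phi t * t.
Proof. have /andP[h _] := hPhi t; apply: le_trans h; by rewrite mulr_ge0 ?powR_ge0 ?invr_ge0// ltW. Qed.

(** A nonzero value would persist near [0] by continuity and contradict the sign of [Phi t * t] on
    one side. *)
Lemma growth0 : Phi 0 = 0.
Proof.
apply/eqP; rewrite eq_le; apply/andP; split; rewrite leNgt; apply/negP => h.
  have /(_ (0 : R))/cvgrPdist_lt/(_ _ h)/nbhs_ballP[e/= e0 he] := cPhi.
  have b : ball (0 : R) e (- (e / 2)).
    by rewrite -ball_normE/= sub0r opprK ger0_norm; lra.
  have := he _ b; rewrite ltr_distl => /andP[_].
  by have := growth_sign (- (e / 2)); rewrite mulrN oppr_ge0 pmulr_lle0 ?divr_gt0//; lra.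
have h' : 0 < - Phi 0 by rewrite oppr_gt0.
have /(_ (0 : R))/cvgrPdist_lt/(_ _ h')/nbhs_ballP[e/= e0 he] := cPhi.
have b : ball (0 : R) e (e / 2).
  by rewrite -ball_normE/= sub0r normrN ger0_norm; lra.
have := he _ b; rewrite ltr_distl => /andP[].
by have := growth_sign (e / 2); rewrite pmulr_lge0 ?divr_gt0//; lra.
Qed.

Lemma growth_le t : `|Phi t| <= L * `|t| `^ (p - 1).
Proof.
have [->|t0] := eqVneq t 0; first by rewrite growth0 normr0 mulr_ge0 ?powR_ge0 ?ltW.
have t0' : 0 < `|t| by rewrite normr_gt0.
rewrite -(ler_pM2r t0') -mulrA [_ `^ _ * _]mulrC mulr_powRB1 ?normr_ge0//.
by rewrite -normrM ger0_norm ?growth_sign//; have /andP[] := hPhi t.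
Qed.

(** For [t != 0], [Phi t * s] is [Phi t * t] times the nonnegative number [t s / t^2], so the lower
    bound scales. It is applied with [s] an increment of [psi u]. *)
Lemma growth_ge t s : 0 <= t * s -> L^-1 * (`|t| `^ (p - 1) * `|s|) <= Phi t * s.
Proof.
move=> ts; have [->|t0] := eqVneq t 0.
  by rewrite growth0 mul0r normr0 powR0 ?mul0r ?mulr0// subr_eq0 gt_eqF.
have t2 : 0 < t ^+ 2 by rewrite exprn_even_gt0.
have -> : Phi t * s = (Phi t * t) * (t * s / t ^+ 2) by field.
have -> : `|t| `^ (p - 1) * `|s| = `|t| `^ p * (t * s / t ^+ 2).
  have ht : `|t| != 0 by rewrite normr_eq0.
  have -> : t * s / t ^+ 2 = `|s| / `|t|.
    by rewrite -[t * s]ger0_norm// normrM -[t ^+ 2]real_normK ?num_real//; field.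
  by rewrite -(mulr_powRB1 (normr_ge0 t) p0); field.
rewrite mulrA ler_wpM2r ?divr_ge0 ?(ltW t2)//; by have /andP[] := hPhi t.
Qed.

(** For the lower bound, [F (t / 2) >= 0] is dropped and the mean value theorem is applied between
    [t / 2] and [t], where the intermediate point has size comparable to [|t|]; no monotonicity of
    [Phi] enters. The third clause will dominate difference quotients. *)
Lemma growth_primitive : exists F : R -> R, [/\ forall x : R, is_derive x (1 : R) F (Phi x),
   exists2 c, 0 < c & forall t, c * `|t| `^ p <= F t,
   forall a b, `|F (a + b) - F a| <= L * (`|a| + `|b|) `^ (p - 1) * `|b| &
   forall t, F t <= L * `|t| `^ p].
Proof.
have [F [F0 dF]] := primitive cPhi growth0; exists F.
have H a b : `|F (a + b) - F a| <= L * (`|a| + `|b|) `^ (p - 1) * `|b|.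
  have [c cab ->] := MVT_line a (a + b) dF.
  rewrite addrAC subrr add0r normrM ler_wpM2r//.
  apply: (le_trans (growth_le c)); rewrite ler_wpM2l ?(ltW L0)//.
  have ca : `|c| <= `|a| + `|b|.
    have := ler_norm a; have := ler_norm b; have := ler_norm (- b); have := ler_norm (- a).
    rewrite !normrN => h1 h2 h3 h4; rewrite ler_norml.
    by move: cab; rewrite ge_min le_max => /andP[/orP[h5|h5] /orP[h6|h6]]; apply/andP; split; lra.
  by apply: ge0_ler_powR; rewrite ?nnegrE ?subr_ge0 ?addr_ge0 ?(ltW p1).
split=> // [|t]; last first.
  have := H 0 t; rewrite add0r F0 subr0 normr0 add0r -mulrA [_ `^ _ * _]mulrC mulr_powRB1//.
  by apply: le_trans; exact: ler_norm.
exists ((2 * L)^-1 * 2^-1 `^ p); first by rewrite mulr_gt0 ?powR_gt0 ?invr_gt0 ?mulr_gt0.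
move=> t.
have h1 : 0 <= F (t / 2).
  have [c cab] := MVT_line 0 (t / 2) dF; rewrite F0 !subr0 => ->.
  have [->|c0] := eqVneq c 0; first by rewrite growth0 mul0r.
  have : 0 <= Phi c * c * (t / 2 / c).
    rewrite mulr_ge0 ?growth_sign//.
    have [t0|t0] := leP 0 t.
      by rewrite divr_ge0//; move: cab; rewrite min_l// ?divr_ge0//; lra.
    by rewrite -mulrNN -invrN mulr_ge0 ?invr_ge0; move: cab; rewrite ?max_l// ?min_r//; lra.
  by congr (_ <= _); field.
have [c cab e] := MVT_line (t / 2) t dF.
have [->|t0] := eqVneq t 0; first by rewrite F0 normr0 powR0 ?mulr0// gt_eqF.
have {}e : F t = F (t / 2) + Phi c * (t / 2) by rewrite -[LHS](subrK (F (t / 2))) e; field.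
rewrite e; apply: ler_wpDl => //.
have [c0 [ct tc]] : c != 0 /\ (1 <= t / c /\ `|t / 2| <= `|c|).
  have [tp|tn] := ltP 0 t.
    have cp : t / 2 <= c <= t by move: cab; rewrite min_l ?max_r//; lra.
    have c0 : 0 < c by lra.
    by split; [rewrite gt_eqF|split; [rewrite ler_pdivlMr//|rewrite !ger0_norm]; lra].
  have {}tn : t < 0 by rewrite lt_neqAle t0.
  have cp : t <= c <= t / 2 by move: cab; rewrite min_r ?max_l//; lra.
  have c0 : c < 0 by lra.
  by split; [rewrite lt_eqF|split; [rewrite ler_ndivlMr//|rewrite !ler0_norm]; lra].
have -> : Phi c * (t / 2) = 2^-1 * (Phi c * c) * (t / c) by field.
apply: (@le_trans _ _ (2^-1 * (Phi c * c))); last by rewrite ler_peMr//; apply: mulr_ge0 => //; exact: growth_sign.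
rewrite invfM -!mulrA ler_wpM2l//.
have /andP[hc _] := hPhi c; apply: le_trans hc; rewrite ler_wpM2l ?invr_ge0 ?(ltW L0)//.
rewrite -powRM// mulrC -{1}[2^-1]ger0_norm// -normrM.
by apply: ge0_ler_powR; rewrite ?nnegrE ?(ltW p0).
Qed.

End growth.
End powers.

(** * Young's inequality and the bounded weight *)

Section power_inequality.
Context {R : realType}.

Lemma powR_expR (x y : R) : 0 < x -> x `^ y = expR (y * ln x).
Proof. by move=> x0; rewrite /powR gt_eqF. Qed.

(** Both factors are at most the corresponding powers of the larger of [A] and [B]; a sharp constant
    would gain nothing. *)
Lemma geom_mean_le_add (A B th : R) : 0 <= th <= 1 -> 0 <= A -> 0 <= B ->
  A `^ th * B `^ (1 - th) <= A + B.
Proof.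
move=> /andP[th0 th1] A0 B0.
have H (M : R) : 0 <= M -> A <= M -> B <= M -> M <= A + B -> A `^ th * B `^ (1 - th) <= A + B.
  move=> M0 AM BM MAB; apply: le_trans MAB.
  have -> : M = M `^ th * M `^ (1 - th).
    rewrite -powRD; last by apply/implyP; rewrite subrKC oner_eq0.
    by rewrite subrKC powRr1.
  by apply: ler_pM; rewrite ?powR_ge0//; apply: ge0_ler_powR; rewrite ?nnegrE// subr_ge0.
have [AB|/ltW BA] := leP A B.
  by apply: (H B) => //; rewrite lerDr.
by apply: (H A) => //; rewrite lerDl.
Qed.

(* Young's inequality with exponents [p / q] and [p / (p - q)]; [W] will be
   [1 + |u x| + |u y|]. *)
Lemma gagliardo_interpolation (n s h p q xi t W r : R) : 0 < q < p -> 0 <= t -> 0 < W -> 0 < r ->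
  t `^ q * r `^ (- (n + h * q)) <=
  t `^ p * W `^ (- xi) * r `^ (- (n + s * p))
  + W `^ (xi * q / (p - q)) * r `^ ((s - h) * q * p / (p - q) - n).
Proof.
move=> /andP[q0 qp] t0 W0 r0; have p0 : 0 < p by exact: lt_trans qp.
move: t0; rewrite le_eqVlt => /predU1P[<-|t0].
  by rewrite !powR0 ?gt_eqF// !mul0r add0r mulr_ge0 ?powR_ge0.
(* With the weight [q / p] the powers of [W] cancel in the geometric mean and those of [r] add up to
   [-(n + h q)]; what remains is an identity of exponents. *)
apply: le_trans (@geom_mean_le_add _ _ (q / p) _ _ _); last 3 first.
- by rewrite divr_ge0 ?(ltW q0) ?(ltW p0)//= ler_pdivrMr// mul1r ltW.
- by rewrite !mulr_ge0 ?powR_ge0.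
- by rewrite mulr_ge0 ?powR_ge0.
rewrite !powRM ?mulr_ge0 ?powR_ge0// -!powRrM !powR_expR// -!expRD ler_expR le_eqVlt.
apply/orP; left; apply/eqP; field.
by rewrite gt_eqF//= gt_eqF// subr_gt0.
Qed.

Section bounded_weight.
Variables (xi : R).
Hypothesis xi1 : 1 < xi.

Let G (t : R) : R := (1 - (1 + t) `^ (1 - xi)) / (xi - 1).

Let G_mean (a b : R) : 0 <= a <= b -> (b - a) * (1 + b) `^ (- xi) <= G b - G a <= b - a.
Proof.
have xi1' := xi1; move=> /andP[a0 ab].
have dG (t : R) : 0 <= t -> is_derive t (1 : R) G ((1 + t) `^ (- xi)).
  move=> t0; have t1 : 0 < 1 + t by lra.
  have d1 : is_derive t (1 : R) (fun t : R => 1 + t) 1.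
    by apply: (is_derive_eq (is_deriveD (is_derive_cst _ _ _) (is_derive_id _ _))); rewrite add0r.
  have d2 := is_derive1_comp (is_derive1_powR (1 - xi) t1) d1.
  have d3 := is_deriveM (is_deriveB (is_derive_cst (1 : R) t (1 : R)) d2) (is_derive_cst ((xi - 1)^-1 : R) t (1 : R)).
  apply: (is_derive_eq d3) => /=.
  rewrite scaler0 add0r mulr1 sub0r /GRing.scale/= (_ : 1 - xi - 1 = - xi); last by ring.
  by field; rewrite subr_eq0 gt_eqF.
have [c] : exists2 c, c \in `[a, b] & G b - G a = (1 + c) `^ (- xi) * (b - a).
  apply: (@MVT_segment R G (fun t => (1 + t) `^ (- xi))) => //.
    by move=> x; rewrite in_itv/= => /andP[ax _]; apply: dG; lra.
  apply: derivable_within_continuous => x; rewrite in_itv/= => /andP[ax _].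
  by have [] := dG x (le_trans a0 ax).
rewrite in_itv/= => /andP[ac cb] ->; rewrite mulrC ler_wpM2r ?subr_ge0//=.
  rewrite ler_piMl ?subr_ge0// powRN invf_le1 ?powR_gt0//; last by lra.
  have : 1 `^ xi <= (1 + c) `^ xi by apply: ge0_ler_powR; rewrite ?nnegrE; lra.
  by rewrite powR1.
rewrite !powRN lef_pV2 ?posrE ?powR_gt0//; [|lra|lra].
by apply: ge0_ler_powR; rewrite ?nnegrE; lra.
Qed.

(* The odd function with derivative [(1 + |t|)^-xi]. *)
Definition wpsi (t : R) : R := if 0 <= t then G t else - G (- t).

Let G0 : G 0 = 0. Proof. by rewrite /G addr0 powR1 subrr mul0r. Qed.

Let wpsi_le_aux (a b : R) : a <= b ->
  (b - a) * (1 + `|a| + `|b|) `^ (- xi) <= wpsi b - wpsi a <= b - a.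
Proof.
have xi1' := xi1; move=> ab; rewrite /wpsi.
have M (x y : R) : 0 < x -> x <= y -> y `^ (- xi) <= x `^ (- xi).
  move=> x0 xy; rewrite !powRN lef_pV2 ?posrE ?powR_gt0//; last exact: lt_le_trans xy.
  by apply: ge0_ler_powR; rewrite ?nnegrE; lra.
have [a0|a0] := leP 0 a.
  rewrite (le_trans a0 ab) !ger0_norm ?(le_trans a0 ab)//.
  have /andP[h1 ->] := G_mean (a := a) (b := b) ltac:(by rewrite a0 ab).
  rewrite andbT; apply: le_trans h1; rewrite ler_wpM2l ?subr_ge0//; apply: M; lra.
(* For [a < 0 <= b] the increment is the sum of those from [0] to either end, each with a weight
   larger than the common one. *)
have [b0|b0] := leP 0 b.
  have /andP[h1 h2] := G_mean (a := 0) (b := b) ltac:(by rewrite lexx b0).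
  have /andP[h3 h4] := G_mean (a := 0) (b := - a) ltac:(by rewrite lexx oppr_ge0 ltW).
  move: h1 h2 h3 h4; rewrite G0 !subr0 => h1 h2 h3 h4.
  rewrite ltr0_norm// ger0_norm// opprK; apply/andP; split; last by lra.
  rewrite mulrDl; apply: lerD.
    by apply: le_trans h1; rewrite ler_wpM2l//; apply: M; lra.
  by apply: le_trans h3; rewrite ler_wpM2l ?oppr_ge0 ?(ltW a0)//; apply: M; lra.
have /andP[h1 h2] := G_mean (a := - b) (b := - a) ltac:(by rewrite lerN2 ab oppr_ge0 ltW).
rewrite !ltr0_norm//; apply/andP; split; last by lra.
have -> : - G (- b) - - G (- a) = G (- a) - G (- b) by ring.
apply: le_trans h1; have -> : - a - - b = b - a by ring.
by rewrite ler_wpM2l ?subr_ge0//; apply: M; lra.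
Qed.

Lemma wpsi_homo : {homo wpsi : a b / a <= b}.
Proof.
move=> a b ab; have /andP[h _] := wpsi_le_aux ab; rewrite -subr_ge0; apply: le_trans h.
by rewrite mulr_ge0 ?powR_ge0 ?subr_ge0.
Qed.

Lemma wpsi_lipschitz a b : `|wpsi a - wpsi b| <= `|a - b|.
Proof.
have H (x y : R) : x <= y -> `|wpsi x - wpsi y| <= `|x - y|.
  move=> xy; have /andP[_ h] := wpsi_le_aux xy.
  rewrite ler0_norm ?subr_le0 ?wpsi_homo// ler0_norm ?subr_le0//; lra.
have [/H//|/ltW/H] := leP a b; by rewrite distrC [leRHS]distrC.
Qed.

Lemma wpsi_lower a b : `|a - b| * (1 + `|a| + `|b|) `^ (- xi) <= `|wpsi a - wpsi b|.
Proof.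
have H (x y : R) : x <= y -> `|x - y| * (1 + `|x| + `|y|) `^ (- xi) <= `|wpsi x - wpsi y|.
  move=> xy; have /andP[h _] := wpsi_le_aux xy.
  by rewrite (distrC x) (distrC (wpsi x)) (ger0_norm (x := y - x)) ?subr_ge0// (ger0_norm (x := wpsi y - wpsi x)) ?subr_ge0 ?wpsi_homo.
have [/H//|/ltW/H] := leP a b; by rewrite (distrC a) (distrC (wpsi a)) (addrAC 1 `|a|).
Qed.

Lemma wpsi0 : wpsi 0 = 0. Proof. by rewrite /wpsi lexx G0. Qed.

(** [(xi - 1)^-1] is the integral of [(1 + t)^-xi] over the half-line, finite because [1 < xi]. *)
Lemma wpsi_bound t : `|wpsi t| <= (xi - 1)^-1.
Proof.
have xi1' := xi1; have H (x : R) : 0 <= x -> `|G x| <= (xi - 1)^-1.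
  move=> x0; rewrite /G normrM [X in _ * X]ger0_norm ?invr_ge0 ?subr_ge0 ?(ltW xi1)//.
  rewrite ler_piMl ?invr_ge0 ?subr_ge0 ?(ltW xi1)// ler_norml.
  have h1 : 0 <= (1 + x) `^ (1 - xi) by exact: powR_ge0.
  have h2 : (1 + x) `^ (1 - xi) <= 1.
    rewrite -[1 - xi]opprB powRN invf_le1 ?powR_gt0//; last by lra.
    have : 1 `^ (xi - 1) <= (1 + x) `^ (xi - 1) by apply: ge0_ler_powR; rewrite ?nnegrE; lra.
    by rewrite powR1.
  by apply/andP; split; lra.
by rewrite /wpsi; case: (leP 0 t) => t0; [exact: H|rewrite normrN H// oppr_ge0 ltW].
Qed.

End bounded_weight.
End power_inequality.

Section lower_bound.
Context {R : realType} {n : nat}.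
Local Notation leb := (@lebesgue_rV R n).

(** Integrating first in [y] over the complement of [E], every [x] contributes [g x] times a mass
    bounded below by [kernel_outside_ge]. It serves the level sets of a solution and, with [E] the
    whole domain, the Poincaré inequality. *)
Lemma kernel_lower_bound (f : 'rV[R]_n * 'rV[R]_n -> R) (g : 'rV[R]_n -> R) (E : set 'rV[R]_n) (b r a : R) :
  (0 < n)%N -> measurable E -> 0 < b -> 0 < r -> 0 < a ->
  measurable_fun setT f -> (forall z, 0 <= f z) -> measurable_fun setT g -> (forall x, 0 <= g x) ->
  (leb E <= (b * r ^+ n)%:E)%E ->
  (forall x y, ~ E y -> g x * (enorm (x - y) / r) `^ (- (n%:R + a)) <= f (x, y)) ->
  ((kernc (n := n) a * b `^ (- (a / n%:R)) * r ^+ n)%:E * \int[leb]_x (g x)%:E <=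
    \int[leb \x leb]_z (f z)%:E)%E.
Proof.
move=> n0 mE b0 r0 a0 mf f0 mg g0 hE gf.
set c := _ * r ^+ n.
have c0 : 0 <= c by rewrite !mulr_ge0 ?powR_ge0// exprn_ge0// ltW.
rewrite fubini_tonelli1; last 2 first.
- by mfun.
- by move=> z; rewrite lee_fin.
rewrite -ge0_integralZl//; last 2 first.
- by mfun.
- by move=> x _; rewrite lee_fin.
apply: ge0_le_integralW => x _; first by rewrite mule_ge0 ?lee_fin.
have me := measurable_enorm2 x.
rewrite /fubini_F; apply: (@le_trans _ _ (\int[leb]_(y in ~` E) (g x * (enorm (x - y) / r) `^ (- (n%:R + a)))%:E)%E).
  under eq_integral do rewrite EFinM.
  rewrite ge0_integralZl//; last 4 first.
  - exact: measurableC.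
  - by apply: measurable_funS (measurableT) _ _ => //; mfun.
  - by move=> y _; rewrite lee_fin powR_ge0.
  - by rewrite lee_fin.
  rewrite muleC; apply: lee_wpmul2l; first by rewrite lee_fin.
  exact: kernel_outside_ge.
rewrite [leLHS]integral_mkcond; apply: ge0_le_integralW => y _; rewrite patchE; case: ifPn => yE.
- by rewrite lee_fin mulr_ge0 ?powR_ge0.
- by [].
- by rewrite lee_fin; apply: gf; move: yE; rewrite inE.
- by rewrite lee_fin.
Qed.

End lower_bound.

Definition clip {R : realType} (k t : R) : R := Num.max (- k) (Num.min k t).

Lemma clip_homo (R : realType) (k : R) : {homo clip k : a b / a <= b}.
Proof. by move=> a b ab; rewrite /clip; case: (leP k a) => ?; case: (leP k b) => ?; case: (leP (- k) a) => ?; case: (leP (- k) b) => ?; case: (leP (- k) k) => ?; lra. Qed.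

Lemma clip_lipschitz (R : realType) (k a b : R) : `|clip k a - clip k b| <= `|a - b|.
Proof.
have H (x y : R) : x <= y -> `|clip k x - clip k y| <= `|x - y|.
  move=> xy; have := clip_homo k xy => h; rewrite distrC (distrC x) !ger0_norm ?subr_ge0//.
  by move: h; rewrite /clip; case: (leP k x) => ?; case: (leP k y) => ?; case: (leP (- k) x) => ?; case: (leP (- k) y) => ?; case: (leP (- k) k) => ?; lra.
have [/H//|/ltW/H] := leP a b; by rewrite distrC (distrC a).
Qed.

Lemma clip_bound (R : realType) (k t : R) : 0 <= k -> `|clip k t| <= k.
Proof. move=> k0; rewrite ler_norml /clip; case: (leP k t) => ?; case: (leP (- k) k) => ?; case: (leP (- k) t) => ?; apply/andP; split; lra. Qed.

Lemma clip0 (R : realType) (k : R) : 0 <= k -> clip k 0 = 0.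
Proof. by move=> k0; rewrite /clip min_r// max_r// oppr_le0. Qed.

Lemma clip_gap (R : realType) (k a b : R) : 0 <= k -> `|a| > 2 * k -> `|b| <= k -> k <= `|clip (2 * k) a - clip (2 * k) b|.
Proof.
move=> k0 ha; rewrite ler_norml => /andP[b1 b2].
have -> : clip (2 * k) b = b by rewrite /clip min_r ?max_r//; lra.
have [a0|a0] := leP 0 a.
  move: ha; rewrite ger0_norm// => ha; rewrite /clip min_l ?max_r; [|lra|lra].
  by apply: le_trans (ler_norm _); lra.
move: ha; rewrite ltr0_norm// => ha; rewrite /clip min_r ?max_l; [|lra|lra].
by rewrite -normrN; apply: le_trans (ler_norm _); lra.
Qed.

(** * Decay of level sets *)

Section decay.
Context {R : realType} {n : nat}.
Local Notation leb := (@lebesgue_rV R n).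

(** Monotonicity gives the tested form a sign, [psi 0 = 0] preserves the zero exterior values, and
    the Lipschitz bound preserves finite energy. *)
Definition nd_contraction (psi : R -> R) : Prop :=
  [/\ {homo psi : a b / a <= b}, psi 0 = 0 & forall a b, `|psi a - psi b| <= `|a - b|].

(* The solution rescaled by [k], where [|mu|(Omega) <= k^(p - 1) d^(n - s p)], with
   distances measured in units of the diameter [d]: all constants become universal. *)
Record normalized (s p A d : R) (Omega : set 'rV[R]_n) (U : 'rV[R]_n -> R) : Prop := Normalized {
  nrm_Omega : measurable Omega ;
  nrm_d : 0 < d ;
  nrm_diam : forall x y, Omega x -> Omega y -> enorm (x - y) <= d ;
  nrm_meas : measurable_fun setT U ;
  nrm_out : forall x, ~ Omega x -> U x = 0 ;
  nrm_energy : forall psi B, nd_contraction psi -> (forall t, `|psi t| <= B) ->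
    (\int[leb \x leb]_z (`|U z.1 - U z.2| `^ (p - 1) * `|psi (U z.1) - psi (U z.2)|
       * (enorm (z.1 - z.2) / d) `^ (- (n%:R + s * p)))%:E
     <= (A * B * (d ^+ n) ^+ 2)%:E)%E }.

Lemma nd_contraction_measurable psi : nd_contraction psi -> measurable_fun setT psi.
Proof. by move=> [h _ _]; exact: nondecreasing_measurable. Qed.

Lemma measure_le_diam (d : R) (Omega : set 'rV[R]_n) : measurable Omega -> 0 < d ->
  (forall x y, Omega x -> Omega y -> enorm (x - y) <= d) -> (leb Omega <= (2 ^+ n * d ^+ n)%:E)%E.
Proof.
move=> mO d0 hO; have [->|/set0P[x Ox]] := eqVneq Omega set0.
  by rewrite measure0 lee_fin mulr_ge0 ?exprn_ge0// ltW.
rewrite -exprMn -(lebesgue_box x (ltW d0)); apply: le_measure; rewrite ?inE//.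
  exact: measurable_box.
by move=> y Oy; apply: enorm_le_box; exact: hO.
Qed.

Variables (s p A : R).
Hypotheses (n0 : (0 < n)%N) (s0 : 0 < s) (p1 : 1 < p) (spn : s * p < n%:R) (A0 : 0 < A).
Let N0 : 0 < n%:R :> R. Proof. by rewrite ltr0n. Qed.
Let p0 : 0 < p. Proof. exact: lt_trans p1. Qed.
Let sp0 : 0 < s * p. Proof. exact: mulr_gt0. Qed.

(** Exponent of the weak Lebesgue (Marcinkiewicz) space that contains the solutions with measure
    data. *)
Definition gstar : R := n%:R * (p - 1) / (n%:R - s * p).
Let th : R := s * p / n%:R.
Let Ck : R := 2 * A / kernc (n := n) (s * p).
(** The summand [2^n] covers the starting level by the volume of [Omega]; the other one makes
    [level_const^(1 - th)] at least [Ck 2^gstar], which is what one inductive step consumes. *)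
Definition level_const : R := 2 ^+ n + (Ck * 2 `^ gstar) `^ (1 - th)^-1.

Let th01 : 0 < th < 1.
Proof. by rewrite divr_gt0//= ltr_pdivrMr// mul1r. Qed.

Let kernc0 : 0 < kernc (n := n) (s * p).
Proof. by rewrite powR_gt0// divr_gt0// mulr_gt0// powR_gt0. Qed.

Let Ck0 : 0 < Ck. Proof. by rewrite divr_gt0// mulr_gt0. Qed.

Lemma level_const_gt0 : 0 < level_const.
Proof. by rewrite ltr_pwDl ?exprn_gt0 ?powR_ge0. Qed.

(* If [m_i] is the measure of [{|U| > 2^i}], testing with the truncation at height
   [2^(i + 1)] gives [m_(i + 1) <= C m_i^theta 2^(- i (p - 1))], [theta = s p / n]:
   points of [{|U| > 2^(i + 1)}] see the complement of [{|U| > 2^i}] through a kernel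
   of total mass at least [c m_i^(- theta)]. *)
Lemma level_le d Omega U (i : nat) : normalized s p A d Omega U ->
  (leb [set x | (2 ^+ i < `|U x|)%R] <= (level_const * (2 `^ (- gstar)) ^+ i * d ^+ n)%:E)%E.
Proof.
move=> [mO d0 hd mU U0 HE]; have /andP[th0 th1] := th01.
have [lc [-> lc0 lc2 hlc]] : exists lc, [/\ level_const = lc, 0 < lc, 2 ^+ n <= lc &
    Ck * 2 `^ gstar <= lc `^ (1 - th)].
  exists level_const; split=> //; first exact: level_const_gt0.
    by rewrite lerDl powR_ge0.
  have : ((Ck * 2 `^ gstar) `^ (1 - th)^-1) `^ (1 - th) <= level_const `^ (1 - th).
    apply: ge0_ler_powR; rewrite ?nnegrE ?powR_ge0 ?(ltW level_const_gt0) ?subr_ge0 ?(ltW th1)//.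
    by rewrite /level_const lerDr exprn_ge0.
  have t1 : 1 - th != 0 by rewrite gt_eqF// subr_gt0.
  by rewrite -powRrM mulVf// powRr1// mulr_ge0 ?powR_ge0 ?(ltW Ck0).
have [w wE] : {w : R | w = 2 `^ (- gstar)} by exists (2 `^ (- gstar)).
have w0 : 0 < w by rewrite wE powR_gt0.
rewrite -wE.
pose E i := [set x | (2 ^+ i < `|U x|)%R].
have mE j : measurable (E j).
  rewrite (_ : E j = (fun x => 2 ^+ j < `|U x|) @^-1` [set true]); last first.
    by apply/seteqP; split => x /=.
  rewrite -[X in measurable X]setTI.
  have : measurable_fun setT (fun x => 2 ^+ j < `|U x|) by mfun.
  by apply => //.
have EO j : E j `<=` Omega.
  move=> x Ex; apply: contrapT => /U0 h; move: Ex; rewrite /E/= h normr0.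
  by apply/negP; rewrite -leNgt exprn_ge0.
have d00 : 0 < d ^+ n by rewrite exprn_gt0.
elim: i => [|i ih].
  rewrite expr0 mulr1; apply: (@le_trans _ _ (leb Omega)).
    by apply: le_measure; rewrite ?inE//; [exact: mE 0%N|exact: (EO 0%N)].
  apply: (le_trans (measure_le_diam mO d0 hd)).
  by rewrite lee_fin ler_wpM2r ?(ltW d00).
pose b := lc * w ^+ i.
have b0 : 0 < b by rewrite mulr_gt0 ?exprn_gt0.
pose k : R := 2 ^+ i.
have k0 : 0 < k by rewrite exprn_gt0.
have psiC : nd_contraction (clip (2 * k)).
  split; [exact: clip_homo|by rewrite clip0// mulr_ge0// ltW|by move=> *; exact: clip_lipschitz].
have mpsi := nd_contraction_measurable psiC.
have := HE _ _ psiC (fun t => @clip_bound _ (2 * k) t (mulr_ge0 (ler0n _ 2) (ltW k0))).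
pose f := fun z : 'rV[R]_n * 'rV[R]_n => `|U z.1 - U z.2| `^ (p - 1)
  * `|clip (2 * k) (U z.1) - clip (2 * k) (U z.2)| * (enorm (z.1 - z.2) / d) `^ (- (n%:R + s * p)).
rewrite -[X in (X <= _)%E]/(\int[leb \x leb]_z (f z)%:E)%E => hf.
have me := @measurable_enorm R n.
have mf : measurable_fun setT f by rewrite /f; mfun.
have f0 z : 0 <= f z by rewrite !mulr_ge0 ?powR_ge0.
have g0 (x : 'rV[R]_n) : 0 <= k `^ p * \1_(E i.+1) x by rewrite mulr_ge0 ?powR_ge0.
have mg : measurable_fun setT (fun x : 'rV[R]_n => k `^ p * \1_(E i.+1) x).
  by mfun; exact: mE.
have := @kernel_lower_bound R n f (fun x => k `^ p * \1_(E i.+1) x) (E i) b d (s * p) n0 (mE i) b0 d0 sp0 mf f0 mg g0 ih.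
have -> : (\int[leb]_x (k `^ p * \1_(E i.+1) x)%:E = (k `^ p)%:E * leb (E i.+1))%E.
  rewrite integral_finZ; [|by mfun; exact: mE|by []|exact: powR_ge0].
  by rewrite integral_fin_indic.
move=> H; have {H} := le_trans (H _) hf.
have -> : leb (E i.+1) = (fine (leb (E i.+1)))%:E.
  rewrite fineK// ge0_fin_numE//; apply: le_lt_trans (ltry (2 ^+ n * d ^+ n)).
  apply: le_trans (measure_le_diam mO d0 hd); apply: le_measure; rewrite ?inE//.
set m := fine _; move=> H.
have {}H : kernc (n := n) (s * p) * b `^ (- (s * p / n%:R)) * d ^+ n * (k `^ p * m) <=
   A * (2 * k) * (d ^+ n) ^+ 2.
  rewrite -lee_fin [X in (X <= _)%E]EFinM [X in (_ * X <= _)%E]EFinM; apply: H => x y.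
  rewrite /E/= => /negP; rewrite -leNgt -/k => yk.
  rewrite indicE; case: (boolP (x \in E i.+1)) => [|_]; last by rewrite mulr0 mul0r; exact: f0.
  rewrite inE /E /= exprS -/k => xk; rewrite mulr1 /f /= ler_wpM2r ?powR_ge0//.
  rewrite -(mulr_powRB1 (ltW k0) p0) mulrC; apply: ler_pM; rewrite ?powR_ge0 ?(ltW k0)//.
    apply: ge0_ler_powR; rewrite ?nnegrE ?subr_ge0 ?(ltW p1) ?(ltW k0)//.
    by have := lerB_dist (U x) (U y); lra.
  exact: clip_gap (ltW k0) xk yk.
rewrite lee_fin -/m.
have bth : b `^ th = lc `^ th * (w `^ th) ^+ i.
  by rewrite /b powRM ?exprn_ge0 ?(ltW w0) ?(ltW lc0)// -powR_mulrn ?(ltW w0)// powRAC powR_mulrn ?powR_ge0.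
have hm : m <= Ck * b `^ th * k `^ (1 - p) * d ^+ n.
  have kp0 : 0 < k `^ p by rewrite powR_gt0.
  have bt0 : 0 < b `^ th by rewrite powR_gt0.
  have : m <= (A * (2 * k) * (d ^+ n) ^+ 2) / (kernc (n := n) (s * p) * b `^ (- th) * d ^+ n * k `^ p).
    rewrite ler_pdivlMr; last by apply: mulr_gt0 => //; apply: mulr_gt0 => //; apply: mulr_gt0; rewrite ?kernc0// powR_gt0.
    rewrite -/th in H; apply: le_trans H; rewrite le_eqVlt; apply/orP; left; apply/eqP; ring.
  move/le_trans; apply; rewrite (powRN b th).
  have -> : k `^ (1 - p) = k / k `^ p.
    by rewrite -[X in X / _](powRr1 (ltW k0)) -powRB//; apply/implyP => _; rewrite gt_eqF.
  rewrite le_eqVlt; apply/orP; left; apply/eqP; rewrite /Ck; field.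
  by rewrite !gt_eqF.
apply: (le_trans hm); rewrite ler_wpM2r ?(ltW d00)//.
(* [gstar] solves [gstar (1 - th) = p - 1]; this is why the induction closes with the decay
   [w^i]. *)
have kw : k `^ (1 - p) * (w `^ th) ^+ i = w ^+ i.
  have -> : k `^ (1 - p) = (2 `^ (1 - p)) ^+ i.
    by rewrite /k -powR_mulrn// powRAC powR_mulrn// powR_ge0.
  rewrite -exprMn; congr (_ ^+ i).
  rewrite wE -powRrM -powRD; last by rewrite pnatr_eq0 implybT.
  congr (_ `^ _); rewrite /th /gstar; field.
  by rewrite subr_eq0 gt_eqF//= gt_eqF.
rewrite bth.
have -> : Ck * (lc `^ th * w `^ th ^+ i) * k `^ (1 - p) = Ck * lc `^ th * w ^+ i.
  by rewrite -kw; ring.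
rewrite exprS mulrA; apply: ler_wpM2r; first by rewrite exprn_ge0 ?(ltW w0).
have lcE : lc = lc `^ th * lc `^ (1 - th).
  rewrite -powRD; last by apply/implyP => _; rewrite gt_eqF.
  by rewrite subrKC powRr1// ltW.
rewrite [leRHS](_ : _ = lc `^ th * (lc `^ (1 - th) * w)); last by rewrite mulrA -lcE.
rewrite mulrC ler_wpM2l ?powR_ge0//.
by rewrite wE powRN ler_pdivlMr ?powR_gt0.
Qed.

End decay.

Lemma wpsi_nd_contraction (R : realType) (xi : R) : 1 < xi -> nd_contraction (wpsi xi).
Proof. by move=> x1; split; [exact: wpsi_homo|exact: wpsi0|exact: wpsi_lipschitz]. Qed.

(** * A priori estimates *)

Section regularity.
Context {R : realType} {n : nat}.
Local Notation leb := (@lebesgue_rV R n).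
Variables (s p A : R).
Hypotheses (n0 : (0 < n)%N) (s0 : 0 < s) (p1 : 1 < p) (spn : s * p < n%:R) (A0 : 0 < A).

Lemma powR2X (a : R) i : (2 ^+ i) `^ a = (2 `^ a) ^+ i :> R.
Proof. by rewrite -powR_mulrn// powRAC powR_mulrn// powR_ge0. Qed.

(** The integral is split over dyadic levels; the weight [2^(g i)] against the decay [2^(- gstar i)]
    leaves a geometric series of ratio [z < 1]. *)
Lemma moment_estimate (g : R) : 0 < g < gstar (n := n) s p -> exists2 C : R, 0 < C &
  forall d Omega (U : 'rV[R]_n -> R), normalized s p A d Omega U ->
  (\int[leb]_x ((1 + `|U x|) `^ g * \1_Omega x)%:E <= (C * d ^+ n)%:E)%E.
Proof.
move=> /andP[g0 gg].
have [lc lcE] : {lc : R | lc = level_const (n := n) s p A} by eexists.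
have lc0 : 0 < lc by rewrite lcE level_const_gt0.
have [z zE] : {z : R | z = 2 `^ g * 2 `^ (- gstar (n := n) s p)} by eexists.
have z0 : 0 < z by rewrite zE mulr_gt0 ?powR_gt0.
have z1 : z < 1.
  rewrite zE -powRD; last by rewrite pnatr_eq0 implybT.
  have h : 0 < gstar (n := n) s p - g by rewrite subr_gt0.
  by rewrite -opprB; have /andP[] := powR2N_lt1 h.
(* On [2^i < |U| <= 2^(i + 1)] one has [1 + |U| <= 4 * 2^i], whence [4^g]; the summand [2^n]
   accounts for [|U| <= 1]. *)
exists (4 `^ g * (2 ^+ n + lc / (1 - z))).
  by rewrite mulr_gt0 ?powR_gt0// addr_gt0 ?exprn_gt0// divr_gt0 ?subr_gt0.
move=> d Omega U HU; have [mO d0 hd mU U0 HE] := HU.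
have d00 : 0 < d ^+ n by rewrite exprn_gt0.
pose E i := [set x | (2 ^+ i < `|U x|)%R].
have mE j : measurable (E j).
  rewrite (_ : E j = (fun x => 2 ^+ j < `|U x|) @^-1` [set true]); last first.
    by apply/seteqP; split => x /=.
  rewrite -[X in measurable X]setTI.
  have : measurable_fun setT (fun x => 2 ^+ j < `|U x|) by mfun.
  by apply => //.
pose c i : R := (2 `^ g) ^+ i.
have c0 i : 0 <= c i by rewrite exprn_ge0 ?powR_ge0.
have ms : measurable_fun setT (fun x => \sum_(0 <= i <oo) (c i * \1_(E i) x)%:E)%E.
  apply: ge0_emeasurable_sum => [i x _ _|i _]; first by rewrite lee_fin mulr_ge0.
  by mfun; exact: mE.
have s00 x : (0 <= \sum_(0 <= i <oo) (c i * \1_(E i) x)%:E)%E.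
  by apply: nneseries_ge0 => i _ _; rewrite lee_fin mulr_ge0.
apply: (@le_trans _ _ (\int[leb]_x ((4 `^ g)%:E * ((\1_Omega x)%:E + \sum_(0 <= i <oo) (c i * \1_(E i) x)%:E)))%E).
  apply: ge0_le_integralW => x _; first by rewrite lee_fin mulr_ge0 ?powR_ge0.
  have [Ox|nOx] := pselect (Omega x); last first.
    by rewrite indicE memNset// mulr0 mule_ge0 ?lee_fin ?powR_ge0// adde_ge0// lee_fin.
  have -> : \1_Omega x = 1 :> R by rewrite indicE mem_set.
  rewrite mulr1; have [U1|U1] := leP `|U x| 1.
    apply: (@le_trans _ _ ((4 `^ g)%:E * 1%:E)%E).
      rewrite mule1 lee_fin; apply: ge0_ler_powR; rewrite ?nnegrE ?(ltW g0)//.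
      by lra.
    by rewrite lee_wpmul2l ?lee_fin ?powR_ge0// leeDl.
  have [i /andP[i1 i2]] := dyadic_gt1 U1.
  apply: (@le_trans _ _ ((4 `^ g)%:E * (c i)%:E)%E).
    rewrite -EFinM lee_fin /c -powR2X -powRM ?exprn_ge0//.
    apply: ge0_ler_powR; rewrite ?nnegrE ?(ltW g0)//.
    have : 1 <= (2 : R) ^+ i by apply: exprn_ege1; lra.
    by move: i2; rewrite exprS; move: (2 ^+ i) => k; lra.
  rewrite lee_wpmul2l ?lee_fin ?powR_ge0//.
  have : ((c i * \1_(E i) x)%:E <= \sum_(0 <= i <oo) (c i * \1_(E i) x)%:E)%E.
    by apply: (nneseries_term_le (u := fun i => (c i * \1_(E i) x)%:E)) => k; rewrite lee_fin mulr_ge0.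
  rewrite {1}indicE mem_set// mulr1 => h; apply: (le_trans h); by rewrite leeDr// lee_fin.
rewrite ge0_integralZl; last 4 first.
- by [].
- by apply: emeasurable_funD => //; mfun.
- by move=> x _; rewrite adde_ge0// lee_fin.
- by rewrite lee_fin powR_ge0.
rewrite -mulrA [X in (_ <= X)%E]EFinM lee_wpmul2l ?lee_fin ?powR_ge0//.
rewrite ge0_integralD; [|by []|by move=> x _; rewrite lee_fin|by mfun|by []|by []].
rewrite mulrDl EFinD; apply: leeD.
  by rewrite integral_fin_indic//; exact: measure_le_diam.
rewrite integral_nneseries; [|by []|by move=> i; mfun; exact: mE|by move=> i x _; rewrite lee_fin mulr_ge0].
apply: (@le_trans _ _ (\sum_(0 <= i <oo) ((lc * d ^+ n) * z ^+ i)%:E)%E); last first.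
  rewrite nneseries_geometric ?(ltW z0)//; last by rewrite mulr_ge0// ltW.
  by rewrite lee_fin mulrAC.
apply: lee_nneseries => [i _ _|i _].
  by apply: integral_fin_ge0 => x; rewrite mulr_ge0.
rewrite integral_finZ; [|by mfun; exact: mE|by []|exact: c0].
rewrite integral_fin_indic; last exact: mE.
have := level_le n0 s0 p1 spn A0 i HU; rewrite -lcE => h.
apply: (le_trans (lee_wpmul2l _ h)); first by rewrite lee_fin.
rewrite -EFinM lee_fin zE exprMn -/(c i) le_eqVlt; apply/orP; left; apply/eqP; ring.
Qed.

(** After clearing denominators [q / (p - q) < gstar] reads [q p (n - s) < n p (p - 1)], which is
    [q < qbar]. *)
Lemma qbar_bounds (q : R) : 0 < q < qbar n s p -> q < p /\ q / (p - q) < gstar (n := n) s p /\ q < gstar (n := n) s p.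
Proof.
rewrite /qbar /gstar => /andP[q0 qq].
have spn' := spn; have p1' := p1; have s0' := s0.
have p0 : 0 < p by exact: lt_trans p1.
have sn : s < n%:R by apply: le_lt_trans spn; rewrite ler_peMr// ltW.
have N0 : 0 < n%:R :> R by rewrite ltr0n.
have h1 : q * (n%:R - s) < n%:R * (p - 1) by rewrite -ltr_pdivlMr ?subr_gt0.
have qp : q < p.
  have : q * (n%:R - s) < p * (n%:R - s) by apply: lt_trans h1 _; nra.
  by rewrite ltr_pM2r ?subr_gt0.
split=> //; split.
  rewrite ltr_pdivrMr ?subr_gt0// mulrAC ltr_pdivlMr ?subr_gt0//; nra.
rewrite ltr_pdivlMr ?subr_gt0//; apply: le_lt_trans h1.
rewrite ler_wpM2l ?(ltW q0)//; nra.
Qed.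

(** Pairs at distance at most [d] fall under Young's inequality: one term is the energy tested with
    [wpsi], the other a moment against an integrable kernel. Pairs farther apart cannot both lie in
    [Omega], so the increment is a single value of [U] and the tail of the kernel is integrable. *)
Lemma gagliardo_estimate (h q : R) : 0 < h < s -> 0 < q < qbar n s p -> exists2 C : R, 0 < C &
  forall d Omega (U : 'rV[R]_n -> R), normalized s p A d Omega U ->
  (\int[leb \x leb]_z (`|U z.1 - U z.2| `^ q * (enorm (z.1 - z.2) / d) `^ (- (n%:R + h * q)))%:E
   <= (C * (d ^+ n) ^+ 2)%:E)%E.
Proof.
have spn' := spn; have p1' := p1; have s0' := s0.
move=> /andP[h0 hs] hq; have [qp [qg1 qg2]] := qbar_bounds hq; have /andP[q0 _] := hq.
have p0 : 0 < p by exact: lt_trans p1.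
have pq0 : 0 < p - q by rewrite subr_gt0.
(* [xi] is the midpoint between [1] and the value at which the order [xi q / (p - q)] reaches
   [gstar]. *)
have [xi [xi1 xig]] : exists xi, 1 < xi /\ xi * q / (p - q) < gstar (n := n) s p.
  move: qg1; set G := gstar _ _ => qg1.
  have h1 : 1 < G * (p - q) / q by move: qg1; rewrite ltr_pdivrMr// ltr_pdivlMr// mul1r.
  exists ((1 + G * (p - q) / q) / 2); split; first by lra.
  rewrite ltr_pdivrMr// -ltr_pdivlMr//; lra.
pose g := xi * q / (p - q).
have g0 : 0 < g by rewrite divr_gt0// mulr_gt0//; lra.
(* Margin of integrability of the second kernel in Young's inequality, positive because [h < s]. *)
pose e := (s - h) * q * p / (p - q).
have e0 : 0 < e by rewrite divr_gt0// !mulr_gt0// subr_gt0.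
have [|C1 C10 H1] := @moment_estimate g; first by rewrite g0.
have [|C2 C20 H2] := @moment_estimate q; first by rewrite q0.
have hq0 : 0 < h * q by rewrite mulr_gt0.
have ge := @geomc_gt0 R n _ e0.
have gh := @geomc_gt0 R n _ hq0.
exists (A / (xi - 1) + (2 `^ g * (2 * geomc (n := n) e * C1) + 2 * geomc (n := n) (h * q) * C2)).
  have P2 : 0 < 2 `^ g :> R by exact: powR_gt0.
  have A1 : 0 < A / (xi - 1) by rewrite divr_gt0 ?subr_gt0.
  have A2 : 0 < 2 * geomc (n := n) e * C1 by do 2 apply: mulr_gt0 => //.
  have A3 : 0 < 2 * geomc (n := n) (h * q) * C2 by do 2 apply: mulr_gt0 => //.
  by do 2 apply: addr_gt0 => //; apply: mulr_gt0.
move=> d Omega U HU; have [mO d0 hd mU U0 HE] := HU.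
have d00 : 0 < d ^+ n by rewrite exprn_gt0.
pose g1 x := (1 + `|U x|) `^ g * \1_Omega x.
pose g2 x := (1 + `|U x|) `^ q * \1_Omega x.
have g10 x : 0 <= g1 x by rewrite mulr_ge0 ?powR_ge0.
have g20 x : 0 <= g2 x by rewrite mulr_ge0 ?powR_ge0.
have mg1 : measurable_fun setT g1 by rewrite /g1; mfun.
have mg2 : measurable_fun setT g2 by rewrite /g2; mfun.
have psiC := wpsi_nd_contraction xi1.
have mpsi := nd_contraction_measurable psiC.
have me := @measurable_enorm R n.
have mkn := @measurable_knear R n e.
have mkf := @measurable_kfar R n (h * q).
pose r (z : 'rV[R]_n * 'rV[R]_n) := enorm (z.1 - z.2) / d.
pose F1 z := `|U z.1 - U z.2| `^ (p - 1) * `|wpsi xi (U z.1) - wpsi xi (U z.2)| * (r z) `^ (- (n%:R + s * p)).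
pose F2 z := (g1 z.1 + g1 z.2) * knear (n := n) e (r z).
pose F3 z := (g2 z.1 + g2 z.2) * kfar (n := n) (h * q) (r z).
have mF1 : measurable_fun setT F1 by rewrite /F1 /r; mfun.
have mF2 : measurable_fun setT F2 by rewrite /F2 /r; mfun.
have mF3 : measurable_fun setT F3 by rewrite /F3 /r; mfun.
have F10 z : 0 <= F1 z by rewrite !mulr_ge0 ?powR_ge0.
have F20 z : 0 <= F2 z by rewrite mulr_ge0 ?addr_ge0 ?knear_ge0.
have F30 z : 0 <= F3 z by rewrite mulr_ge0 ?addr_ge0 ?kfar_ge0.
have I1 : (\int[leb \x leb]_z (F1 z)%:E <= (A / (xi - 1) * (d ^+ n) ^+ 2)%:E)%E.
  by apply: HE => // t; exact: wpsi_bound.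
have I2 : (\int[leb \x leb]_z (F2 z)%:E <= (2 * geomc (n := n) e * C1 * (d ^+ n) ^+ 2)%:E)%E.
  apply: le_trans (@kernel_double_integral_le R n _ (geomc (n := n) e * d ^+ n) d g1 mkn (@knear_ge0 R n e) _ _ mg1 g10) _.
  - by rewrite mulr_ge0 ?(ltW ge) ?(ltW d00).
  - by move=> x; exact: knear_integral_le.
  apply: (le_trans (lee_wpmul2l _ (H1 _ _ _ HU))); first by rewrite lee_fin; apply: mulr_ge0 => //; apply: mulr_ge0; apply: ltW.
  by rewrite -EFinM lee_fin le_eqVlt; apply/orP; left; apply/eqP; ring.
have I3 : (\int[leb \x leb]_z (F3 z)%:E <= (2 * geomc (n := n) (h * q) * C2 * (d ^+ n) ^+ 2)%:E)%E.
  apply: le_trans (@kernel_double_integral_le R n _ (geomc (n := n) (h * q) * d ^+ n) d g2 mkf (@kfar_ge0 R n (h * q)) _ _ mg2 g20) _.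
  - by rewrite mulr_ge0 ?(ltW gh) ?(ltW d00).
  - by move=> x; exact: kfar_integral_le.
  apply: (le_trans (lee_wpmul2l _ (H2 _ _ _ HU))); first by rewrite lee_fin; apply: mulr_ge0 => //; apply: mulr_ge0; apply: ltW.
  by rewrite -EFinM lee_fin le_eqVlt; apply/orP; left; apply/eqP; ring.
have P z : `|U z.1 - U z.2| `^ q * (r z) `^ (- (n%:R + h * q)) <= F1 z + (2 `^ g * F2 z + F3 z).
  have F230 : 0 <= 2 `^ g * F2 z + F3 z by rewrite addr_ge0// mulr_ge0// powR_ge0.
  have two_g : 1 <= 2 `^ g :> R.
    rewrite -[leLHS](powRr0 2) ler_powR ?(ltW g0)//; lra.
  case: z F230 => x y /= F230.
  have [nOO|OO] := pselect (~ Omega x /\ ~ Omega y).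
    case: nOO => nx ny; rewrite (U0 _ nx) (U0 _ ny) subrr normr0 powR0 ?gt_eqF// mul0r.
    by apply: addr_ge0 => //; exact: F10.
  have I x' : Omega x' -> \1_Omega x' = 1 :> R by move=> Ox; rewrite indicE mem_set.
  have J x' : ~ Omega x' -> \1_Omega x' = 0 :> R by move=> Ox; rewrite indicE memNset.
  have rr0 : 0 <= r (x, y) by rewrite divr_ge0 ?enorm_ge0 ?(ltW d0).
  move: rr0; rewrite le_eqVlt => /predU1P[<-|rp].
    rewrite powR0; last by rewrite oppr_eq0 gt_eqF// ltr_wpDl.
    by rewrite mulr0; apply: addr_ge0 => //; exact: F10.
  have [r1|r1] := leP (r (x, y)) 1.
    have qp' : 0 < q < p by rewrite q0.
    pose W := 1 + `|U x| + `|U y|.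
    have W0 : 0 < W by rewrite ltr_wpDr// ltr_wpDr.
    have := @gagliardo_interpolation R n%:R s h p q xi `|U x - U y| W (r (x, y)) qp' (normr_ge0 _) W0 rp.
    move/le_trans; apply; apply: lerD.
      rewrite /F1 /= ler_wpM2r ?powR_ge0// -(mulr_powRB1 (normr_ge0 _) p0).
      rewrite [X in X * _]mulrC -mulrA ler_wpM2l ?powR_ge0//; exact: wpsi_lower.
    apply: ler_wpDr => //; rewrite /F2 /= /knear r1 -/g -/e mulrA ler_wpM2r ?powR_ge0//.
    rewrite /W /g1.
    have [Ox|nOx] := pselect (Omega x); have [Oy|nOy] := pselect (Omega y).
    - rewrite (I x)// (I y)// !mulr1; apply: le_trans (powR_add_le (ltW g0) _ _) => //.
      apply: ge0_ler_powR; [exact: ltW|by rewrite nnegrE ltW|by rewrite nnegrE addr_ge0|].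
      by have := normr_ge0 (U x); lra.
    - by rewrite (I x)// (J y)// (U0 y)// normr0 addr0 mulr1 mulr0 addr0 ler_peMl ?powR_ge0.
    - by rewrite (I y)// (J x)// (U0 x)// normr0 addr0 mulr1 mulr0 add0r ler_peMl ?powR_ge0.
    - by case: OO.
  apply: ler_wpDl => //; apply: ler_wpDl; first by rewrite mulr_ge0// powR_ge0.
  rewrite /F3 /kfar (leNgt _ 1) r1 /= ler_wpM2r ?powR_ge0// /g2.
  have H (u : R) : `|u| `^ q <= (1 + `|u|) `^ q.
    by apply: ge0_ler_powR; rewrite ?nnegrE ?(ltW q0) ?addr_ge0// lerDr.
  have [Ox|nOx] := pselect (Omega x); have [Oy|nOy] := pselect (Omega y).
  - by have := hd _ _ Ox Oy; move: r1; rewrite /r /= ltr_pdivlMr// mul1r ltNge => /negP.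
  - by rewrite (I x)// (J y)// (U0 y)// subr0 mulr1 mulr0 addr0.
  - by rewrite (I y)// (J x)// (U0 x)// sub0r normrN mulr1 mulr0 add0r.
  - by case: OO.
apply: (@le_trans _ _ (\int[leb \x leb]_z (F1 z + (2 `^ g * F2 z + F3 z))%:E)%E).
  by apply: le_integral_fin => z; [rewrite mulr_ge0 ?powR_ge0|exact: P].
have two_g : 0 <= 2 `^ g :> R by exact: powR_ge0.
rewrite integral_finD; [|by []|by mfun|by []|by move=> z; rewrite addr_ge0// mulr_ge0].
rewrite integral_finD; [|by mfun|by []|by move=> z; rewrite mulr_ge0|by []].
rewrite integral_finZ//.
rewrite mulrDl EFinD leeD// mulrDl EFinD leeD// -mulrA EFinM lee_wpmul2l// ?lee_fin//.
Qed.

End regularity.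

(** * Rellich compactness *)

Section mean_deviation.
Context d (T : measurableType d) (R : realType) (mu : {sigma_finite_measure set T -> \bar R}).
Local Open Scope ereal_scope.

(** For [x] in [Q], [m w(x)] minus the integral of [w] over [Q] is the integral of [w x - w y] over
    [y] in [Q]; absolute values and integration in [x] give the two terms. *)
Lemma mean_deviation (Q : set T) (m : R) (w : T -> R) : measurable Q -> mu Q = m%:E -> (0 < m)%R ->
  measurable_fun setT w -> \int[mu]_x `|w x|%:E < +oo ->
  \int[mu]_x (`|w x| * \1_Q x)%:E <=
    `|fine (\int[mu]_x (w x * \1_Q x)%:E)|%:E +
    (m^-1)%:E * \int[mu \x mu]_z (`|w z.1 - w z.2| * (\1_Q z.1 * \1_Q z.2))%:E.
Proof.
move=> mQ Qm m0 mw iw.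
have i1 : mu.-integrable setT (EFin \o (fun x => w x * \1_Q x)%R).
  apply/integrableP; split; first by (apply/measurable_EFinP; mfun).
  apply: le_lt_trans iw; apply: ge0_le_integralW => x _ //=.
  rewrite lee_fin normrM ler_piMr// ger0_norm// indicE; by case: (_ \in _).
have iQm : \int[mu]_x (\1_Q x)%:E = m%:E by rewrite integral_fin_indic//; exact: Qm.
have iQ : mu.-integrable setT (EFin \o (\1_Q : T -> R)).
  apply/integrableP; split; first by (apply/measurable_EFinP; mfun).
  under eq_integral do rewrite /= ger0_norm//.
  by rewrite iQm ltry.
set I := fine _.
have IE : \int[mu]_x (w x * \1_Q x)%:E = I%:E by rewrite /I fineK//; exact: integrable_fin_num i1.
pose D x := \int[mu]_y (`|w x - w y| * (\1_Q x * \1_Q y))%:E.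
have D0 x : 0 <= D x by apply: integral_fin_ge0 => y; rewrite !mulr_ge0.
have pw x : (`|w x| * \1_Q x)%:E <= (m^-1 * `|I|)%:E * (\1_Q x)%:E + (m^-1)%:E * D x.
  have [xQ|xQ] := boolP (x \in Q); last first.
    by rewrite indicE (negbTE xQ) mulr0 mule0 add0e mule_ge0// lee_fin invr_ge0 ltW.
  rewrite indicE xQ mulr1 mule1.
  have h : (m * w x - I)%:E = \int[mu]_y ((w x - w y) * \1_Q y)%:E.
    under eq_integral do rewrite mulrBl EFinB EFinM.
    rewrite integralB//; last by apply: integrableZl.
    by rewrite integralZl// iQm IE -EFinM -EFinB mulrC.
  have {}h : `|m * w x - I|%:E <= D x.
    rewrite -abse_EFin h; apply: (le_trans (le_abse_integral _ _ _)) => //; first by mfun.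
    apply: ge0_le_integralW => y _ //; rewrite lee_fin normrM [X in (_ * X)%R]ger0_norm//.
    by rewrite [\1_Q x]indicE xQ mul1r.
  have m0' : (0 <= m^-1)%R by rewrite invr_ge0 ltW.
  apply: (@le_trans _ _ ((m^-1)%:E * (`|I|%:E + D x))); last first.
    by rewrite ge0_muleDr ?lee_fin// -EFinM.
  apply: (@le_trans _ _ ((m^-1)%:E * (`|I| + `|m * w x - I|)%:E)); last first.
    by rewrite lee_wpmul2l ?lee_fin// EFinD leeD2l.
  rewrite -EFinM lee_fin ler_pdivlMl// -[X in (X * _)%R](ger0_norm (ltW m0)) -normrM.
  by rewrite -[X in (`|X| <= _)%R](subrKC I) ler_normD.
apply: (le_trans (ge0_le_integralW mu _ (fun x _ => pw x))); first by move=> x _; rewrite lee_fin mulr_ge0.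
have mD : measurable_fun setT D.
  apply: (@measurable_fun_fubini_tonelli_F _ _ _ _ _ mu (fun z => (`|w z.1 - w z.2| * (\1_Q z.1 * \1_Q z.2))%:E)); try by mfun.
rewrite ge0_integralD; last 5 first.
- by [].
- by move=> x _; rewrite -EFinM lee_fin !mulr_ge0 ?invr_ge0 ?(ltW m0).
- by apply: measurable_funeM; apply/measurable_EFinP; mfun.
- by move=> x _; rewrite mule_ge0// lee_fin invr_ge0 ltW.
- exact: measurable_funeM.
apply: leeD.
  rewrite ge0_integralZl; last 4 first.
  - by [].
  - by mfun.
  - by move=> x _; rewrite lee_fin.
  - by rewrite lee_fin mulr_ge0 ?invr_ge0 ?(ltW m0).
  by rewrite iQm -EFinM mulrAC mulVf ?gt_eqF// mul1r.
rewrite ge0_integralZl//; last by rewrite lee_fin invr_ge0 ltW.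
apply: lee_wpmul2l; first by rewrite lee_fin invr_ge0 ltW.
rewrite fubini_tonelli1; [by []|by mfun|by move=> z; rewrite lee_fin !mulr_ge0].
Qed.

End mean_deviation.

Section cells.
Context {R : realType} {n : nat}.
Local Notation leb := (@lebesgue_rV R n).

(** Cubes of side [1 / N] that tile [[-B, B)^n]; half-open sides make them disjoint, and the index
    set is finite. *)
Definition cell (B N : nat) (g : {ffun 'I_n -> 'I_(2 * B * N)}) : set 'rV[R]_n :=
  [set x | forall i, - B%:R + (g i)%:R / N%:R <= x ord0 i < - B%:R + (g i).+1%:R / N%:R].

Variables (B N : nat).
Hypothesis N0 : (0 < N)%N.
Let NR : 0 < N%:R :> R. Proof. by rewrite ltr0n. Qed.
Implicit Type g : {ffun 'I_n -> 'I_(2 * B * N)}.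

Lemma measurable_cell g : measurable (cell g).
Proof.
rewrite (_ : cell g = \bigcap_(i in [set: 'I_n])
    (fun v : 'rV[R]_n => v ord0 i) @^-1` (`[- B%:R + (g i)%:R / N%:R, - B%:R + (g i).+1%:R / N%:R[%classic)); last first.
  apply/seteqP; split => [v h i _|v h i]; first by have := h i; rewrite /= in_itv/=.
  by have := h i I; rewrite /= in_itv/=.
apply: fin_bigcap_measurable => // i _; rewrite -[X in measurable X]setTI.
by apply: measurable_coord => //; exact: measurable_itv.
Qed.

Lemma lebesgue_cell g : leb (cell g) = ((N%:R^-1) ^+ n)%:E.
Proof.
rewrite (_ : cell g = [set v : 'rV[R]_n | forall i, (`[- B%:R + (g i)%:R / N%:R, - B%:R + (g i).+1%:R / N%:R[%classic) (v ord0 i)]); last first.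
  by apply/seteqP; split => v h i; have := h i; rewrite /= in_itv/=.
rewrite (lebesgue_rV_box (A := fun i => `[- B%:R + (g i)%:R / N%:R, - B%:R + (g i).+1%:R / N%:R[%classic)); last first.
  by move=> i; exact: measurable_itv.
rewrite (eq_bigr (fun=> (N%:R^-1)%:E)); last first.
  move=> i _; rewrite /= lebesgue_measure_itv/= lte_fin ifT; last by rewrite ltrD2l ltr_pM2r ?invr_gt0// ltr_nat.
  rewrite -EFinD; congr EFin; rewrite -natr1; field; exact: lt0r_neq0.
by rewrite prodEFin big_const_ord iter_mulr_1.
Qed.

Lemma cell_inj g g' (x : 'rV[R]_n) : cell g x -> cell g' x -> g = g'.
Proof.
move=> h h'; apply/ffunP => i; apply/val_inj/eqP.
have /andP[h1 h2] := h i; have /andP[h3 h4] := h' i.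
rewrite eqn_leq; apply/andP; split; rewrite -ltnS.
  have := le_lt_trans h1 h4; by rewrite ltrD2l ltr_pM2r ?invr_gt0// ltr_nat.
have := le_lt_trans h3 h2; by rewrite ltrD2l ltr_pM2r ?invr_gt0// ltr_nat.
Qed.

Lemma cell_cover (x : 'rV[R]_n) : (forall i, `|x ord0 i| < B%:R) -> exists g, cell g x.
Proof.
move=> h; have h0 i : 0 <= N%:R * (x ord0 i + B%:R).
  by have := h i; rewrite ltr_norml => /andP[h1 h2]; rewrite mulr_ge0// ?(ltW NR)//; lra.
have lt i : (Num.truncn (N%:R * (x ord0 i + B%:R)) < 2 * B * N)%N.
  rewrite -(ltr_nat R); have /andP[t1 _] := truncn_itv (h0 i); apply: le_lt_trans t1 _.
  rewrite mulrC natrM ltr_pM2r// natrM; have := h i; rewrite ltr_norml => /andP[h1 h2]; lra.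
exists [ffun i => Ordinal (lt i)] => i; rewrite ffunE/=.
have /andP[h1 h2] := truncn_itv (h0 i).
apply/andP; split.
  rewrite -lerBrDl opprK ler_pdivrMr// [leRHS]mulrC.
  exact: h1.
rewrite -ltrBlDl opprK ltr_pdivlMr// [ltLHS]mulrC.
exact: h2.
Qed.

Lemma cell_enorm g (x y : 'rV[R]_n) : cell g x -> cell g y -> enorm (x - y) <= n%:R / N%:R.
Proof.
move=> hx hy; apply: enorm_le_coord; first by rewrite invr_ge0 ltW.
move=> i; rewrite !mxE; have := hx i; have := hy i; rewrite -natr1 mulrDl mul1r.
move: (((g i)%:R : R) / N%:R) (N%:R^-1 : R) => u v /andP[h1 h2] /andP[h3 h4].
by rewrite ler_norml; apply/andP; split; lra.
Qed.

Lemma card_cells : #|{: {ffun 'I_n -> 'I_(2 * B * N)}}| = ((2 * B * N) ^ n)%N.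
Proof. by rewrite card_ffun !card_ord. Qed.

End cells.

Section rellich_step.
Context {R : realType} {n : nat}.
Local Notation leb := (@lebesgue_rV R n).

(** For [n + a > 0] it vanishes on the diagonal, where a negative power of [0] is [0]; the bounds on
    Borel kernels are stated for all pairs with this convention. *)
Definition kern (a : R) (z : 'rV[R]_n * 'rV[R]_n) : R := enorm (z.1 - z.2) `^ (- (n%:R + a)).

Lemma kern_ge0 a z : 0 <= kern a z. Proof. exact: powR_ge0. Qed.

Lemma measurable_kern a : measurable_fun setT (kern a).
Proof. by have me := @measurable_enorm R n; rewrite /kern; mfun. Qed.

Definition energy (s p : R) (v : 'rV[R]_n -> R) : \bar R :=
  (\int[leb \x leb]_z (`|v z.1 - v z.2| `^ p * kern (s * p) z)%:E)%E.

Lemma measurable_energy (s p : R) (v : 'rV[R]_n -> R) : measurable_fun setT v ->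
  measurable_fun setT (fun z : 'rV[R]_n * 'rV[R]_n => `|v z.1 - v z.2| `^ p * kern (s * p) z).
Proof. by move=> mv; have mk := measurable_kern (s * p); mfun. Qed.

Variables (s p : R) (B N : nat).
Hypotheses (s0 : 0 < s) (p1 : 1 < p) (n0 : (0 < n)%N) (N0 : (0 < N)%N).

(** On each cell [mean_deviation] leaves the oscillation, which [le_add_powR] splits at height [a]:
    the small part is counted by volume, the large part is paid by the energy, since two points of a
    cell are within [n / N]. *)
Lemma rellich_step (w : 'rV[R]_n -> R) (a E : R) : measurable_fun setT w ->
  (forall x, w x != 0 -> forall i, `|x ord0 i| < B%:R) ->
  (\int[leb]_x `|w x|%:E < +oo)%E -> 0 < a -> (energy s p w <= E%:E)%E ->
  (\int[leb]_x `|w x|%:E <=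
    (\sum_(g : {ffun 'I_n -> 'I_(2 * B * N)}) `|fine (\int[leb]_x (w x * \1_(cell g) x)%:E)|
     + ((2 * B%:R) ^+ n * a + N%:R ^+ n * (a `^ (1 - p) * (n%:R / N%:R) `^ (n%:R + s * p)) * E))%:E)%E.
Proof.
move=> mw w0 iw a0 hE.
have p1' := p1; have p0 : 0 < p by lra.
have NR : 0 < N%:R :> R by rewrite ltr0n.
have nR : 0 < n%:R :> R by rewrite ltr0n.
pose G := {ffun 'I_n -> 'I_(2 * B * N)}.
have mk := measurable_kern (s * p).
have mc (g : G) : measurable (cell (R := R) g) by exact: measurable_cell.
have mEn := measurable_energy s p mw.
pose c := a `^ (1 - p) * (n%:R / N%:R) `^ (n%:R + s * p).
have c0 : 0 <= c by rewrite mulr_ge0 ?powR_ge0.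
pose F (z : 'rV[R]_n * 'rV[R]_n) := `|w z.1 - w z.2| `^ p * kern (s * p) z.
have F0 z : 0 <= F z by rewrite mulr_ge0 ?powR_ge0.
pose II (g : G) := (\int[leb]_x (w x * \1_(cell g) x)%:E)%E.
pose X (g : G) (z : 'rV[R]_n * 'rV[R]_n) : R := \1_(cell g) z.1 * \1_(cell g) z.2.
have X0 g z : 0 <= X g z by rewrite mulr_ge0.
have mX g : measurable_fun setT (X g) by rewrite /X; mfun; exact: mc.
have IX g : (\int[leb \x leb]_z (X g z)%:E = (N%:R^-1 ^+ n * N%:R^-1 ^+ n)%:E)%E.
  have -> : X g = \1_(cell g `*` cell g).
    by apply/funext => -[x y]; rewrite /X !indicE in_setX; do 2 case: (_ \in _); rewrite ?mulr1 ?mulr0.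
  rewrite integral_fin_indic; last exact: measurableX.
  rewrite [LHS](product_measure1E (lebesgue_rV n) (lebesgue_rV n) (mc g) (mc g)).
  by rewrite EFinM; congr (_ * _)%E; exact: lebesgue_cell.
have m0 : 0 < N%:R^-1 ^+ n :> R by rewrite exprn_gt0// invr_gt0.
have st1 : (\int[leb]_x `|w x|%:E <= \sum_(g : G) \int[leb]_x (`|w x| * \1_(cell g) x)%:E)%E.
  rewrite -ge0_integral_sum//; last by move=> g; have mcg := mc g; mfun.
  apply: ge0_le_integralW => x _ //; rewrite sumEFin lee_fin.
  have [wx|/w0/cell_cover h] := eqVneq (w x) 0.
    by rewrite wx normr0 sumr_ge0// => g _; rewrite mul0r.
  have [g gx] := h N N0; rewrite (bigD1 g)//= [\1__ _]indicE mem_set// mulr1 lerDl.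
  by rewrite sumr_ge0// => g' _; rewrite mulr_ge0.
apply: (le_trans st1).
have st2 g : (\int[leb]_x (`|w x| * \1_(cell g) x)%:E <= `|fine (II g)|%:E +
    (N%:R ^+ n)%:E * \int[leb \x leb]_z (a * X g z + c * (F z * X g z))%:E)%E.
  have := @mean_deviation _ _ R leb (cell g) _ w (mc g) (lebesgue_cell N0 g) m0 mw iw.
  move/le_trans; apply; apply: leeD => //.
  rewrite -exprVn invrK; apply: lee_wpmul2l; first by rewrite lee_fin exprn_ge0// ltW.
  apply: le_integral_fin => z; first by rewrite mulr_ge0// mulr_ge0.
  rewrite mulrA -mulrDl /X /=.
  have [gx|gx] := boolP (z.1 \in cell g); last by rewrite indicE (negbTE gx) mul0r !mulr0.
  have [gy|gy] := boolP (z.2 \in cell g); last by rewrite [\1__ z.2]indicE (negbTE gy) !mulr0.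
  rewrite !indicE gx gy !mulr1; apply: (le_trans (le_add_powR (ltW p1') a0 (normr_ge0 _))).
  rewrite lerD2l /c /F -mulrA ler_wpM2l ?powR_ge0// mulrCA.
  have rN : 0 < n%:R / N%:R :> R by rewrite divr_gt0.
  move: gx gy; rewrite !inE => gx gy; have := cell_enorm N0 gx gy => hle.
  have [e0|e0] := eqVneq (enorm (z.1 - z.2)) 0.
    by rewrite (enorm_eq0 e0) subrr normr0 powR0 ?gt_eqF// mul0r.
  rewrite ler_peMr ?powR_ge0// /kern powRN ler_pdivlMr; last by rewrite powR_gt0// lt_neqAle eq_sym e0 enorm_ge0.
  rewrite mul1r; apply: ge0_ler_powR; rewrite ?nnegrE ?enorm_ge0 ?(ltW rN)//.
  by rewrite addr_ge0 ?mulr_ge0 ?ltW.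
apply: (@le_trans _ _ (\sum_(g : G) (`|fine (II g)|%:E +
    (N%:R ^+ n)%:E * \int[leb \x leb]_z (a * X g z + c * (F z * X g z))%:E))%E).
  by apply: lee_sum => g _; exact: st2.
rewrite big_split/= sumEFin EFinD leeD2l//.
rewrite -ge0_sume_distrr; last first.
  by move=> g _; apply: integral_fin_ge0 => z; apply: addr_ge0; apply: mulr_ge0 => //; [exact: ltW|apply: mulr_ge0].
have NN : (0 <= N%:R ^+ n :> R) by rewrite exprn_ge0// ltW.
(* There are [(2 B N)^n] cells, and the square of each has measure [N^(-2 n)]; with the prefactor
   [N^n] this leaves [(2 B)^n]. Squares of distinct cells are disjoint, so their energies add up to
   at most [E]. *)
apply: (@le_trans _ _ ((N%:R ^+ n)%:E * (((2 * B%:R * N%:R) ^+ n * (a * (N%:R^-1 ^+ n * N%:R^-1 ^+ n)))%:E + (c * E)%:E))%E).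
  apply: lee_wpmul2l => //.
  under eq_bigr => g _.
    rewrite integral_finD; [|by have mXg := mX g; mfun|by have mXg := mX g; mfun|by move=> z; apply: mulr_ge0; [exact: ltW|exact: X0]|by move=> z; apply: mulr_ge0 => //; apply: mulr_ge0; [exact: F0|exact: X0]].
    rewrite integral_finZ; [|exact: mX|exact: X0|exact: ltW].
    rewrite IX.
    over.
  rewrite big_split/=; apply: leeD.
    have cG : #|{: G}|%:R = (2 * B%:R * N%:R) ^+ n :> R by rewrite card_cells natrX !natrM.
    under eq_bigr do rewrite -EFinM.
    by rewrite sumEFin lee_fin sumr_const -cG -[_ *+ _]mulr_natl.
  rewrite -ge0_integral_sum; [|by []|by move=> g; have mXg := mX g; mfun|by move=> g z _; rewrite lee_fin; apply: mulr_ge0 => //; apply: mulr_ge0; [exact: F0|exact: X0]].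
  rewrite EFinM; apply: (@le_trans _ _ (\int[leb \x leb]_z (c * F z)%:E)%E); last first.
    by rewrite integral_finZ// lee_wpmul2l// lee_fin.
  apply: ge0_le_integralW => z _.
    by rewrite sume_ge0// => g _; rewrite lee_fin; apply: mulr_ge0 => //; apply: mulr_ge0; [exact: F0|exact: X0].
  rewrite sumEFin lee_fin -mulr_sumr ler_wpM2l// -mulr_sumr ler_piMr//.
  have [[g gz]|h] := pselect (exists g : G, cell g z.1).
    rewrite (bigD1 g)//= big1 ?addr0 => [|g' gg'].
      by rewrite /X !indicE; do 2 case: (_ \in _); rewrite ?mulr1 ?mulr0.
    rewrite /X indicE memNset ?mul0r// => g'z; move/eqP: gg'; apply; exact: (cell_inj N0 g'z gz).
  by rewrite big1// => g _; rewrite /X indicE memNset ?mul0r// => gz; apply: h; exists g.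
rewrite -EFinD -EFinM lee_fin mulrDr; apply: lerD; last by rewrite le_eqVlt; apply/orP; left; apply/eqP; rewrite /c; ring.
rewrite le_eqVlt; apply/orP; left; apply/eqP; rewrite !exprMn exprVn.
have : N%:R ^+ n != 0 :> R by rewrite expf_neq0// gt_eqF.
by move: (N%:R ^+ n) (2 ^+ n) (B%:R ^+ n) => X1 X2 X3 X10; field.
Qed.

End rellich_step.

Section compactness.
Context {R : realType} {n : nat}.
Local Notation leb := (@lebesgue_rV R n).
Variables (s p : R).
Hypotheses (s0 : 0 < s) (p1 : 1 < p) (n0 : (0 < n)%N).
Let p0 : 0 < p. Proof. exact: lt_trans p1. Qed.
Let sp0 : 0 < s * p. Proof. exact: mulr_gt0. Qed.

Lemma energy_ge0 (v : 'rV[R]_n -> R) : (0 <= energy s p v)%E.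
Proof. by apply: integral_fin_ge0 => z; rewrite mulr_ge0 ?powR_ge0. Qed.

(** [kernel_lower_bound] with [E = Omega]: every point sees the exterior, where [v] vanishes,
    through a kernel of mass bounded below. *)
Lemma poincare (Omega : set 'rV[R]_n) (b : R) : measurable Omega -> 0 < b -> (leb Omega <= b%:E)%E ->
  exists2 C : R, 0 < C & forall v : 'rV[R]_n -> R, measurable_fun setT v -> (forall x, ~ Omega x -> v x = 0) ->
    (\int[leb]_x (`|v x| `^ p)%:E <= C%:E * energy s p v)%E.
Proof.
move=> mO b0 hO; pose c := kernc (n := n) (s * p) * b `^ (- (s * p / n%:R)) * 1 ^+ n.
have N0 : 0 < n%:R :> R by rewrite ltr0n.
have c0 : 0 < c.
  rewrite /c expr1n mulr1; apply: mulr_gt0; last exact: powR_gt0.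
  by rewrite powR_gt0// divr_gt0// mulr_gt0 ?powR_gt0.
exists c^-1; first by rewrite invr_gt0.
move=> v mv v0.
have mv' : measurable_fun setT (fun x => `|v x| `^ p) by mfun.
have h : (leb Omega <= (b * 1 ^+ n)%:E)%E by rewrite expr1n mulr1.
have := kernel_lower_bound n0 mO b0 (ltr01 : 0 < 1 :> R) sp0 (measurable_energy s p mv) _ mv' (fun x => powR_ge0 _ _) h.
rewrite -/c => H; rewrite -(@lee_pmul2l _ c%:E) ?lte_fin// muleA -EFinM mulfV ?gt_eqF// mul1e.
apply: H => [z|x y Oy]; first by rewrite mulr_ge0 ?powR_ge0.
by rewrite divr1 (v0 y Oy) subr0.
Qed.

Lemma L1_le_energy (Omega : set 'rV[R]_n) (b : R) : measurable Omega -> 0 < b -> (leb Omega <= b%:E)%E ->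
  exists2 C : R, 0 < C & forall (v : 'rV[R]_n -> R) E, measurable_fun setT v -> (forall x, ~ Omega x -> v x = 0) ->
    (energy s p v <= E%:E)%E -> (\int[leb]_x `|v x|%:E <= (b + C * E)%:E)%E.
Proof.
move=> mO b0 hO; have [C C0 H] := poincare mO b0 hO.
exists C => // v E mv v0 hE.
apply: (@le_trans _ _ (\int[leb]_x (\1_Omega x + `|v x| `^ p)%:E)%E).
  apply: le_integral_fin => x //; have [Ox|nOx] := pselect (Omega x).
    rewrite indicE mem_set//; have := @le_add_powR R p 1 `|v x| (ltW p1) ltr01 (normr_ge0 _).
    by rewrite powR1 mul1r.
  by rewrite v0// normr0 addr_ge0 ?powR_ge0.
rewrite integral_finD; [|by mfun|by mfun|by []|by move=> x; exact: powR_ge0].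
rewrite EFinD; apply: leeD; first by rewrite integral_fin_indic.
apply: (le_trans (H v mv v0)); rewrite EFinM; apply: lee_wpmul2l => //.
by rewrite lee_fin ltW.
Qed.

Lemma energyB (v w : 'rV[R]_n -> R) (E F : R) : measurable_fun setT v -> measurable_fun setT w ->
  (energy s p v <= E%:E)%E -> (energy s p w <= F%:E)%E ->
  (energy s p (fun x => v x - w x)%R <= (2 `^ p * (E + F))%:E)%E.
Proof.
move=> mv mw hv hw.
have mev := measurable_energy s p mv; have mew := measurable_energy s p mw.
have P0 : 0 <= 2 `^ p :> R by exact: powR_ge0.
apply: (@le_trans _ _ (\int[leb \x leb]_z (2 `^ p * (`|v z.1 - v z.2| `^ p * kern (s * p) z + `|w z.1 - w z.2| `^ p * kern (s * p) z))%:E)%E).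
  apply: le_integral_fin => z; first by rewrite mulr_ge0 ?powR_ge0.
  rewrite -mulrDl mulrA ler_wpM2r ?powR_ge0//.
  apply: le_trans (powR_add_le (ltW p0) (normr_ge0 _) (normr_ge0 _)).
  apply: ge0_ler_powR; rewrite ?nnegrE ?addr_ge0 ?(ltW p0)//.
  have -> : v z.1 - w z.1 - (v z.2 - w z.2) = (v z.1 - v z.2) - (w z.1 - w z.2) by ring.
  exact: ler_normB.
have g0 (u : 'rV[R]_n -> R) z : 0 <= `|u z.1 - u z.2| `^ p * kern (s * p) z by rewrite mulr_ge0 ?powR_ge0.
rewrite integral_finZ; [|exact: measurable_funD|by move=> z; exact: addr_ge0|by []].
rewrite integral_finD//.
by rewrite EFinM lee_wpmul2l ?lee_fin// EFinD leeD.
Qed.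

Lemma ultra_bigI (I : finType) (U : set_system nat) (S : I -> set nat) : ProperFilter U ->
  (forall g, U (S g)) -> U [set i | forall g, S g i].
Proof.
move=> UF h; suff : U [set i | forall g, g \in enum I -> S g i].
  by apply: filterS => i /= hi g; apply: hi; rewrite mem_enum.
elim: (enum I) => [|g l ih]; first by apply: filterS filterT => i _ g.
apply: filterS (filterI (h g) ih) => i [/= hg hl] g'.
by rewrite inE => /predU1P[->//|]; exact: hl.
Qed.

(** Cell averages are bounded sequences of reals, so along one ultrafilter they are all Cauchy up to
    any tolerance. [rellich_step] then makes the functions themselves Cauchy in [L^1] along it, and
    a fast subsequence converges almost everywhere. *)
Lemma rellich (Omega : set 'rV[R]_n) (B : nat) (v_ : nat -> 'rV[R]_n -> R) (E : R) :
  measurable Omega -> (forall x, Omega x -> forall i, `|x ord0 i| < B%:R) ->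
  (forall j, measurable_fun setT (v_ j)) -> (forall j x, ~ Omega x -> v_ j x = 0) ->
  (forall j, energy s p (v_ j) <= E%:E)%E ->
  exists (sg : nat -> nat) (v : 'rV[R]_n -> R), [/\ forall m, (sg m < sg m.+1)%N,
    measurable_fun setT v, forall x, ~ Omega x -> v x = 0 &
    {ae leb, forall x, v_ (sg j) x @[j --> \oo] --> v x}].
Proof.
move=> mO hO mv v0 hE.
have N0 : 0 < n%:R :> R by rewrite ltr0n.
have E0 : 0 <= E by rewrite -lee_fin; apply: le_trans (hE 0%N); exact: energy_ge0.
have [b b0 hb] : exists2 b : R, 0 < b & (leb Omega <= b%:E)%E.
  exists ((2 * (B%:R + 1)) ^+ n); first by rewrite exprn_gt0// mulr_gt0// ltr_wpDl.
  rewrite -(lebesgue_box 0); last by rewrite addr_ge0.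
  apply: le_measure; rewrite ?inE//; first exact: measurable_box.
  by move=> x /hO hx i; rewrite mxE subr0 (le_trans (ltW (hx i)))// lerDl.
have [CP CP0 HP] := L1_le_energy mO b0 hb.
pose C1 := b + CP * E.
have L1 j : (\int[leb]_x `|v_ j x|%:E <= C1%:E)%E := HP _ _ (mv j) (v0 j) (hE j).
have [U [UU Uoo]] := ultraFilterLemma eventually_filter.
have UF : ProperFilter U by exact: ultra_proper.
have key (e : R) : 0 < e -> exists2 S, U S & forall i j, S i -> S j ->
    (\int[leb]_x `|v_ i x - v_ j x|%:E <= e%:E)%E.
  move=> e0.
  pose K := (2 * B%:R) ^+ n + n%:R `^ (n%:R + s * p) * (2 `^ p * (E + E)).
  have K0 : 0 <= K.
    by rewrite addr_ge0 ?mulr_ge0 ?exprn_ge0 ?powR_ge0 ?mulr_ge0 ?addr_ge0.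
  have [N NN hN] : exists2 N : nat, (0 < N)%N & K * N%:R `^ (- s) <= e / 2.
    pose t := (2 * (K + 1) / e) `^ s^-1.
    have K1 : 0 < 2 * (K + 1) / e by rewrite divr_gt0// mulr_gt0// ltr_wpDl.
    exists (Num.truncn t).+1 => //.
    have tN := truncnS_gt t; set N := _.+1 in tN *.
    have t0 : 0 < t by rewrite powR_gt0.
    have NR : 0 < N%:R :> R by exact: lt_trans tN.
    rewrite powRN ler_pdivrMr ?powR_gt0//.
    have : t `^ s <= N%:R `^ s by apply: ge0_ler_powR; rewrite ?nnegrE ?ltW.
    rewrite /t -powRrM mulVf ?gt_eqF// powRr1 ?(ltW K1)// => h.
    apply: (@le_trans _ _ (e / 2 * (2 * (K + 1) / e))); last by rewrite ler_wpM2l// divr_ge0// ltW.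
    have -> : e / 2 * (2 * (K + 1) / e) = K + 1 by field; rewrite gt_eqF.
    by rewrite lerDl.
  have NR : 0 < N%:R :> R by rewrite ltr0n.
  pose G := {ffun 'I_n -> 'I_(2 * B * N)}.
  pose I (g : G) j := fine (\int[leb]_x (v_ j x * \1_(cell g) x)%:E)%E.
  have mc (g : G) : measurable (cell (R := R) g) by exact: measurable_cell.
  have int (g : G) j : leb.-integrable setT (EFin \o (fun x => v_ j x * \1_(cell g) x)).
    have mcg := mc g; have mvj := mv j.
    apply/integrableP; split; first by (apply/measurable_EFinP; mfun).
    apply: le_lt_trans (le_lt_trans (L1 j) (ltry _)); apply: ge0_le_integralW => x _ //=.
    rewrite lee_fin normrM ler_piMr// ger0_norm// indicE; by case: (_ \in _).
  have Ib g j : `|I g j| <= C1.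
    rewrite -lee_fin /I -fine_abse; last exact: integrable_fin_num (int g j).
    rewrite fineK ?abse_fin_num; last exact: integrable_fin_num (int g j).
    have mcg := mc g; have mvj := mv j.
    apply: (le_trans (le_abse_integral _ _ _)) => //; first by mfun.
    apply: le_trans (L1 j); apply: ge0_le_integralW => x _ //=.
    rewrite lee_fin normrM ler_piMr// ger0_norm// indicE; by case: (_ \in _).
  (* The extra [1] keeps the divisor positive even when there is no cell. *)
  pose cG : R := #|{: G}|%:R + 1.
  have cG0 : 0 < cG by rewrite ltr_wpDl.
  have e1 : 0 < e / 2 / cG by rewrite !divr_gt0.
  have /choice[S SP] : forall g, exists S, U S /\ forall i j, S i -> S j -> `|I g i - I g j| <= e / 2 / cG.
    by move=> g; have [S US HS] := ultra_bounded_cauchy UU (Ib g) e1; exists S.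
  exists [set i | forall g, S g i]; first by apply: ultra_bigI => g; have [] := SP g.
  move=> i j Si Sj.
  pose w x := v_ i x - v_ j x.
  have mvi := mv i; have mvj := mv j.
  have mw : measurable_fun setT w by rewrite /w; mfun.
  have w0 x : w x != 0 -> forall k, `|x ord0 k| < B%:R.
    move=> wx; apply: hO; apply: contrapT => nO; move: wx.
    by rewrite /w !v0// subrr eqxx.
  have iw : (\int[leb]_x `|w x|%:E < +oo)%E.
    apply: (@le_lt_trans _ _ (\int[leb]_x (`|v_ i x| + `|v_ j x|)%:E)%E).
      by apply: le_integral_fin => x //; exact: ler_normB.
    rewrite integral_finD; [|by mfun|by mfun|by []|by []].
    by apply: lte_add_pinfty; apply: le_lt_trans (ltry C1).
  (* With the threshold [N^-s] both error terms of [rellich_step] are of order [N^-s]. *)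
  have a0 : 0 < N%:R `^ (- s) :> R by exact: powR_gt0.
  apply: (le_trans (rellich_step s0 p1 n0 NN mw w0 iw a0 (energyB mvi mvj (hE i) (hE j)))).
  rewrite lee_fin [leRHS]splitr; apply: lerD.
    apply: (@le_trans _ _ (\sum_(g : G) (e / 2 / cG))).
      apply: ler_sum => g _.
      have [_ /(_ i j (Si g) (Sj g))] := SP g.
      rewrite /I -fineB ?(integrable_fin_num _ (int _ _))//.
      congr (`|fine _| <= _); rewrite -integralB// ; first by apply: eq_integral => x _; rewrite /= -EFinB mulrBl.
      + exact: int.
      + exact: int.
    rewrite sumr_const -[_ *+ _]mulr_natl mulrCA ler_piMr ?divr_ge0 ?(ltW e0)//.
    by rewrite ler_pdivrMr// mul1r lerDl.
  apply: le_trans hN; rewrite le_eqVlt; apply/orP; left; apply/eqP; rewrite /K.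
  have -> : N%:R ^+ n * ((N%:R `^ (- s)) `^ (1 - p) * (n%:R / N%:R) `^ (n%:R + s * p)) = n%:R `^ (n%:R + s * p) * N%:R `^ (- s) :> R.
    rewrite -[N%:R ^+ n]powR_mulrn ?(ltW NR)// -powRrM !powR_expR ?divr_gt0//.
    rewrite lnM ?posrE ?invr_gt0// lnV ?posrE// -!expRD; congr expR; ring.
  move: (2 `^ p * (E + E)) (n%:R `^ _) (N%:R `^ _) (_ ^+ n) => X1 X2 X3 X4; ring.
have /choice[S SP] : forall m : nat, exists S, U S /\ forall i j, S i -> S j ->
    (\int[leb]_x `|v_ i x - v_ j x|%:E <= ((1 / 2) ^+ m)%:E)%E.
  move=> m; have [|S US HS] := key ((1 / 2) ^+ m); first by rewrite exprn_gt0.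
  by exists S.
have [sg [sg1 sg2 sg3]] := @ultra_subsequence U S UF Uoo (fun m => (SP m).1).
pose v x := fine (limn_esup (fun m => (v_ (sg m) x)%:E)).
exists sg, v; split => //.
- apply: (measurableT_comp (f := fine)) => //.
  by apply: measurable_fun_limn_esup => m; have mvm := mv (sg m); mfun.
- move=> x Ox; rewrite /v (_ : (fun m => _) = cst 0%:E); last by apply/funext => m; rewrite v0.
  by rewrite (cvg_limn_einf_sup (cvg_cst _)).2.
- apply: ae_cvg_of_summable => // m.
  by have [_] := SP m; apply.
Qed.

End compactness.

Lemma ae_prod d (T : measurableType d) (R : realType) (mu : {sigma_finite_measure set T -> \bar R})
    (P : T -> Prop) : {ae mu, forall x, P x} -> {ae (mu \x mu)%E, forall z, P z.1 /\ P z.2}.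
Proof.
move=> [N [mN N0 NS]].
have h1 : ((mu \x mu) (N `*` setT) = 0)%E.
  by rewrite (product_measure1E mu mu mN measurableT) [X in (X * _)%E]N0 mul0e.
have h2 : ((mu \x mu) (setT `*` N) = 0)%E.
  by rewrite (product_measure1E mu mu measurableT mN) [X in (_ * X)%E]N0 mule0.
exists ((N `*` setT) `|` (setT `*` N)); split.
- by apply: measurableU; exact: measurableX.
- have m1 : measurable (N `*` [set: T]) by exact: measurableX.
  have m2 : measurable ([set: T] `*` N) by exact: measurableX.
  apply/eqP; rewrite eq_le measure_ge0 andbT.
  apply: le_trans (measureU2 _ m1 m2) _.
  by rewrite [X in (X + _)%E]h1 [X in (_ + X)%E]h2 adde0.
- move=> z /= hz; have [p1|p1] := pselect (P z.1); last by left; split => //; exact: NS.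
  by right; split => //; apply: NS => p2; exact: hz.
Qed.

Lemma cvg_invS (R : realType) : (j.+1%:R : R)^-1 @[j --> \oo] --> (0 : R).
Proof. exact: cvg_harmonic. Qed.

(** * First variation of the energy *)

Section euler_lagrange.
Context d (Z : measurableType d) (R : realType) (m : {measure set Z -> \bar R}).

(** Difference quotients along [t_j = 1 / (j + 1)] converge to [Phi (a z) * b z * K z] under an
    integrable majorant. Only a one-sided inequality is claimed; using it for [b] and [- b] yields
    the equation. *)
Lemma euler_lagrange (Phi F : R -> R) (K a b : Z -> R) (p L c : R) :
  1 < p -> 0 <= L -> continuous Phi -> (forall x : R, is_derive x (1 : R) F (Phi x)) ->
  (forall a b, `|F (a + b) - F a| <= L * (`|a| + `|b|) `^ (p - 1) * `|b|) ->
  (forall t, 0 <= F t) -> (forall t, F t <= L * `|t| `^ p) ->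
  measurable_fun setT K -> measurable_fun setT a -> measurable_fun setT b ->
  (forall z, 0 <= K z) ->
  (\int[m]_z (`|a z| `^ p * K z)%:E < +oo)%E -> (\int[m]_z (`|b z| `^ p * K z)%:E < +oo)%E ->
  (forall t, 0 < t -> fine (\int[m]_z (F (a z) * K z)%:E)%E + t * c <=
     fine (\int[m]_z (F (a z + t * b z) * K z)%:E)%E) ->
  m.-integrable setT (fun z => (Phi (a z) * b z * K z)%:E) /\
  (c%:E <= \int[m]_z (Phi (a z) * b z * K z)%:E)%E.
Proof.
move=> p1 L0 cPhi dF FL F0 FU mK ma mb K0 ia ib hmin.
have p0 : 0 < p by lra.
have mPhi : measurable_fun setT Phi by exact: continuous_measurable_fun.
have cF : continuous F.
  by move=> x; apply: differentiable_continuous; apply/derivable1_diffP; have [] := dF x.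
have mF : measurable_fun setT F by exact: continuous_measurable_fun.
pose t_ (j : nat) : R := j.+1%:R^-1.
have t0 j : 0 < t_ j by rewrite invr_gt0.
have t1 j : t_ j <= 1 by rewrite invf_le1// ler1n.
(* Common majorant of [F (a + t b) K] for [|t| <= 1] and of the difference quotients: both are at
   most [L (|a| + |b|)^p K]. *)
pose g z := L * 2 `^ p * (`|a z| `^ p * K z) + L * 2 `^ p * (`|b z| `^ p * K z).
have P2 : 0 <= L * 2 `^ p by rewrite mulr_ge0 ?powR_ge0.
have aK0 z : 0 <= `|a z| `^ p * K z by rewrite mulr_ge0 ?powR_ge0.
have bK0 z : 0 <= `|b z| `^ p * K z by rewrite mulr_ge0 ?powR_ge0.
have g0 z : 0 <= g z by apply: addr_ge0; apply: mulr_ge0.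
have mg : measurable_fun setT g by rewrite /g; mfun.
have ig : (\int[m]_z (g z)%:E < +oo)%E.
  rewrite /g integral_finD; [|by mfun|by mfun|by move=> z; exact: mulr_ge0|by move=> z; exact: mulr_ge0].
  rewrite integral_finZ; [|by mfun|by []|by []].
  rewrite integral_finZ; [|by mfun|by []|by []].
  have P2E : (0 <= (L * 2 `^ p)%:E)%E by rewrite lee_fin.
  exact: (lte_add_pinfty (lte_mul_pinfty P2E isT ia) (lte_mul_pinfty P2E isT ib)).
have gI : m.-integrable setT (EFin \o g).
  apply/integrableP; split; first by (apply/measurable_EFinP; mfun).
  by under eq_integral do rewrite /= ger0_norm//.
have FI t : `|t| <= 1 -> m.-integrable setT (fun z => (F (a z + t * b z) * K z)%:E).
  move=> ht; have mf : measurable_fun setT (fun z => F (a z + t * b z) * K z) by mfun.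
  apply/integrableP; split; first by mfun.
  apply: le_lt_trans ig; apply: ge0_le_integralW => z _ //=.
  rewrite lee_fin ger0_norm ?mulr_ge0// /g -mulrDr -mulrDl mulrA ler_wpM2r//.
  apply: (le_trans (FU _)); rewrite -mulrA ler_wpM2l//.
  apply: le_trans (powR_add_le (ltW p0) (normr_ge0 _) (normr_ge0 _)).
  apply: ge0_ler_powR; rewrite ?nnegrE ?addr_ge0 ?(ltW p0)//.
  by apply: (le_trans (ler_normD _ _)); rewrite lerD2l normrM ler_piMl.
have FI0 : m.-integrable setT (fun z => (F (a z) * K z)%:E).
  have := FI 0; rewrite normr0 => /(_ ler01); apply: eq_integrable => // z _.
  by rewrite mul0r addr0.
pose f_ j z : R := (F (a z + t_ j * b z) - F (a z)) / t_ j * K z.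
have mf j : measurable_fun setT (f_ j) by rewrite /f_; mfun.
have fcvg z : f_ j z @[j --> \oo] --> Phi (a z) * b z * K z.
  have /choice[c_ cP] : forall j, exists c, `|c - a z| <= t_ j * `|b z| /\
      F (a z + t_ j * b z) - F (a z) = Phi c * (t_ j * b z).
    move=> j; have [x /andP[x1 x2] ->] := MVT_line (a z) (a z + t_ j * b z) dF.
    exists x; split; last by congr (_ * _); ring.
    have : `|t_ j * b z| = t_ j * `|b z| by rewrite normrM gtr0_norm.
    move=> <-; move: x1 x2; rewrite ge_min le_max; move: (t_ j * b z) => y h1 h2.
    have h3 := ler_norm y; have h4 := ler_norm (- y); rewrite normrN in h4.
    by rewrite ler_norml; apply/andP; split; case/orP: h1 => ?; case/orP: h2 => ?; lra.
  have cc : c_ j @[j --> \oo] --> a z.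
    apply/cvgrPdist_le => e e0.
    have : (t_ j * `|b z|) @[j --> \oo] --> 0 * `|b z| by apply: cvgMr_tmp; exact: cvg_invS.
    rewrite mul0r => /cvgrPdist_le/(_ e e0); apply: filterS => j /=.
    rewrite sub0r normrN ger0_norm ?mulr_ge0 ?(ltW (t0 j))// distrC => h.
    by apply: le_trans h; have [] := cP j.
  have : (Phi (c_ j) * (b z * K z)) @[j --> \oo] --> Phi (a z) * (b z * K z).
    by apply: cvgMr_tmp; exact: (cvg_comp _ _ cc (cPhi (a z))).
  rewrite -mulrA; apply: cvg_trans; apply: near_eq_cvg; apply: nearW => j /=.
  rewrite /f_; have [_ ->] := cP j; field; exact: lt0r_neq0.
have fg j z : `|f_ j z| <= g z.
  rewrite /f_ normrM (ger0_norm (K0 z)) /g -mulrDr -mulrDl mulrA ler_wpM2r//.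
  rewrite normrM normfV (gtr0_norm (t0 j)) ler_pdivrMr//.
  apply: (le_trans (FL _ _)).
  rewrite normrM (gtr0_norm (t0 j)) [t_ j * `|b z|]mulrC mulrA ler_wpM2r ?(ltW (t0 j))// -2!mulrA ler_wpM2l//.
  apply: le_trans (powR_add_le (ltW p0) (normr_ge0 _) (normr_ge0 _)).
  have S0 : 0 <= `|a z| + `|b z| by rewrite addr_ge0.
  rewrite -(mulr_powRB1 S0 p0) [leLHS]mulrC; apply: ler_pM; rewrite ?powR_ge0 ?lerDr//.
  have tb : 0 <= t_ j * `|b z| by rewrite mulr_ge0 ?(ltW (t0 j)).
  have hXS : `|a z| + `|b z| * t_ j <= `|a z| + `|b z| by rewrite lerD2l ler_piMr.
  have hX0 : 0 <= `|a z| + `|b z| * t_ j by rewrite addr_ge0// mulrC.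
  by apply: ge0_ler_powR; rewrite ?nnegrE ?subr_ge0 ?(ltW p1).
have [] := @dominated_convergence _ _ _ m setT measurableT (fun j => EFin \o f_ j)
  (fun z => (Phi (a z) * b z * K z)%:E) (EFin \o g).
- by move=> j; apply/measurable_EFinP.
- by mfun.
- by apply: nearW => z _; apply: cvg_EFinT; exact: fcvg.
- by [].
- by apply: nearW => z j _; rewrite /= lee_fin.
move=> I1 _ C1; split=> //.
rewrite -(cvg_lim _ C1)//; apply: lime_ge; first by apply/cvg_ex; eexists; exact: C1.
apply: nearW => j /=.
have -> : (\int[m]_x (f_ j x)%:E = ((t_ j)^-1)%:E * (\int[m]_z (F (a z + t_ j * b z) * K z)%:E - \int[m]_z (F (a z) * K z)%:E))%E.
  have It := FI (t_ j); rewrite gtr0_norm// in It; have {}It := It (t1 j).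
  rewrite -integralB// -integralZl//; last by apply: integrableB.
  by apply: eq_integral => z _; rewrite -EFinB -EFinM /f_; congr EFin; rewrite -mulrBl mulrA [X in X * _]mulrC.
have It := FI (t_ j); rewrite gtr0_norm// in It; have {}It := It (t1 j).
rewrite -(fineK (integrable_fin_num _ It))// -(fineK (integrable_fin_num _ FI0))//.
rewrite -EFinB -EFinM lee_fin mulrC ler_pdivlMr// mulrC; have := hmin _ (t0 j); lra.
Qed.

End euler_lagrange.

Lemma cvg_powR (R : realType) (u : nat -> R) (l q : R) : 0 < q -> (forall j, 0 <= u j) ->
  u j @[j --> \oo] --> l -> u j `^ q @[j --> \oo] --> l `^ q.
Proof.
move=> q0 u0 ul.
have l0 : 0 <= l.
  rewrite -(cvg_lim _ ul)//; apply: limr_ge; [by apply/cvg_ex; exists l|exact: nearW].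
(* The power need not be differentiable at [0], so the limit [0] is treated by hand. *)
move: l0; rewrite le_eqVlt => /predU1P[l0|l0].
  move: ul; rewrite -l0 powR0 ?gt_eqF// => ul; apply/cvgrPdist_le => e e0.
  have e1 : 0 < e `^ q^-1 by rewrite powR_gt0.
  have /cvgrPdist_le/(_ _ e1) := ul; apply: filterS => j /=.
  rewrite !sub0r !normrN !ger0_norm ?powR_ge0// => h.
  rewrite -[leRHS](powRr1 (ltW e0)) -[X in e `^ X](mulVf (lt0r_neq0 q0)) powRrM.
  by apply: ge0_ler_powR; rewrite ?nnegrE ?(ltW q0) ?(ltW e1).
have cq : {for l, continuous (fun x : R => x `^ q)}.
  apply: differentiable_continuous; apply/derivable1_diffP.
  by have [] := is_derive1_powR q l0.
exact: (cvg_comp _ _ ul cq).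
Qed.

(** * Bounded data *)

Section weak_existence.
Context {R : realType} {n : nat}.
Local Notation leb := (@lebesgue_rV R n).
Local Notation T := 'rV[R]_n.
Variables (s p L : R) (Phi : R -> R) (K : T * T -> R) (Omega : set T) (B : nat).
Hypotheses (s0 : 0 < s) (p1 : 1 < p) (n0 : (0 < n)%N) (L1 : 1 <= L).
Hypotheses (cPhi : continuous Phi) (hPhi : forall t, L^-1 * `|t| `^ p <= Phi t * t <= L * `|t| `^ p).
Hypotheses (mK : measurable_fun setT K) (hK : forall z, L^-1 * kern (s * p) z <= K z <= L * kern (s * p) z).
Hypotheses (mO : measurable Omega) (hO : forall x, Omega x -> forall i, `|x ord0 i| < B%:R).
Let p0 : 0 < p. Proof. exact: lt_trans p1. Qed.
Let L0 : 0 < L. Proof. exact: lt_le_trans L1. Qed.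

Definition admissible (v : T -> R) : Prop :=
  [/\ measurable_fun setT v, forall x, ~ Omega x -> v x = 0 & (energy s p v < +oo)%E].

Definition solves (f v : T -> R) : Prop := admissible v /\
  forall phi, admissible phi ->
    (leb \x leb)%E.-integrable setT
      (fun z => (Phi (v z.1 - v z.2) * (phi z.1 - phi z.2) * K z)%:E) /\
    (\int[leb \x leb]_z (Phi (v z.1 - v z.2) * (phi z.1 - phi z.2) * K z)%:E =
     \int[leb]_x (f x * phi x)%:E)%E.

Lemma K_ge0 z : 0 <= K z.
Proof.
have /andP[h _] := hK z; apply: le_trans h.
by rewrite mulr_ge0 ?powR_ge0// invr_ge0 ltW.
Qed.

Lemma energyZ (c : R) (v : T -> R) : measurable_fun setT v -> 0 <= c ->
  energy s p (fun x => c * v x) = ((c `^ p)%:E * energy s p v)%E.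
Proof.
move=> mv c0; rewrite /energy -integral_finZ; [|exact: measurable_energy|by move=> z; rewrite mulr_ge0 ?powR_ge0|exact: powR_ge0].
apply: eq_integral => z _; congr EFin; rewrite -mulrBr normrM powRM// (ger0_norm c0); ring.
Qed.

Lemma energyN (v : T -> R) : energy s p (fun x => - v x) = energy s p v.
Proof. by apply: eq_integral => z _; rewrite -opprD normrN. Qed.

Lemma energy_fineE (v : T -> R) : (energy s p v < +oo)%E -> energy s p v = (fine (energy s p v))%:E.
Proof. by move=> h; rewrite fineK// ge0_fin_numE// energy_ge0. Qed.

Lemma admissibleN v : admissible v -> admissible (fun x => - v x).
Proof. by move=> [mv v0 ev]; split; [mfun|by move=> x /v0 ->; rewrite oppr0|rewrite energyN]. Qed.

Lemma admissibleB v w : admissible v -> admissible w -> admissible (fun x => v x - w x).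
Proof.
move=> [mv v0 ev] [mw w0 ew]; split; [by mfun|by move=> x nx; rewrite v0// w0// subrr|].
apply: (@le_lt_trans _ _ (2 `^ p * (fine (energy s p v) + fine (energy s p w)))%:E); last exact: ltry.
by apply: energyB => //; rewrite -energy_fineE.
Qed.

Lemma admissibleZ (c : R) v : 0 <= c -> admissible v -> admissible (fun x => c * v x).
Proof.
move=> c0 [mv v0 ev]; split; [by mfun|by move=> x /v0 ->; rewrite mulr0|].
by rewrite energyZ// lte_mul_pinfty// lee_fin powR_ge0.
Qed.

Lemma Omega_measure_lt : exists2 b : R, 0 < b & (leb Omega <= b%:E)%E.
Proof.
exists ((2 * (B%:R + 1)) ^+ n); first by rewrite exprn_gt0// mulr_gt0// ltr_wpDl.
rewrite -(lebesgue_box 0); last by rewrite addr_ge0.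
apply: le_measure; rewrite ?inE//; first exact: measurable_box.
by move=> x /hO hx i; rewrite mxE subr0 (le_trans (ltW (hx i)))// lerDl.
Qed.

Lemma bounded_data_integrable (f v : T -> R) (M : R) : measurable_fun setT f -> (forall x, `|f x| <= M) ->
  admissible v -> leb.-integrable setT (fun x => (f x * v x)%:E).
Proof.
move=> mf fM [mv v0 ev]; have [b b0 hb] := Omega_measure_lt.
have [C C0 H] := L1_le_energy s0 p1 n0 mO b0 hb.
have M0 : 0 <= M by apply: le_trans (fM 0).
have ev' : (energy s p v <= (fine (energy s p v))%:E)%E by rewrite -energy_fineE.
have h := H v _ mv v0 ev'.
apply/integrableP; split; first by mfun.
apply: (@le_lt_trans _ _ (\int[leb]_x (M * `|v x|)%:E)%E).
  by apply: ge0_le_integralW => x _ //; rewrite /= lee_fin normrM ler_wpM2r.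
rewrite integral_finZ//; last by mfun.
apply: (@le_lt_trans _ _ (M%:E * (b + C * fine (energy s p v))%:E)%E); last by rewrite -EFinM ltry.
by rewrite lee_wpmul2l.
Qed.

Lemma weak_existence (f : T -> R) (M : R) : measurable_fun setT f -> (forall x, `|f x| <= M) ->
  exists v, solves f v.
Proof.
move=> mf fM.
have M0 : 0 <= M by apply: le_trans (fM 0).
have [b b0 hb] := Omega_measure_lt.
have [CP CP0 HP] := poincare s0 p1 n0 mO b0 hb.
have [F [dF [c c0 FL] FD FU]] := growth_primitive cPhi p1 L1 hPhi.
have F0 t : 0 <= F t by apply: le_trans (FL t); rewrite mulr_ge0 ?powR_ge0// ltW.
have mPhi : measurable_fun setT Phi by exact: continuous_measurable_fun.
have cF : continuous F.
  by move=> x; apply: differentiable_continuous; apply/derivable1_diffP; have [] := dF x.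
have mF : measurable_fun setT F by exact: continuous_measurable_fun.
have K0 := K_ge0.
pose J1 (v : T -> R) := (\int[leb \x leb]_z (F (v z.1 - v z.2) * K z)%:E)%E.
pose J2 (v : T -> R) := fine (\int[leb]_x (f x * v x)%:E)%E.
have mJ1 (v : T -> R) : measurable_fun setT v -> measurable_fun setT (fun z : T * T => F (v z.1 - v z.2) * K z).
  by move=> mv; mfun.
have J1ge (v : T -> R) : measurable_fun setT v -> ((c / L)%:E * energy s p v <= J1 v)%E.
  move=> mv; rewrite /energy -integral_finZ; [|exact: measurable_energy|by move=> z; rewrite mulr_ge0 ?powR_ge0|by rewrite divr_ge0 ?ltW].
  apply: le_integral_fin => z; first by rewrite !mulr_ge0 ?powR_ge0 ?invr_ge0 ?ltW.
  rewrite (_ : c / L * _ = (c * `|v z.1 - v z.2| `^ p) * (L^-1 * kern (s * p) z)); last by ring.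
  apply: ler_pM; rewrite ?mulr_ge0 ?powR_ge0 ?invr_ge0 ?(ltW c0) ?(ltW L0)//.
  by have /andP[] := hK z.
have J1le (v : T -> R) : measurable_fun setT v -> (J1 v <= (L * L)%:E * energy s p v)%E.
  move=> mv; rewrite /energy -integral_finZ; [|exact: measurable_energy|by move=> z; rewrite mulr_ge0 ?powR_ge0|by rewrite mulr_ge0 ?ltW].
  apply: le_integral_fin => z; first by rewrite mulr_ge0.
  rewrite (_ : L * L * _ = (L * `|v z.1 - v z.2| `^ p) * (L * kern (s * p) z)); last by ring.
  by apply: ler_pM; rewrite ?F0 ?K0//; have /andP[] := hK z.
have J1fin v : admissible v -> J1 v = (fine (J1 v))%:E.
  move=> [mv v0 ev]; rewrite fineK// ge0_fin_numE; last by apply: integral_fin_ge0 => z; rewrite mulr_ge0.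
  by apply: le_lt_trans (J1le v mv) _; rewrite lte_mul_pinfty// lee_fin mulr_ge0// ltW.
have J2int v : admissible v -> leb.-integrable setT (fun x => (f x * v x)%:E).
  exact: bounded_data_integrable fM.
have J2fin v : admissible v -> (\int[leb]_x (f x * v x)%:E = (J2 v)%:E)%E.
  by move=> av; rewrite /J2 fineK//; apply: integrable_fin_num => //; exact: J2int.
have J2le (A : R) v : 0 < A -> admissible v ->
    `|J2 v| <= M * (A * b + A `^ (1 - p) * (CP * fine (energy s p v))).
  move=> A0 av; have [mv v0 ev] := av; rewrite -lee_fin.
  have -> : `|J2 v|%:E = `|\int[leb]_x (f x * v x)%:E|%E by rewrite J2fin.
  apply: (le_trans (le_abse_integral _ _ _)) => //; first by mfun.
  apply: (@le_trans _ _ (\int[leb]_x (M * (A * \1_Omega x + A `^ (1 - p) * `|v x| `^ p))%:E)%E).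
    apply: ge0_le_integralW => x _ //; rewrite lee_fin normrM; apply: ler_pM => //.
    have [Ox|nOx] := pselect (Omega x).
      by rewrite indicE mem_set// mulr1; exact: le_add_powR (ltW p1) A0 _.
    by rewrite v0// normr0 addr_ge0 ?mulr_ge0 ?powR_ge0// ltW.
  have i1 : measurable_fun setT (fun x : T => A * \1_Omega x + A `^ (1 - p) * `|v x| `^ p) by mfun.
  rewrite integral_finZ; [|by []|by move=> x; rewrite addr_ge0 ?mulr_ge0 ?powR_ge0// ltW|by []].
  rewrite EFinM lee_wpmul2l ?lee_fin//.
  rewrite integral_finD; [|by mfun|by mfun|by move=> x; rewrite mulr_ge0 ?(ltW A0)|by move=> x; rewrite mulr_ge0 ?powR_ge0].
  rewrite integral_finZ; [|by mfun|by []|by exact: ltW].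
  rewrite integral_finZ; [|by mfun|by move=> x; exact: powR_ge0|exact: powR_ge0].
  rewrite EFinD; apply: leeD.
    by rewrite EFinM lee_wpmul2l ?lee_fin ?(ltW A0)// integral_fin_indic.
  by rewrite !EFinM lee_wpmul2l ?lee_fin ?powR_ge0// -energy_fineE// HP.
pose kappa := c / L.
have kappa0 : 0 < kappa by rewrite divr_gt0.
(* [A] solves [(M + 1) A^(1 - p) CP = kappa / 2], so the linear term absorbs at most half of the
   energy; the [1] keeps [A] positive when [M = 0]. *)
pose A := (2 * (M + 1) * CP / kappa) `^ (p - 1)^-1.
have A0 : 0 < A by rewrite powR_gt0// divr_gt0// !mulr_gt0// ltr_wpDl.
have hA : M * (A `^ (1 - p) * CP) <= kappa / 2.
  have -> : A `^ (1 - p) = kappa / (2 * (M + 1) * CP).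
    have pn : p - 1 != 0 by rewrite subr_eq0 gt_eqF.
    have X0 : 0 < 2 * (M + 1) * CP / kappa by rewrite divr_gt0// !mulr_gt0// ltr_wpDl.
    by rewrite /A -[1 - p]opprB powRN -powRrM mulVf// powRr1 ?(ltW X0)// invf_div.
  have M1 : 0 < M + 1 by rewrite ltr_wpDl.
  rewrite (_ : M * _ = kappa / 2 * (M / (M + 1))); last by field; rewrite !gt_eqF.
  apply: ler_piMr; first by rewrite divr_ge0 ?(ltW kappa0).
  by rewrite ler_pdivrMr// mul1r lerDl.
pose J v := fine (J1 v) - J2 v.
have Jge v : admissible v -> kappa / 2 * fine (energy s p v) - M * A * b <= J v.
  move=> av; have [mv v0 ev] := av; have := J2le A v A0 av.
  have := J1ge v mv; rewrite (J1fin v av) (energy_fineE ev) -EFinM lee_fin -/kappa.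
  have e0 : 0 <= fine (energy s p v) by rewrite fine_ge0// energy_ge0.
  have := ler_wpM2r e0 hA; rewrite /J; have := ler_norm (J2 v).
  move: (fine (energy s p v)) (fine (J1 v)) (J2 v) (A `^ (1 - p)) => E X Y W h1 h2 h3 h4.
  have -> : kappa / 2 * E - M * A * b = kappa * E - (kappa / 2 * E + M * A * b) by field.
  rewrite lerB//; apply: (le_trans h1); apply: (le_trans h4).
  have -> : M * (A * b + W * (CP * E)) = M * (W * CP) * E + M * A * b by ring.
  by rewrite lerD2r.
pose V := [set J v | v in admissible].
have adm0 : admissible (fun=> 0).
  split=> //; rewrite /energy (eq_integral (cst 0%E)) ?integral0// => z _.
  by rewrite subrr normr0 powR0 ?mul0r// gt_eqF.
have hV : has_inf V.
  split; first by exists (J (fun=> 0)); exists (fun=> 0).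
  exists (- (M * A * b)) => _ [v av <-]; apply: le_trans (Jge v av).
  rewrite lerDr; apply: mulr_ge0; first by rewrite divr_ge0// ltW.
  by apply: fine_ge0; exact: energy_ge0.
have /choice[v_ vP] : forall j : nat, exists v, admissible v /\ J v <= inf V + j.+1%:R^-1.
  move=> j; have ej : 0 < j.+1%:R^-1 :> R by rewrite invr_gt0.
  by have [_ [v av <-] h] := inf_adherent ej hV; exists v; split=> //; exact: ltW.
(* The coercivity bound [Jge] solved for the energy, at values of [J] up to [inf V + 1]. *)
pose E0 := 2 / kappa * (inf V + 1 + M * A * b).
have vE j : (energy s p (v_ j) <= E0%:E)%E.
  have [av h] := vP j; have [_ _ ev] := av; rewrite (energy_fineE ev) lee_fin /E0.
  have := Jge _ av; have : j.+1%:R^-1 <= 1 :> R by rewrite invf_le1// ler1n.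
  move: h; move: (fine _) (J _) (j.+1%:R^-1) => E X t h1 h2 h3.
  rewrite mulrAC ler_pdivlMr// mulrC; lra.
have [sg [v [sg1 mv v0 vc]]] := rellich s0 p1 n0 mO hO (fun j => let: And3 h _ _ := (vP j).1 in h)
   (fun j => let: And3 _ h _ := (vP j).1 in h) vE.
have vc2 := ae_prod vc.
have Ev : (energy s p v <= E0%:E)%E.
  apply: (fatou_le (f_ := fun j z => `|v_ (sg j) z.1 - v_ (sg j) z.2| `^ p * kern (s * p) z) (c_ := fun=> E0)).
  - by move=> j; apply: measurable_energy; have [[]] := vP (sg j).
  - by move=> j z; rewrite mulr_ge0 ?powR_ge0.
  - apply: filterS vc2 => z [h1 h2]; apply: cvgMr_tmp.
    have h3 : `|v_ (sg j) z.1 - v_ (sg j) z.2| @[j --> \oo] --> `|v z.1 - v z.2|.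
      by apply: cvg_norm; exact: cvgB.
    by apply: cvg_powR.
  - by move=> j; exact: vE.
  - exact: cvg_cst.
have av : admissible v by split => //; exact: le_lt_trans Ev (ltry _).
have vj j : admissible (v_ (sg j)) by have [] := vP (sg j).
(* The linear term has no sign, so Fatou's lemma does not apply to it; it converges because the
   bounded integrals of [p]-th powers make the differences uniformly integrable on [Omega]. *)
have J2cvg : J2 (v_ (sg j)) @[j --> \oo] --> J2 v.
  pose h_ j x := `|f x * (v_ (sg j) x - v x)|.
  have mvj j : measurable_fun setT (v_ (sg j)) by have [] := vj j.
  have CE : forall j, (\int[leb]_x (M * `|v_ (sg j) x - v x| `^ p)%:E <= (M * (CP * (2 `^ p * (E0 + E0))))%:E)%E.
    move=> j; have mvj' := mvj j.
    rewrite integral_finZ; [|by mfun|by move=> x; exact: powR_ge0|by []].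
    rewrite EFinM lee_wpmul2l ?lee_fin//.
    apply: (le_trans (HP (fun x => v_ (sg j) x - v x) _ _)); first by mfun.
      by have [_ w0 _] := vj j; move=> x nx; rewrite v0// w0// subrr.
    rewrite EFinM; apply: lee_wpmul2l; first by rewrite lee_fin ltW.
    exact: energyB (mvj j) mv (vE _) Ev.
  have : (\int[leb]_x (h_ j x)%:E @[j --> \oo] --> 0)%E.
    apply: (equiintegrable_cvg0 (b_ := fun j x => M * `|v_ (sg j) x - v x| `^ p) (w := fun x => M * \1_Omega x) _ _ _ _ _ _ _ _ _ CE).
    - by move=> j; have mvj' := mvj j; rewrite /h_; mfun.
    - by move=> j; have mvj' := mvj j; mfun.
    - by mfun.
    - by move=> j x; rewrite /h_.
    - by move=> j x; rewrite mulr_ge0 ?powR_ge0.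
    - by move=> x; rewrite mulr_ge0.
    - apply: filterS vc => x vx; rewrite /h_.
      have : `|f x * (v_ (sg j) x - v x)| @[j --> \oo] --> `|f x * (v x - v x)|.
        by apply: cvg_norm; apply: cvgMl_tmp; apply: cvgB => //; exact: cvg_cst.
      by rewrite subrr mulr0 normr0.
    - move=> e e0; have [|N N0 HN] := @powR_le_addZ R 1 p e _ e0; first by rewrite ltr01 p1.
      exists N => // j x; rewrite /h_ normrM.
      have [Ox|nOx] := pselect (Omega x).
        rewrite indicE mem_set// mulr1 [N * M]mulrC [e * _]mulrCA -mulrDr; apply: ler_pM => //.
        by have := HN _ (normr_ge0 (v_ (sg j) x - v x)); rewrite powRr1.
      have [_ w0 _] := vj j; rewrite v0// w0// subrr normr0 mulr0 indicE memNset// !mulr0 add0r.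
      by rewrite !mulr_ge0 ?powR_ge0// ltW.
    - rewrite integral_finZ; [|by mfun|by []|by []].
      rewrite integral_fin_indic//; apply: (@le_lt_trans _ _ (M%:E * b%:E)%E); last by rewrite -EFinM ltry.
      by rewrite lee_wpmul2l ?lee_fin.
  move=> /fine_cvgP[_ hc]; apply/cvgrPdist_le => e e0.
  have /cvgrPdist_le/(_ e e0) := hc; apply: filterS => j /=; rewrite sub0r normrN => he.
  apply: le_trans he; apply: le_trans (ler_norm _); rewrite -lee_fin.
  have adiff := admissibleB (vj j) av.
  have mvj' := mvj j.
  have hI : leb.-integrable setT (fun x => (f x * (v_ (sg j) x - v x))%:E) by exact: J2int adiff.
  rewrite fineK; last first.
    by have := integrable_fin_num _ (integrable_abse hI); apply.
  have e1 : (\int[leb]_x (f x * (v_ (sg j) x - v x))%:E = (J2 (v_ (sg j)) - J2 v)%:E)%E.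
    rewrite EFinB -J2fin; last exact: vj.
    rewrite -(J2fin v av) -(integralB_EFin measurableT (J2int _ (vj j)) (J2int _ av)).
    by apply: eq_integral => x _; rewrite mulrBr EFinB.
  have -> : (`|J2 v - J2 (v_ (sg j))|%:E = `|\int[leb]_x (f x * (v_ (sg j) x - v x))%:E|)%E.
    by rewrite e1 abse_EFin distrC.
  by apply: le_abse_integral => //; mfun.
(* Fatou's lemma for the nonnegative term with [F]; the bounds combine the minimizing property with
   the convergence of the linear term. *)
have Jv : J v <= inf V.
  rewrite /J lerBlDr -lee_fin -J1fin//.
  apply: (fatou_le (f_ := fun j z => F (v_ (sg j) z.1 - v_ (sg j) z.2) * K z) (c_ := fun j => inf V + j.+1%:R^-1 + J2 (v_ (sg j)))).
  - by move=> j; apply: mJ1; have [] := vj j.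
  - by move=> j z; rewrite mulr_ge0.
  - apply: filterS vc2 => z [h1 h2]; apply: cvgMr_tmp.
    have h3 : v_ (sg j) z.1 - v_ (sg j) z.2 @[j --> \oo] --> v z.1 - v z.2 by exact: cvgB.
    exact: (cvg_comp _ _ h3 (cF _)).
  - move=> j; rewrite -/(J1 (v_ (sg j))) (J1fin _ (vj j)) lee_fin -lerBlDr.
    have [_] := vP (sg j); move/le_trans; apply; rewrite lerD2l lef_pV2 ?posrE ?ltr0n// ler_nat ltnS.
    exact: increasing_seq_ge_id.
  - rewrite -[inf V in X in _ --> X]addr0; apply: cvgD => //; apply: cvgD; first exact: cvg_cst.
    exact: cvg_invS.
exists v; split=> // phi aphi.
have main (psi : T -> R) : admissible psi ->
    (leb \x leb)%E.-integrable setT (fun z => (Phi (v z.1 - v z.2) * (psi z.1 - psi z.2) * K z)%:E) /\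
    ((J2 psi)%:E <= \int[leb \x leb]_z (Phi (v z.1 - v z.2) * (psi z.1 - psi z.2) * K z)%:E)%E.
  move=> apsi; have [mpsi psi0 epsi] := apsi.
  have KE (w : T -> R) : admissible w -> (\int[leb \x leb]_z (`|w z.1 - w z.2| `^ p * K z)%:E < +oo)%E.
    move=> [mw w0 ew]; apply: (@le_lt_trans _ _ (L%:E * energy s p w)%E); last first.
      by rewrite lte_mul_pinfty// lee_fin ltW.
    rewrite /energy -integral_finZ; [|exact: measurable_energy|by move=> z; rewrite mulr_ge0 ?powR_ge0|exact: ltW].
    apply: le_integral_fin => z; first by rewrite mulr_ge0 ?powR_ge0.
    by rewrite mulrCA ler_wpM2l ?powR_ge0//; have /andP[] := hK z.
  apply: (euler_lagrange (F := F) (p := p) (L := L)) => //.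
  - exact: ltW.
  - by mfun.
  - by mfun.
  - exact: KE.
  - exact: KE.
  - move=> t t0.
    pose w x := v x + t * psi x.
    have aw : admissible w.
      have := admissibleB av (admissibleN (admissibleZ (ltW t0) apsi)).
      by rewrite (_ : (fun x => _) = w)//; apply/funext => x; rewrite opprK.
    have hw : J v <= J w by apply: (le_trans Jv); apply: inf_lbound; [case: hV|exists w].
    have e1 : fine (\int[leb \x leb]_z (F (v z.1 - v z.2 + t * (psi z.1 - psi z.2)) * K z)%:E)%E = fine (J1 w).
      congr fine; apply: eq_integral => z _; congr (_ * _)%:E; congr (F _); rewrite /w; ring.
    rewrite e1 -/(J1 v).
    have e2 : J2 w = J2 v + t * J2 psi.
      have tI : leb.-integrable setT (fun x => (t * (f x * psi x))%:E).
        by have := integrableZl measurableT t (J2int _ apsi); apply: eq_integrable.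
      apply: EFin_inj; rewrite EFinD EFinM -(J2fin w aw) -(J2fin v av) -(J2fin psi apsi).
      rewrite -(integralZl measurableT (J2int _ apsi)) -(integralD measurableT (J2int _ av) tI).
      by apply: eq_integral => x _; rewrite -EFinD; congr EFin; rewrite /w; ring.
    by move: hw; rewrite /J e2; move: (fine (J1 v)) (fine (J1 w)) (t * _) => X Y Z; lra.
have [I1 H1] := main _ aphi.
have [I2 H2] := main _ (admissibleN aphi).
split=> //; rewrite (J2fin _ aphi); apply/eqP; rewrite eq_le H1 andbT.
move: H2.
have -> : (\int[leb \x leb]_z (Phi (v z.1 - v z.2) * (- phi z.1 - - phi z.2) * K z)%:E = - \int[leb \x leb]_z (Phi (v z.1 - v z.2) * (phi z.1 - phi z.2) * K z)%:E)%E.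
  rewrite -integralN/=; last by apply: integrable_add_def.
  apply: eq_integral => z _; rewrite (_ : - phi z.1 - - phi z.2 = - (phi z.1 - phi z.2)); last by ring.
  by rewrite mulrN mulNr EFinN.
have -> : J2 (fun x => - phi x) = - J2 phi.
  apply: EFin_inj; rewrite EFinN -(J2fin _ (admissibleN aphi)) -(J2fin _ aphi).
  rewrite -integralN; last exact: integrable_add_def (J2int _ aphi).
  by apply: eq_integral => z _; rewrite mulrN EFinN.
by rewrite EFinN leeN2.
Qed.

End weak_existence.

(** * Testing the equation with functions of the solution *)

Section apriori.
Context {R : realType} {n : nat}.
Local Notation leb := (@lebesgue_rV R n).
Local Notation T := 'rV[R]_n.
Variables (s p L : R) (Phi : R -> R) (K : T * T -> R) (Omega : set T).
Hypotheses (s0 : 0 < s) (p1 : 1 < p) (L1 : 1 <= L).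
Hypotheses (cPhi : continuous Phi) (hPhi : forall t, L^-1 * `|t| `^ p <= Phi t * t <= L * `|t| `^ p).
Hypotheses (mK : measurable_fun setT K) (hK : forall z, L^-1 * kern (s * p) z <= K z <= L * kern (s * p) z).
Let p0 : 0 < p. Proof. exact: lt_trans p1. Qed.
Let L0 : 0 < L. Proof. exact: lt_le_trans L1. Qed.

Lemma admissible_comp (psi : R -> R) (v : T -> R) : nd_contraction psi ->
  admissible s p Omega v -> admissible s p Omega (psi \o v).
Proof.
move=> hpsi [mv v0 ev]; have [_ psi0 lip] := hpsi.
split; first by apply: measurableT_comp => //; exact: nd_contraction_measurable.
  by move=> x /v0 /= ->.
apply: le_lt_trans ev; apply: le_integral_fin => z; first by rewrite mulr_ge0 ?powR_ge0.
rewrite ler_wpM2r ?powR_ge0//; apply: ge0_ler_powR; rewrite ?nnegrE ?(ltW p0)//.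
exact: lip.
Qed.

(** The tested form equals the integral of [f psi(v)], at most [b M]. Monotonicity of [psi] makes
    its integrand nonnegative, and returning from [Phi] and [K] to pure powers costs a factor [L]
    each. *)
Lemma tested_energy (f v : T -> R) (psi : R -> R) (b M : R) : 0 <= b -> measurable_fun setT f ->
  (\int[leb]_x `|f x|%:E <= M%:E)%E -> solves s p Phi K Omega f v ->
  nd_contraction psi -> (forall t, `|psi t| <= b) ->
  (\int[leb \x leb]_z (`|v z.1 - v z.2| `^ (p - 1) * `|psi (v z.1) - psi (v z.2)| * kern (s * p) z)%:E
   <= (L * L * (b * M))%:E)%E.
Proof.
move=> b0 mf fM [av sv] hpsi psib; have [mv v0 ev] := av.
have [hom psi0 lip] := hpsi.
have mpsi := nd_contraction_measurable hpsi.
have mPhi : measurable_fun setT Phi by exact: continuous_measurable_fun.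
have mk := @measurable_kern R n (s * p).
have [I1 E1] := sv _ (admissible_comp hpsi av).
have K0 z : 0 <= K z by apply: le_trans (andP (hK z)).1; rewrite mulr_ge0 ?powR_ge0 ?invr_ge0 ?ltW.
have sgn z : 0 <= (v z.1 - v z.2) * (psi (v z.1) - psi (v z.2)).
  have [h|/ltW h] := leP (v z.1) (v z.2).
    by rewrite mulr_le0// subr_le0//; exact: hom.
  by rewrite mulr_ge0// subr_ge0//; exact: hom.
have P z : `|v z.1 - v z.2| `^ (p - 1) * `|psi (v z.1) - psi (v z.2)| * kern (s * p) z <=
    L * L * (Phi (v z.1 - v z.2) * (psi (v z.1) - psi (v z.2)) * K z).
  have h1 := growth_ge cPhi p1 L1 hPhi (sgn z).
  have /andP[h2 _] := hK z.
  set X := _ * `|_|; have X0 : 0 <= X by rewrite mulr_ge0 ?powR_ge0.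
  have -> : X * kern (s * p) z = L * L * ((L^-1 * X) * (L^-1 * kern (s * p) z)) by field; rewrite gt_eqF.
  rewrite ler_wpM2l ?mulr_ge0 ?(ltW L0)//; apply: ler_pM => //; rewrite mulr_ge0 ?invr_ge0 ?(ltW L0)//.
  exact: powR_ge0.
have H0 z : 0 <= Phi (v z.1 - v z.2) * (psi (v z.1) - psi (v z.2)) * K z.
  rewrite mulr_ge0//; apply: le_trans (growth_ge cPhi p1 L1 hPhi (sgn z)).
  by rewrite mulr_ge0 ?invr_ge0 ?(ltW L0)// mulr_ge0 ?powR_ge0.
apply: (@le_trans _ _ (\int[leb \x leb]_z (L * L * (Phi (v z.1 - v z.2) * (psi (v z.1) - psi (v z.2)) * K z))%:E)%E).
  by apply: le_integral_fin => z; [rewrite !mulr_ge0 ?powR_ge0|exact: P].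
have LL : 0 <= L * L by rewrite mulr_ge0 ?ltW.
rewrite integral_finZ; [|by mfun|by []|by []].
rewrite [leRHS]EFinM; apply: lee_wpmul2l; first by rewrite lee_fin.
move: E1 => /= ->.
apply: (@le_trans _ _ (\int[leb]_x (b * `|f x|)%:E)%E); last first.
  rewrite integral_finZ; [|by mfun|by []|by []].
  by rewrite [leRHS]EFinM; apply: lee_wpmul2l; rewrite ?lee_fin.
apply: (@le_trans _ _ (`|\int[leb]_x (f x * psi (v x))%:E|)%E); first exact: lee_abs.
apply: (le_trans (le_abse_integral _ _ _)) => //; first by mfun.
apply: ge0_le_integralW => x _ //; rewrite lee_fin normrM mulrC ler_wpM2r//.
Qed.

(** The rescaled test map [psi'] is again a contraction, now with bound [k b]. The powers of [k]
    cancel against [M <= k^(p - 1) d^(n - s p)], and those of [d] add up to [2 n]. *)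
Lemma solves_normalized (f v : T -> R) (M d k : R) : measurable Omega -> 0 < d -> 0 < k ->
  (forall x y, Omega x -> Omega y -> enorm (x - y) <= d) ->
  measurable_fun setT f -> (\int[leb]_x `|f x|%:E <= M%:E)%E ->
  M <= k `^ (p - 1) * d `^ (n%:R - s * p) -> solves s p Phi K Omega f v ->
  normalized s p (L * L) d Omega (fun x => k^-1 * v x).
Proof.
move=> mO d0 k0 hd mf fM Mk sv; have [[mv v0 ev] _] := sv.
split => //; first by mfun.
  by move=> x /v0 ->; rewrite mulr0.
move=> psi b hpsi psib; have [hom psi0 lip] := hpsi.
have b0 : 0 <= b by apply: le_trans (psib 0).
have k0' : 0 < k^-1 by rewrite invr_gt0.
pose psi' t := k * psi (k^-1 * t).
have hpsi' : nd_contraction psi'.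
  split=> [x y xy||x y].
  - by rewrite /psi' ler_wpM2l ?(ltW k0)//; apply: hom; rewrite ler_wpM2l ?(ltW k0').
  - by rewrite /psi' mulr0 psi0 mulr0.
  - rewrite /psi' -mulrBr normrM (gtr0_norm k0) -ler_pdivlMl//.
    by apply: (le_trans (lip _ _)); rewrite -mulrBr normrM (gtr0_norm k0').
have psib' t : `|psi' t| <= k * b by rewrite /psi' normrM (gtr0_norm k0) ler_wpM2l ?(ltW k0).
have kb0 : 0 <= k * b by rewrite mulr_ge0// ltW.
have h := tested_energy kb0 mf fM sv hpsi' psib'.
pose C := k `^ (1 - p) * k^-1 * d `^ (n%:R + s * p).
have C0 : 0 <= C by rewrite !mulr_ge0 ?powR_ge0 ?(ltW k0').
have mk := @measurable_kern R n (s * p).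
have mpsi' := nd_contraction_measurable hpsi'.
have E z : `|k^-1 * v z.1 - k^-1 * v z.2| `^ (p - 1) * `|psi (k^-1 * v z.1) - psi (k^-1 * v z.2)| *
    (enorm (z.1 - z.2) / d) `^ (- (n%:R + s * p)) =
    C * (`|v z.1 - v z.2| `^ (p - 1) * `|psi' (v z.1) - psi' (v z.2)| * kern (s * p) z).
  rewrite /psi' -!mulrBr !normrM (gtr0_norm k0) (gtr0_norm k0') !powRM ?enorm_ge0 ?invr_ge0 ?(ltW d0) ?(ltW k0)//.
  have iv (a b' : R) : 0 < a -> a^-1 `^ b' = a `^ (- b').
    by move=> a0; rewrite -[a^-1]powR_inv1 ?(ltW a0)// -powRrM mulN1r.
  rewrite !iv// opprK opprB.
  by rewrite /C /kern; field; rewrite gt_eqF.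
under eq_integral do rewrite E.
rewrite integral_finZ; [|by mfun|by move=> z; rewrite !mulr_ge0 ?powR_ge0|by []].
apply: (le_trans (lee_wpmul2l _ h)); first by rewrite lee_fin.
rewrite -EFinM lee_fin.
have -> : C * (L * L * (k * b * M)) = L * L * b * (k `^ (1 - p) * d `^ (n%:R + s * p) * M).
  by rewrite /C; field; rewrite gt_eqF.
rewrite ler_wpM2l ?mulr_ge0 ?(ltW L0)//.
apply: (@le_trans _ _ (k `^ (1 - p) * d `^ (n%:R + s * p) * (k `^ (p - 1) * d `^ (n%:R - s * p)))).
  by rewrite ler_wpM2l// mulr_ge0 ?powR_ge0.
rewrite le_eqVlt; apply/orP; left; apply/eqP.
rewrite -[d ^+ n]powR_mulrn ?(ltW d0)// -[in RHS]powR_mulrn ?powR_ge0// -powRrM !powR_expR// -!expRD.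
by congr expR; ring.
Qed.

End apriori.

Lemma indic_nneg (R : realType) (U : Type) (A : set U) (x : U) : 0 <= \1_A x :> R.
Proof. by rewrite indicE. Qed.

(** * Smoothing of measures *)

Section averages.
Context {R : realType} {n : nat}.
Local Notation leb := (@lebesgue_rV R n).
Local Notation T := 'rV[R]_n.

Definition proximity (r : R) : set (T * T) := [set z | box z.1 r z.2].

Lemma measurable_proximity r : measurable (proximity r).
Proof.
rewrite (_ : proximity r = \bigcap_(i in [set: 'I_n])
    (fun z : T * T => `|z.2 ord0 i - z.1 ord0 i|) @^-1` [set t | t <= r]); last first.
  by apply/seteqP; split => z /= h i => [_|]; exact: h.
apply: fin_bigcap_measurable => // i _; rewrite -[X in measurable X]setTI.
have mc := @measurable_coord R n i.
have m : measurable_fun setT (fun z : T * T => `|z.2 ord0 i - z.1 ord0 i|).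
  have m1 : measurable_fun setT (fun z : T * T => z.1 ord0 i) by exact: (measurableT_comp mc measurable_fst).
  have m2 : measurable_fun setT (fun z : T * T => z.2 ord0 i) by exact: (measurableT_comp mc measurable_snd).
  by mfun.
apply: m => //; rewrite [X in measurable X](_ : _ = `]-oo, r]%classic); first exact: measurable_itv.
by apply/seteqP; split=> t /=; rewrite in_itv.
Qed.

Variable nu : {finite_measure set T -> \bar R}.

(** Density of the convolution of [nu] with the uniform probability on a centred cube. *)
Definition cube_average (r : R) (x : T) : R := fine (nu (box x r)) / (2 * r) ^+ n.

Lemma cube_average_ge0 r x : 0 < r -> 0 <= cube_average r x.
Proof. by move=> r0; rewrite divr_ge0 ?fine_ge0// exprn_ge0// mulr_ge0// ltW. Qed.

Lemma finite_measure_fine (A : set T) : measurable A -> nu A = (fine (nu A))%:E.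
Proof. by move=> mA; rewrite fineK//; exact: fin_num_measure. Qed.

Lemma cube_average_le r x : 0 < r -> cube_average r x <= fine (nu setT) / (2 * r) ^+ n.
Proof.
move=> r0; rewrite ler_wpM2r ?invr_ge0 ?exprn_ge0 ?mulr_ge0 ?(ltW r0)//.
rewrite -lee_fin -!finite_measure_fine//; last exact: measurable_box.
by apply: le_measure; rewrite ?inE//; exact: measurable_box.
Qed.

Lemma integral_proximity1 r x :
  (\int[nu]_y (\1_(proximity r) (x, y))%:E = nu (box x r))%E.
Proof.
by rewrite -(integral_fin_indic nu (measurable_box x r)).
Qed.

Lemma integral_proximity2 r (y : T) : 0 <= r ->
  (\int[leb]_x (\1_(proximity r) (x, y))%:E = ((2 * r) ^+ n)%:E)%E.
Proof.
move=> r0; rewrite -(lebesgue_box y r0) -(integral_fin_indic leb (measurable_box y r)).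
apply: eq_integral => x _; congr EFin; rewrite !indicE; congr (nat_of_bool _)%:R.
by apply/idP/idP; rewrite !inE => h i; rewrite distrC; exact: h.
Qed.

Lemma measurable_proximity_indic r : measurable_fun setT (fun z : T * T => \1_(proximity r) z : R).
Proof. by apply: measurable_indic; exact: measurable_proximity. Qed.

Lemma measurable_proximity_section r x : measurable_fun setT (fun y : T => \1_(proximity r) (x, y) : R).
Proof.
rewrite (_ : (fun y : T => _) = \1_(box x r)); first by apply: measurable_indic; exact: measurable_box.
by apply/funext => y; rewrite !indicE.
Qed.

Lemma measurable_cube_average r : measurable_fun setT (cube_average r).
Proof.
have m : measurable_fun setT (fun x => fine (nu (box x r))).
  apply: (measurableT_comp (f := fine)) => //.
  have := measurable_fun_xsection nu (measurable_proximity r).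
  apply: eq_measurable_fun => x _; congr (nu _).
  by apply/seteqP; split => y /=; rewrite /xsection/= inE.
by rewrite /cube_average; mfun.
Qed.

Lemma cube_average_fubini_integrable r (psi : T -> R) : 0 < r -> measurable_fun setT psi ->
  (\int[leb]_x `|psi x|%:E < +oo)%E ->
  (leb \x nu)%E.-integrable setT (fun z => (psi z.1 * \1_(proximity r) z / (2 * r) ^+ n)%:E).
Proof.
move=> r0 mpsi ipsi; have mp := measurable_proximity r.
have m : measurable_fun setT (fun z : T * T => psi z.1 * \1_(proximity r) z / (2 * r) ^+ n).
  have m1 : measurable_fun setT (fun z : T * T => psi z.1) by exact: (measurableT_comp mpsi measurable_fst).
  by mfun.
have V0 : 0 < (2 * r) ^+ n by rewrite exprn_gt0// mulr_gt0.
have me : measurable_fun setT (fun z : T * T => (psi z.1 * \1_(proximity r) z / (2 * r) ^+ n)%:E).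
  exact/measurable_EFinP.
apply/(integrable12ltyP leb nu me).
apply: (@le_lt_trans _ _ (\int[leb]_x (fine (nu setT) / (2 * r) ^+ n * `|psi x|)%:E)%E).
  apply: ge0_le_integralW => x _; first by apply: integral_ge0.
  apply: (@le_trans _ _ (\int[nu]_y (`|psi x| / (2 * r) ^+ n * \1_(proximity r) (x, y))%:E)%E).
    apply: ge0_le_integralW => y _ //=; rewrite lee_fin !normrM.
    by rewrite mulrAC (ger0_norm (indic_nneg _ _ _)) normfV (gtr0_norm V0).
  have mx : measurable_fun setT (fun y : T => \1_(proximity r) (x, y) : R).
    exact: measurable_proximity_section.
  rewrite integral_finZ; [|exact: mx|by move=> y; exact: indic_nneg|by apply: divr_ge0 => //; exact: ltW].
  rewrite integral_proximity1 (finite_measure_fine (measurable_box x r)) -EFinM lee_fin.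
  have := cube_average_le x r0; rewrite /cube_average => h.
  by have := ler_wpM2r (normr_ge0 (psi x)) h; rewrite mulrAC -mulrA [X in X <= _]mulrC.
rewrite integral_finZ; [|by mfun|by []|by rewrite divr_ge0 ?fine_ge0// ltW].
by rewrite lte_mul_pinfty// lee_fin divr_ge0 ?fine_ge0// ltW.
Qed.

(** The averaging moves from [nu] to [psi]: the inner integral is the mean of [psi] over the cube
    around [y]. *)
Lemma cube_average_fubini r (psi : T -> R) : 0 < r -> measurable_fun setT psi ->
  (\int[leb]_x `|psi x|%:E < +oo)%E ->
  (\int[leb]_x (psi x * cube_average r x)%:E =
   \int[nu]_y \int[leb]_x (psi x * \1_(proximity r) (x, y) / (2 * r) ^+ n)%:E)%E.
Proof.
move=> r0 mpsi ipsi; have I := cube_average_fubini_integrable r0 mpsi ipsi.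
rewrite -(Fubini I); apply: eq_integral => x _ /=.
have mx : measurable_fun setT (fun y : T => \1_(proximity r) (x, y) : R).
  exact: measurable_proximity_section.
have Ix : nu.-integrable setT (fun y => (\1_(proximity r) (x, y) : R)%:E).
  apply/integrableP; split; first exact/measurable_EFinP.
  rewrite (eq_integral (fun y => (\1_(proximity r) (x, y) : R)%:E)); last first.
    by move=> y _; rewrite gee0_abs// lee_fin indic_nneg.
  by rewrite integral_proximity1 (finite_measure_fine (measurable_box x r)) ltry.
under eq_integral do rewrite mulrAC EFinM.
rewrite integralZl//.
rewrite integral_proximity1 (finite_measure_fine (measurable_box x r)) -EFinM /cube_average.
by congr EFin; ring.
Qed.

(** Only the mass of [nu] within [r] of [B] can reach [B], and averaging spreads each unit of mass
    into at most one. *)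
Lemma cube_average_indic_le r (B B' : set T) : 0 < r -> measurable B -> (leb B < +oo)%E ->
  measurable B' -> (forall x y, B x -> box x r y -> B' y) ->
  (\int[leb]_x (\1_B x * cube_average r x)%:E <= nu B')%E.
Proof.
move=> r0 mB fB mB' h; have V0 : 0 < (2 * r) ^+ n by rewrite exprn_gt0// mulr_gt0.
have mi : measurable_fun setT (\1_B : T -> R) by exact: measurable_indic.
have ii : (\int[leb]_x `|\1_B x : R|%:E < +oo)%E.
  rewrite (eq_integral (fun x => (\1_B x : R)%:E)); first by rewrite integral_fin_indic.
  by move=> x _; rewrite ger0_norm ?indic_nneg.
rewrite (cube_average_fubini r0 mi ii).
rewrite -(integral_fin_indic nu mB'); apply: ge0_le_integralW => y _.
  by apply: integral_fin_ge0 => x; rewrite !mulr_ge0 ?indic_nneg ?invr_ge0// ltW.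
have my : measurable_fun setT (fun x : T => \1_(proximity r) (x, y) : R).
  exact: (measurableT_comp (measurable_proximity_indic r) (pair2_measurable y)).
apply: (@le_trans _ _ (\int[leb]_x (\1_B' y / (2 * r) ^+ n * \1_(proximity r) (x, y))%:E)%E).
  apply: le_integral_fin => x; first by rewrite !mulr_ge0 ?indic_nneg ?invr_ge0// ltW.
  rewrite mulrAC; have [p|np] := pselect (proximity r (x, y)); last first.
    by rewrite [\1_(proximity r) _]indicE memNset// !mulr0.
  rewrite ler_wpM2r ?indic_nneg// ler_wpM2r ?invr_ge0 ?(ltW V0)//.
  rewrite [leLHS]indicE [leRHS]indicE; have [b|nb] := pselect (B x); last by rewrite memNset.
  by rewrite !mem_set//; exact: h p.
rewrite integral_finZ; [|exact: my|by move=> x; exact: indic_nneg|by rewrite divr_ge0 ?indic_nneg// ltW].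
by rewrite integral_proximity2 ?(ltW r0)// -EFinM lee_fin -mulrA mulVf ?mulr1// gt_eqF.
Qed.

(** By [cube_average_fubini] it suffices that the means of [psi] over shrinking cubes tend to [psi];
    they are bounded by the constant [M], which the finite measure [nu] integrates. *)
Lemma cube_average_cvg (r_ : nat -> R) (psi : T -> R) (M : R) : (forall j, 0 < r_ j) ->
  r_ j @[j --> \oo] --> 0 -> continuous psi -> (forall x, `|psi x| <= M) ->
  (\int[leb]_x `|psi x|%:E < +oo)%E ->
  (\int[leb]_x (psi x * cube_average (r_ j) x)%:E @[j --> \oo] --> \int[nu]_y (psi y)%:E)%E.
Proof.
move=> r0 rc cpsi psiM ipsi; have mpsi := continuous_measurable_rV cpsi.
pose A j y : \bar R := (\int[leb]_x (psi x * \1_(proximity (r_ j)) (x, y) / (2 * r_ j) ^+ n)%:E)%E.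
have V0 j : 0 < (2 * r_ j) ^+ n by rewrite exprn_gt0// mulr_gt0.
have my j y : measurable_fun setT (fun x : T => \1_(proximity (r_ j)) (x, y) : R).
  exact: (measurableT_comp (measurable_proximity_indic (r_ j)) (pair2_measurable y)).
have Ic j y : leb.-integrable setT (fun x => (\1_(proximity (r_ j)) (x, y) / (2 * r_ j) ^+ n)%:E).
  apply/integrableP; split; first by apply/measurable_EFinP; apply: measurable_funM; [exact: my|exact: measurable_cst].
  rewrite (eq_integral (fun x => ((2 * r_ j) ^- n * \1_(proximity (r_ j)) (x, y))%:E)); last first.
    by move=> x _; rewrite gee0_abs ?lee_fin ?divr_ge0 ?indic_nneg ?(ltW (V0 j))// mulrC.
  rewrite integral_finZ; [|exact: my|by move=> x; exact: indic_nneg|by rewrite invr_ge0 ltW].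
  by rewrite integral_proximity2 ?(ltW (r0 j))// -EFinM ltry.
have Ec j y (c : R) : (\int[leb]_x (c * (\1_(proximity (r_ j)) (x, y) / (2 * r_ j) ^+ n))%:E = c%:E)%E.
  under eq_integral do rewrite EFinM.
  rewrite integralZl//.
  under eq_integral do rewrite mulrC.
  rewrite integral_finZ; [|exact: my|by move=> x; exact: indic_nneg|by rewrite invr_ge0 ltW].
  by rewrite integral_proximity2 ?(ltW (r0 j))// -EFinM mulVf; [rewrite mulr1|rewrite gt_eqF].
have Icc j y (c : R) : leb.-integrable setT (fun x => (c * (\1_(proximity (r_ j)) (x, y) / (2 * r_ j) ^+ n))%:E).
  by under eq_fun do rewrite EFinM; apply: integrableZl.
have Ip j y : leb.-integrable setT (fun x => (psi x * \1_(proximity (r_ j)) (x, y) / (2 * r_ j) ^+ n)%:E).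
  apply: le_integrable (Icc j y M) => //.
    by apply/measurable_EFinP; apply: measurable_funM; [apply: measurable_funM => //; exact: my|exact: measurable_cst].
  move=> x _ /=; rewrite lee_fin -mulrA !normrM.
  by rewrite ler_wpM2r// (le_trans (psiM x))// ler_norm.
(* A mean lies between any bounds valid on its cube; this gives both the pointwise limit and the
   majorant. *)
have bd j y (a b : R) : (forall x, proximity (r_ j) (x, y) -> a <= psi x <= b) ->
    (a%:E <= A j y <= b%:E)%E.
  move=> h; apply/andP; split; [rewrite -(Ec j y a)|rewrite -(Ec j y b)]; rewrite /A.
    apply: le_integral => // x _; rewrite lee_fin -mulrA.
    have [p|np] := pselect (proximity (r_ j) (x, y)); last by rewrite indicE memNset// !mul0r !mulr0.
    by rewrite ler_wpM2r ?divr_ge0 ?indic_nneg ?(ltW (V0 j))//; have /andP[] := h x p.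
  apply: le_integral => // x _; rewrite lee_fin -mulrA.
  have [p|np] := pselect (proximity (r_ j) (x, y)); last by rewrite indicE memNset// !mul0r !mulr0.
  by rewrite ler_wpM2r ?divr_ge0 ?indic_nneg ?(ltW (V0 j))//; have /andP[] := h x p.
have E j : (\int[leb]_x (psi x * cube_average (r_ j) x)%:E = \int[nu]_y A j y)%E.
  exact: cube_average_fubini.
under eq_fun do rewrite E.
have [] := @dominated_convergence _ _ _ nu setT measurableT A (fun y => (psi y)%:E) (fun=> M%:E).
- by move=> j; have := measurable_fubini_G (cube_average_fubini_integrable (r0 j) mpsi ipsi).
- exact/measurable_EFinP.
- apply: nearW => y _.
  have Af j : A j y \is a fin_num by apply: integrable_fin_num.
  suff : fine (A j y) @[j --> \oo] --> psi y.
    by move=> h; apply/fine_cvgP; split; [exact: nearW|].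
  apply/cvgrPdist_le => e e0.
  have /cvgrPdist_le/(_ e e0) := cpsi y.
  move=> /nbhs_ballP[d/= d0 hd].
  have /cvgrPdist_lt/(_ d d0) := rc; apply: filterS => j /=.
  rewrite sub0r normrN gtr0_norm// => rd.
  have /andP[] : ((psi y - e)%:E <= A j y <= (psi y + e)%:E)%E.
    apply: bd => x px; rewrite -ler_distl distrC; apply: hd; split=> //.
    move=> i k; rewrite (ord1 i) -ball_normE/= distrC.
    by rewrite distrC; apply: le_lt_trans (px k) rd.
  rewrite -(fineK (Af j)) !lee_fin => h1 h2; rewrite distrC ler_distl; exact/andP.
- apply/integrableP; split; first exact: measurable_cst.
  have := finite_measure_fine measurableT => fT.
  rewrite (eq_integral (cst `|M|%:E))// integral_cst//.
  apply: (@le_lt_trans _ _ (`|M|%:E * (fine (nu setT))%:E)%E); last by rewrite -EFinM ltry.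
  by rewrite -fT; exact: lexx.
- apply: nearW => y j _; have /andP[] : ((- M)%:E <= A j y <= M%:E)%E.
    by apply: bd => x _; rewrite -ler_norml.
  have Af : A j y \is a fin_num by apply: integrable_fin_num.
  by rewrite -(fineK Af) !lee_fin => h1 h2; rewrite ler_norml h1.
by [].
Qed.

End averages.

(** * Euclidean norm, closed balls and compact supports *)

Section euclidean.
Context {R : realType} {n : nat}.
Implicit Types x y : 'rV[R]_n.

Lemma enorm_sqr x : enorm x ^+ 2 = \sum_(i < n) x ord0 i ^+ 2.
Proof. by rewrite sqr_sqrtr// sumr_ge0// => i _; exact: sqr_ge0. Qed.

Lemma enormZ (t : R) x : 0 <= t -> enorm (t *: x) = t * enorm x.
Proof.
move=> t0; apply/eqP; rewrite -(@eqrXn2 _ 2)// ?mulr_ge0 ?enorm_ge0//.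
rewrite exprMn !enorm_sqr mulr_sumr; apply/eqP/eq_bigr => i _.
by rewrite mxE exprMn.
Qed.

(* Young's inequality with the weights that make it sharp gives Cauchy-Schwarz. *)
Lemma enorm_cauchy x y : \sum_(i < n) x ord0 i * y ord0 i <= enorm x * enorm y.
Proof.
have [x0|x0] := eqVneq (enorm x) 0.
  rewrite x0 mul0r big1// => i _.
  by have := coord_le_enorm x i; rewrite x0 normr_le0 => /eqP ->; rewrite mul0r.
have [y0|y0] := eqVneq (enorm y) 0.
  rewrite y0 mulr0 big1// => i _.
  by have := coord_le_enorm y i; rewrite y0 normr_le0 => /eqP ->; rewrite mulr0.
have X0 : 0 < enorm x by rewrite lt_neqAle eq_sym x0 enorm_ge0.
have Y0 : 0 < enorm y by rewrite lt_neqAle eq_sym y0 enorm_ge0.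
set A := enorm x; set B := enorm y.
apply: (@le_trans _ _ (\sum_(i < n) (B / (2 * A) * x ord0 i ^+ 2 + A / (2 * B) * y ord0 i ^+ 2))).
  apply: ler_sum => i _; rewrite -subr_ge0.
  rewrite (_ : _ - _ = A * B / 2 * (x ord0 i / A - y ord0 i / B) ^+ 2).
    by rewrite mulr_ge0 ?sqr_ge0// divr_ge0// mulr_ge0// ltW.
  by field; rewrite !gt_eqF.
rewrite big_split/= -!mulr_sumr -!enorm_sqr -/A -/B le_eqVlt; apply/orP; left; apply/eqP.
by field; rewrite !gt_eqF.
Qed.

Lemma enormD x y : enorm (x + y) <= enorm x + enorm y.
Proof.
rewrite -(@ler_pXn2r _ 2)// ?nnegrE ?addr_ge0 ?enorm_ge0// sqrrD !enorm_sqr.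
rewrite (eq_bigr (fun i => x ord0 i ^+ 2 + x ord0 i * y ord0 i *+ 2 + y ord0 i ^+ 2)); last first.
  by move=> i _; rewrite mxE sqrrD.
rewrite !big_split/= lerD2r lerD2l.
rewrite mulr2n; apply: lerD; exact: enorm_cauchy.
Qed.

(** Enlarged balls will decrease to the closed ball, whereas the comparison is with the closure of
    the open one. A point of the closed ball is contracted toward [x] by the factor [r / (r + e)],
    which moves each coordinate by less than [e]. *)
Lemma closed_eball_closure x (r : R) y : 0 < r -> enorm (y - x) <= r -> closure (eball x r) y.
Proof.
move=> r0 hy B /nbhs_ballP[e/= e0 eB].
have re : 0 < r + e by rewrite addr_gt0.
pose t := r / (r + e).
have t0 : 0 <= t by rewrite divr_ge0// ltW.
have t1 : t < 1 by rewrite ltr_pdivrMr// mul1r ltrDl.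
exists (x + t *: (y - x)); split.
  rewrite /eball/= addrAC subrr add0r enormZ//.
  apply: (@le_lt_trans _ _ (t * r)); first by rewrite ler_wpM2l.
  by rewrite gtr_pMl.
apply: eB; split=> // i k; rewrite (ord1 i) -ball_normE/= !mxE.
have -> : y ord0 k - (x ord0 k + t * (y ord0 k - x ord0 k)) = (1 - t) * (y ord0 k - x ord0 k) by ring.
rewrite normrM ger0_norm ?subr_ge0 ?(ltW t1)//.
have h : `|y ord0 k - x ord0 k| <= r.
  by apply: le_trans hy; have := coord_le_enorm (y - x) k; rewrite !mxE.
apply: (@le_lt_trans _ _ ((1 - t) * r)); first by rewrite ler_wpM2l// subr_ge0 ltW.
have -> : (1 - t) * r = e * (r / (r + e)) by rewrite /t; field; rewrite gt_eqF.
by rewrite gtr_pMr.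
Qed.

Lemma csupported_bounded (U : set 'rV[R]_n) (psi : 'rV[R]_n -> R) : continuous psi -> csupported U psi ->
  exists2 M, 0 <= M & forall x, `|psi x| <= M.
Proof.
move=> cpsi [cS _].
have /compact_bounded[M [_ hM]] : compact (psi @` closure [set x | psi x != 0]).
  by apply: continuous_compact => //; exact: continuous_subspaceT.
exists (Num.max M 0 + 1); first by rewrite addr_ge0// le_max lexx orbT.
have M1 : M < Num.max M 0 + 1 by rewrite (@le_lt_trans _ _ (Num.max M 0))// ?ltrDl// le_max lexx.
move=> x; have [->|x0] := eqVneq (psi x) 0.
  by rewrite normr0 addr_ge0// le_max lexx orbT.
by apply: (hM _ M1); exists x => //; exact: subset_closure.
Qed.

Lemma csupported_off (U : set 'rV[R]_n) (psi : 'rV[R]_n -> R) x : csupported U psi -> ~ U x -> psi x = 0.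
Proof.
move=> [_ SU] nU; apply/eqP/negP => /negP h; apply: nU; apply: SU.
exact: subset_closure.
Qed.

End euclidean.

Lemma limn_esup_le_nonincreasing (R : realType) (u v : nat -> \bar R) (l : \bar R) :
  (forall j, (u j <= v j)%E) -> (forall i j, (i <= j)%N -> (v j <= v i)%E) ->
  v j @[j --> \oo] --> l -> (limn_esup u <= l)%E.
Proof.
move=> uv vn vl; rewrite limn_esup_lim -(cvg_lim _ vl)//.
apply: lee_lim; [exact: is_cvg_esups|by apply/cvg_ex; exists l|].
apply: nearW => i; apply: ge_ereal_sup => _ [j /= ij <-].
exact: le_trans (uv j) (vn _ _ ij).
Qed.

Section smoothing.
Context {R : realType} {n : nat}.
Local Notation leb := (@lebesgue_rV R n).
Local Notation T := 'rV[R]_n.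
Variables (Omega : set T) (mu : {charge set T -> \bar R}) (b : R).
Hypotheses (mO : measurable Omega) (hb : (leb Omega <= b%:E)%E).
Hypothesis (hmu : finite_radon_measure Omega mu).

Let nup : {finite_measure set T -> \bar R} := jordan_pos (hahnP mu).
Let nun : {finite_measure set T -> \bar R} := jordan_neg (hahnP mu).

Let tvE A : charge_tv mu A = (nup A + nun A)%E. Proof. by []. Qed.

Lemma charge_tv_fine A : measurable A -> charge_tv mu A = (fine (charge_tv mu A))%:E.
Proof.
move=> mA; rewrite fineK// tvE (finite_measure_fine nup mA) (finite_measure_fine nun mA).
by rewrite -EFinD.
Qed.

Lemma charge_tvT : charge_tv mu setT = charge_tv mu Omega.
Proof.
have h : (nup (~` Omega) + nun (~` Omega) = 0)%E by exact: hmu.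
have /eqP := h; rewrite padde_eq0// => /andP[/eqP h1 /eqP h2].
have E (nu : {finite_measure set T -> \bar R}) : nu setT = (nu Omega + nu (~` Omega))%E.
  by rewrite -measureU//; [rewrite setUv|exact: measurableC|exact: setICr].
transitivity ((nup Omega + nup (~` Omega)) + (nun Omega + nun (~` Omega)))%E.
  by rewrite tvE; congr (_ + _)%E; exact: E.
by rewrite h1 h2 !adde0.
Qed.

(** The cut to [Omega] only lowers the mass and is invisible to functions supported in [Omega]. *)
Definition smoothing (r : R) (x : T) : R := \1_Omega x * (cube_average nup r x - cube_average nun r x).

Lemma measurable_smoothing r : measurable_fun setT (smoothing r).
Proof.
have m1 := measurable_cube_average nup r; have m2 := measurable_cube_average nun r.
by rewrite /smoothing; mfun.
Qed.

Lemma smoothing_le r x : 0 < r -> `|smoothing r x| <= cube_average nup r x + cube_average nun r x.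
Proof.
move=> r0; have p0 := cube_average_ge0 nup x r0; have n0 := cube_average_ge0 nun x r0.
rewrite /smoothing normrM ger0_norm ?indic_nneg//.
apply: (@le_trans _ _ `|cube_average nup r x - cube_average nun r x|).
  by apply: ler_piMl => //; rewrite indicE; case: (_ \in _).
by apply: (le_trans (ler_normB _ _)); rewrite !ger0_norm.
Qed.

Lemma smoothing_bounded r : 0 < r -> exists M, forall x, `|smoothing r x| <= M.
Proof.
move=> r0; eexists => x; apply: (le_trans (smoothing_le x r0)).
apply: lerD; exact: cube_average_le.
Qed.

Lemma smoothing_integral_le r (B B' : set T) : 0 < r -> measurable B -> measurable B' ->
  (forall x y, B x -> box x r y -> B' y) ->
  (\int[leb]_(x in Omega `&` B) `|smoothing r x|%:E <= charge_tv mu B')%E.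
Proof.
move=> r0 mB mB' h; have mOB : measurable (Omega `&` B) by exact: measurableI.
have fO : (leb (Omega `&` B) < +oo)%E.
  by apply: (@le_lt_trans _ _ (leb Omega)); [apply: le_measure; rewrite ?inE|apply: le_lt_trans hb (ltry _)].
have m1 := measurable_cube_average nup r; have m2 := measurable_cube_average nun r.
have h' x y : (Omega `&` B) x -> box x r y -> B' y by move=> [_ Bx]; exact: h.
rewrite integral_mkcond.
apply: (@le_trans _ _ (\int[leb]_x (\1_(Omega `&` B) x * cube_average nup r x + \1_(Omega `&` B) x * cube_average nun r x)%:E)%E).
  apply: ge0_le_integralW => x _; rewrite patchE; case: ifPn => // xB.
    by rewrite lee_fin indicE xB !mul1r; exact: smoothing_le.
  by rewrite lee_fin indicE (negbTE xB) !mul0r addr0.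
rewrite integral_finD; [|by mfun|by mfun|by move=> x; rewrite mulr_ge0 ?indic_nneg ?cube_average_ge0|by move=> x; rewrite mulr_ge0 ?indic_nneg ?cube_average_ge0].
rewrite tvE; apply: leeD; exact: cube_average_indic_le r0 mOB fO mB' h'.
Qed.

Lemma smoothing_mass r : 0 < r -> (\int[leb]_x `|smoothing r x|%:E <= charge_tv mu Omega)%E.
Proof.
move=> r0; rewrite -charge_tvT.
apply: le_trans (smoothing_integral_le (B := setT) (B' := setT) r0 measurableT measurableT _) => //.
rewrite setIT [leRHS]integral_mkcond; apply: ge0_le_integralW => x _ //.
rewrite patchE; case: ifPn => // nx.
by rewrite /smoothing indicE (negbTE nx) mul0r normr0.
Qed.

(** The mass seen in the ball comes from the enlarged balls [F j], which decrease to the closed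
    ball; finite measures are continuous along this sequence. The factor [n] in [F] converts the
    half-side of a cube into a distance. *)
Lemma smoothing_limsup (r_ : nat -> R) x r : (forall j, 0 < r_ j) -> (forall i j, (i <= j)%N -> r_ j <= r_ i) ->
  r_ j @[j --> \oo] --> 0 -> 0 < r ->
  (limn_esup (fun j => \int[leb]_(y in Omega `&` eball x r) `|smoothing (r_ j) y|%:E) <= charge_tv mu (closure (eball x r)))%E.
Proof.
move=> r0 rn rc r00.
pose F j := [set y : T | enorm (x - y) <= r + n%:R * r_ j].
have mle (a : R) : measurable [set y : T | enorm (x - y) <= a].
  rewrite -[X in measurable X]setTI.
  rewrite (_ : [set y | _] = (fun y => enorm (x - y)) @^-1` `]-oo, a]%classic); last first.
    by apply/seteqP; split=> y /=; rewrite in_itv.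
  by apply: measurable_enorm2 => //; exact: measurable_itv.
have mF j : measurable (F j) by exact: mle.
have mball : measurable (eball x r).
  rewrite -[X in measurable X]setTI.
  rewrite (_ : eball x r = (fun y => enorm (x - y)) @^-1` `]-oo, r[%classic); last first.
    by apply/seteqP; split=> y /=; rewrite in_itv/= enorm_sym.
  by apply: measurable_enorm2 => //; exact: measurable_itv.
have Fn i j : (i <= j)%N -> F j `<=` F i.
  by move=> ij y /= h; apply: (le_trans h); rewrite lerD2l ler_wpM2l// rn.
have FE : \bigcap_j F j = [set y | enorm (x - y) <= r].
  apply/seteqP; split=> y /= h; last first.
    by move=> j _; apply: (le_trans h); rewrite lerDl mulr_ge0// ltW.
  apply/ler_addgt0Pr => e e0.
  have : (n%:R * r_ j) @[j --> \oo] --> (n%:R * 0 : R) by apply: cvgMl_tmp.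
  rewrite mulr0 => /cvgrPdist_le/(_ e e0)[N _ /(_ N (leqnn _))] /=.
  rewrite sub0r normrN ger0_norm ?mulr_ge0 ?(ltW (r0 N))// => hN.
  by apply: (le_trans (h N I)); rewrite lerD2l.
have mcap : measurable (\bigcap_j F j) by rewrite FE; exact: mle.
have cF (nu : {finite_measure set T -> \bar R}) : nu (F j) @[j --> \oo] --> nu (\bigcap_j F j).
  apply: nonincreasing_cvg_mu => //; first by apply: (@le_lt_trans _ _ (fine (nu (F 0%N)))%:E); [rewrite -(finite_measure_fine nu (mF 0%N)); exact: lexx|exact: ltry].
  by move=> i j ij; apply/subsetPset; exact: Fn.
apply: (@le_trans _ _ (charge_tv mu (\bigcap_j F j))).
  apply: (@limn_esup_le_nonincreasing _ _ (fun j => charge_tv mu (F j))).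
  - move=> j; apply: smoothing_integral_le => // z y zx hy.
    rewrite /F/= enorm_sym.
    have -> : y - x = (y - z) + (z - x) by rewrite addrA subrK.
    apply: (le_trans (enormD _ _)); rewrite addrC; apply: lerD; first exact: ltW.
    by rewrite enorm_sym; apply: box_enorm_le => //; exact: ltW.
  - move=> i j ij; rewrite !tvE; apply: leeD; apply: le_measure; rewrite ?inE//; exact: Fn.
  - rewrite tvE; have c1 := cF nup; have c2 := cF nun.
    by apply: cvgeD => //; rewrite (finite_measure_fine nup mcap) (finite_measure_fine nun mcap).
rewrite FE !tvE.
have mcl : measurable (closure (eball x r)).
  by rewrite -[X in measurable X]setCK; apply: measurableC; apply: open_measurable_rV; apply: closed_openC; exact: closed_closure.
have sub : [set y | enorm (x - y) <= r] `<=` closure (eball x r).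
  by move=> y /= h; apply: closed_eball_closure => //; rewrite enorm_sym.
by apply: leeD; apply: le_measure; rewrite ?inE//; exact: mle.
Qed.

Lemma smoothing_cvg (r_ : nat -> R) (psi : T -> R) : (forall j, 0 < r_ j) ->
  r_ j @[j --> \oo] --> 0 -> continuous psi -> csupported Omega psi ->
  (\int[leb]_(x in Omega) (psi x * smoothing (r_ j) x)%:E @[j --> \oo] --> charge_integral mu Omega psi)%E.
Proof.
move=> r0 rc cpsi spsi.
have [M M0 hM] := csupported_bounded cpsi spsi.
have off x : ~ Omega x -> psi x = 0 by exact: csupported_off spsi.
have mpsi := continuous_measurable_rV cpsi.
have ipsi : (\int[leb]_x `|psi x|%:E < +oo)%E.
  apply: (@le_lt_trans _ _ (\int[leb]_x (M * \1_Omega x)%:E)%E).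
    apply: ge0_le_integralW => x _ //; rewrite lee_fin.
    have [Ox|nOx] := pselect (Omega x); first by rewrite indicE mem_set// mulr1.
    by rewrite off// normr0 mulr_ge0.
  rewrite integral_finZ; [|by mfun|by move=> x; exact: indic_nneg|by []].
  rewrite integral_fin_indic//; apply: (@le_lt_trans _ _ (M%:E * b%:E)%E); last by rewrite -EFinM ltry.
  by rewrite lee_wpmul2l.
have ipsi' : leb.-integrable setT (EFin \o psi) by apply/integrableP; split; first exact/measurable_EFinP.
have onO (nu : {measure set T -> \bar R}) : (\int[nu]_(x in Omega) (psi x)%:E = \int[nu]_x (psi x)%:E)%E.
  rewrite integral_mkcond; apply: eq_integral => x _; rewrite patchE; case: ifPn => //.
  by rewrite notin_setE => /off ->.
have fin (nu : {finite_measure set T -> \bar R}) : (\int[nu]_x (psi x)%:E \is a fin_num)%E.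
  apply: integrable_fin_num => //; apply/integrableP; split; first exact/measurable_EFinP.
  apply: (@le_lt_trans _ _ (\int[nu]_x (M * \1_setT x)%:E)%E).
    apply: ge0_le_integralW => x _ //=; by rewrite lee_fin indicE in_setT mulr1.
  rewrite integral_finZ; [|by mfun|by move=> x; exact: indic_nneg|by []].
  apply: (@le_lt_trans _ _ (M%:E * (fine (nu setT))%:E)%E); last by rewrite -EFinM ltry.
  rewrite -(finite_measure_fine nu measurableT); apply: lee_wpmul2l; first by rewrite lee_fin.
  by have := integral_fin_indic nu measurableT => ->; exact: lexx.
have iav (nu : {finite_measure set T -> \bar R}) j : leb.-integrable setT (fun x => (psi x * cube_average nu (r_ j) x)%:E).
  have m1 := measurable_cube_average nu (r_ j).
  pose c := fine (nu setT) / (2 * r_ j) ^+ n.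
  have I1 : leb.-integrable setT (fun x => (c * psi x)%:E).
    by under eq_fun do rewrite EFinM; apply: integrableZl.
  apply: le_integrable I1 => //; first by mfun.
  move=> x _ /=; rewrite lee_fin [leLHS]normrM [leRHS]normrM mulrC ler_wpM2r//.
  rewrite (ger0_norm (cube_average_ge0 nu x (r0 j))).
  by apply: le_trans (cube_average_le nu x (r0 j)) (ler_norm _).
have cv (nu : {finite_measure set T -> \bar R}) := @cube_average_cvg R n nu r_ psi M r0 rc cpsi hM ipsi.
rewrite /charge_integral !onO.
rewrite (_ : (fun j => _) = (fun j => \int[leb]_x (psi x * cube_average nup (r_ j) x)%:E - \int[leb]_x (psi x * cube_average nun (r_ j) x)%:E)%E); last first.
  apply/funext => j; rewrite -(integralB measurableT (iav nup j) (iav nun j)).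
  rewrite [LHS]integral_mkcond; apply: eq_integral => x _; rewrite patchE -EFinB -mulrBr; case: ifPn => xO.
    by rewrite /smoothing indicE xO mul1r.
  by move: xO; rewrite notin_setE => /off ->; rewrite mul0r.
have f1 := fin nup; have f2 := fin nun.
apply: cvgeB; [|exact: cv|exact: cv].
by rewrite fin_num_adde_defl// fin_numN.
Qed.

End smoothing.

(** * Test functions *)

Section test_functions.
Context {R : realType} {n : nat}.
Local Notation leb := (@lebesgue_rV R n).
Local Notation T := 'rV[R]_n.

Lemma is_derive_line (phi : T -> R) (x v : T) : (forall y, derivable phi y v) ->
  forall t : R, is_derive t (1 : R) (fun t => phi (x + t *: v)) ('D_v phi (x + t *: v)).
Proof.
move=> dphi t.
have E : (fun h : R => h^-1 *: (((fun t => phi (x + t *: v)) \o shift t) (h *: (1 : R)) - phi (x + t *: v))) =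
    (fun h : R => h^-1 *: ((phi \o shift (x + t *: v)) (h *: v) - phi (x + t *: v))).
  apply/funext => h /=; congr (_ *: (phi _ - _)).
  by rewrite [_ *: 1]mulr1 scalerDl addrCA.
split; first by rewrite /derivable E; exact: dphi.
by rewrite /derive E.
Qed.

Lemma partial_bounded (U : set T) (phi : T -> R) (i : 'I_n) : test_function U phi ->
  exists2 M, 0 <= M & forall x, `|'D_(delta_mx ord0 i) phi x| <= M.
Proof.
move=> [sm [cS _]]; have [cD _] := sm [:: i].
have /compact_bounded[M [_ hM]] : compact ('D_(delta_mx ord0 i) phi @` closure [set x | phi x != 0]).
  by apply: continuous_compact => //; exact: continuous_subspaceT.
exists (Num.max M 0 + 1); first by rewrite addr_ge0// le_max lexx orbT.
have M1 : M < Num.max M 0 + 1 by rewrite (@le_lt_trans _ _ (Num.max M 0))// ?ltrDl// le_max lexx.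
move=> x; have [Sx|Sx] := pselect (closure [set x | phi x != 0] x).
  by apply: (hM _ M1); exists x.
have nx : \forall y \near x, phi y = (cst 0 : T -> R) y.
  have : nbhs x (~` closure [set x | phi x != 0]).
    by apply: open_nbhs_nbhs; split=> //; apply: closed_openC; exact: closed_closure.
  apply: filterS => y /= Sy; apply/eqP/negP => /negP h; apply: Sy; exact: subset_closure.
rewrite (near_eq_derive _ nx) derive_cst normr0 addr_ge0// le_max lexx orbT//.
Qed.

(** The segment is replaced by a path that changes one coordinate at a time, so that bounds on
    partial derivatives and the mean value theorem on lines suffice. *)
Lemma test_function_lipschitz (U : set T) (phi : T -> R) : test_function U phi ->
  exists2 M, 0 <= M & forall x y, `|phi x - phi y| <= M * enorm (x - y).
Proof.
move=> tphi; have [sm _] := tphi; have [_ dphi] := sm [::].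
have /choice[M_ MP] : forall i : 'I_n, exists M, 0 <= M /\ forall x, `|'D_(delta_mx ord0 i) phi x| <= M.
  by move=> i; have [M ? ?] := partial_bounded i tphi; exists M.
pose M := \sum_(i < n) M_ i.
have M0 : 0 <= M by apply: sumr_ge0 => i _; have [] := MP i.
have Mi i : M_ i <= M.
  by rewrite /M (bigD1 i)//= lerDl sumr_ge0// => j _; have [] := MP j.
exists (n%:R * M); first by rewrite mulr_ge0.
move=> x y; pose z (k : nat) : T := \row_j (if (j < k)%N then y ord0 j else x ord0 j).
have z0 : z 0%N = x by apply/rowP => j; rewrite mxE.
have zn : z n = y by apply/rowP => j; rewrite mxE ltn_ord.
have H (k : nat) : (k <= n)%N -> `|phi x - phi (z k)| <= k%:R * (M * enorm (x - y)).
  elim: k => [|k ih] kn; first by rewrite z0 subrr normr0 mul0r.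
  have -> : phi x - phi (z k.+1) = (phi x - phi (z k)) + (phi (z k) - phi (z k.+1)) by rewrite addrA subrK.
  apply: (le_trans (ler_normD _ _)); rewrite -natr1 mulrDl mul1r; apply: lerD; first exact/ih/ltnW.
  pose i := Ordinal kn; pose t := y ord0 i - x ord0 i.
  have zE : z k.+1 = z k + t *: delta_mx ord0 i.
    apply/rowP => j; rewrite !mxE eqxx/= -(inj_eq val_inj)/= ltnS leq_eqVlt.
    have [jk|jk] := eqVneq (val j) k; last by rewrite mulr0 addr0.
    rewrite jk ltnn mulr1 /t addrC; have -> : j = i by apply: val_inj.
    by rewrite subrK.
  have [c _ e] := MVT_line 0 t (is_derive_line (z k) (dphi i)).
  have {e} : phi (z k.+1) - phi (z k) = 'D_(delta_mx ord0 i) phi (z k + c *: delta_mx ord0 i) * t.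
    by move: e; rewrite scale0r addr0 subr0 zE.
  rewrite distrC => ->; rewrite normrM; apply: ler_pM => //.
    by have [_ h] := MP i; apply: (le_trans (h _)).
  by rewrite /t distrC; have := coord_le_enorm (x - y) i; rewrite !mxE.
by have := H n (leqnn n); rewrite zn mulrA.
Qed.

(** The kernel that arises when a bounded Lipschitz increment, raised to the power [a], is set
    against [kern c]. *)
Definition trunc_kern (a c : R) (z : T * T) : R := Num.min (enorm (z.1 - z.2)) 1 `^ a * kern c z.

Lemma trunc_kern_ge0 a c z : 0 <= trunc_kern a c z.
Proof. by rewrite mulr_ge0 ?powR_ge0. Qed.

Lemma measurable_trunc_kern a c : measurable_fun setT (trunc_kern a c).
Proof.
have m1 := @measurable_enorm R n; have m2 := @measurable_kern R n c.
by rewrite /trunc_kern; mfun.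
Qed.

Lemma trunc_kern_integral (Omega : set T) (b a c : R) : measurable Omega -> (leb Omega <= b%:E)%E ->
  0 < c < a ->
  (\int[leb \x leb]_z ((\1_Omega z.1 + \1_Omega z.2) * trunc_kern a c z)%:E < +oo)%E.
Proof.
move=> mO hb /andP[c0 ca].
have ac : 0 < a - c by rewrite subr_gt0.
(* Near the diagonal the order of the singularity drops to [n - (a - c)]; away from it the
   truncation is [1] and the kernel is a pure tail. *)
pose k (t : R) := knear (n := n) (a - c) t + kfar (n := n) c t.
have k0 t : 0 <= k t by rewrite addr_ge0 ?knear_ge0 ?kfar_ge0.
have mn := @measurable_knear R n (a - c); have mf := @measurable_kfar R n c.
have mk : measurable_fun setT k by rewrite /k; mfun.
pose C := geomc (n := n) (a - c) + geomc (n := n) c.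
have C0 : 0 <= C by rewrite addr_ge0// ltW// geomc_gt0.
have ki x : (\int[leb]_y (k (enorm (x - y) / 1))%:E <= C%:E)%E.
  have me := measurable_enorm2 x; rewrite /k.
  rewrite integral_finD; [|by mfun|by mfun|by move=> y; exact: knear_ge0|by move=> y; exact: kfar_ge0].
  rewrite /C EFinD; apply: leeD.
    by have := @knear_integral_le R n _ x 1 ac ltr01; rewrite expr1n mulr1.
  by have := @kfar_integral_le R n _ x 1 c0 ltr01; rewrite expr1n mulr1.
apply: (@le_lt_trans _ _ (\int[leb \x leb]_z ((\1_Omega z.1 + \1_Omega z.2) * k (enorm (z.1 - z.2) / 1))%:E)%E).
  apply: le_integral_fin => z; first by rewrite mulr_ge0 ?addr_ge0 ?trunc_kern_ge0.
  apply: ler_wpM2l; first by rewrite addr_ge0.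
  rewrite /trunc_kern /kern divr1; set t := enorm _.
  have t0 : 0 <= t by exact: enorm_ge0.
  rewrite /k /knear /kfar minEle; case: ifPn => t1; last by rewrite powR1 mul1r add0r.
  have [->|tn0] := eqVneq t 0.
    by rewrite powR0 ?mul0r ?addr0 ?powR_ge0// gt_eqF// (lt_trans c0).
  rewrite addr0 -powRD; last by rewrite tn0 implybT.
  by rewrite (_ : a + _ = a - c - n%:R)//; lra.
apply: (le_lt_trans (kernel_double_integral_le mk k0 C0 ki _ _)); [by mfun|by move=> x|].
rewrite integral_fin_indic//.
apply: (@le_lt_trans _ _ ((2 * C)%:E * b%:E)%E); last by rewrite -EFinM ltry.
by apply: lee_wpmul2l => //; rewrite lee_fin mulr_ge0.
Qed.

(** The second inequality is a product form of the fact that the increment vanishes when both points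
    lie outside [Omega]; it brings in the factor that makes the kernels integrable over the whole
    product. *)
Lemma test_function_increment (Omega : set T) (phi : T -> R) : test_function Omega phi ->
  exists2 M, 0 <= M & forall z : T * T, `|phi z.1 - phi z.2| <= M * Num.min (enorm (z.1 - z.2)) 1 /\
    `|phi z.1 - phi z.2| <= `|phi z.1 - phi z.2| * (\1_Omega z.1 + \1_Omega z.2).
Proof.
move=> tphi; have [sm sup] := tphi; have [cphi _] := sm [::].
have [A A0 hA] := test_function_lipschitz tphi; have [B B0 hB] := csupported_bounded cphi sup.
exists (A + 2 * B); first by rewrite addr_ge0// mulr_ge0.
move=> z; split.
  have h1 := hA z.1 z.2; have h2 : `|phi z.1 - phi z.2| <= 2 * B.
    by apply: (le_trans (ler_normB _ _)); have := hB z.1; have := hB z.2; lra.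
  have e0 := enorm_ge0 (z.1 - z.2).
  rewrite minEle; case: ifP => _; first by apply: (le_trans h1); rewrite ler_wpM2r// lerDl mulr_ge0.
  by rewrite mulr1; apply: (le_trans h2); rewrite lerDr.
have [ox|nO1] := pselect (Omega z.1).
  by rewrite ler_peMr// indicE mem_set// lerDl.
have [ox|nO2] := pselect (Omega z.2).
  by rewrite ler_peMr// [X in _ <= _ + X]indicE mem_set// lerDr.
by rewrite (csupported_off sup nO1) (csupported_off sup nO2) subrr normr0 mul0r.
Qed.

(** The [p]-th power of the increment leaves [trunc_kern p (s * p)], which is integrable because
    [s < 1] gives [s p < p]. *)
Lemma test_admissible (s p : R) (Omega : set T) (b : R) (phi : T -> R) : measurable Omega ->
  (leb Omega <= b%:E)%E -> 0 < s < 1 -> 1 < p -> test_function Omega phi -> admissible s p Omega phi.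
Proof.
move=> mO hb /andP[s0 s1] p1 tphi; have [sm sup] := tphi; have [cphi _] := sm [::].
have [M M0 hM] := test_function_increment tphi.
have p0 : 0 < p by exact: lt_trans p1.
split; [exact: continuous_measurable_rV|by move=> x; exact: csupported_off sup|].
have mk := measurable_trunc_kern p (s * p).
apply: (@le_lt_trans _ _ (\int[leb \x leb]_z (M `^ p * ((\1_Omega z.1 + \1_Omega z.2) * trunc_kern p (s * p) z))%:E)%E).
  apply: le_integral_fin => z; first by rewrite mulr_ge0 ?powR_ge0.
  have [h1 h2] := hM z.
  have m0 : 0 <= Num.min (enorm (z.1 - z.2)) 1 by rewrite le_min enorm_ge0 ler01.
  rewrite (_ : _ * (_ * _) = (\1_Omega z.1 + \1_Omega z.2) * ((M * Num.min (enorm (z.1 - z.2)) 1) `^ p * kern (s * p) z)); last first.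
    by rewrite /trunc_kern powRM//; ring.
  have [->|d0] := eqVneq (phi z.1 - phi z.2) 0.
    by rewrite normr0 powR0 ?gt_eqF// mul0r !mulr_ge0 ?addr_ge0 ?powR_ge0.
  have i1 : 1 <= \1_Omega z.1 + \1_Omega z.2 :> R by move: h2; rewrite -ler_pdivrMl ?normr_gt0// mulVf ?normr_eq0.
  rewrite -[leLHS]mul1r; apply: ler_pM => //; first by rewrite mulr_ge0 ?powR_ge0.
  rewrite ler_wpM2r ?powR_ge0//; apply: ge0_ler_powR; rewrite ?nnegrE ?(ltW p0)//.
  exact: mulr_ge0.
rewrite integral_finZ; [|by mfun|by move=> z; rewrite mulr_ge0 ?addr_ge0 ?trunc_kern_ge0|exact: powR_ge0].
apply: lte_mul_pinfty; [by rewrite lee_fin powR_ge0|by []|].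
apply: (trunc_kern_integral mO hb); rewrite mulr_gt0//= gtr_pMl//.
Qed.

End test_functions.

(** * Borel representatives *)

Section completion.
Context d (T : measurableType d) (R : realType) (mu : {measure set T -> \bar R}).

(** Sets that agree with a measurable set off a measurable null set form a sigma-algebra containing
    the generators of the completion. *)
Lemma completion_sub (E : set T) : <<s completed_algebra_gen mu >> E ->
  exists A N, [/\ measurable A, measurable N, mu N = 0%E & forall x, ~ N x -> (A x <-> E x)].
Proof.
move=> sE; suff : <<s completed_algebra_gen mu >> `<=` [set E | exists A N, [/\ measurable A, measurable N, mu N = 0%E & forall x, ~ N x -> (A x <-> E x)]].
  exact.
apply: smallest_sub; last first.
  move=> _ [A mA [N0 [N [mN N1 sub]] <-]]; exists A, N; split=> // x Nx.
  by split=> [|[]//]; [left|move=> /sub].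
split.
- by exists set0, set0; split=> //; rewrite measure0.
- move=> A' [A [N [mA mN N0 h]]]; exists (~` A), N; split=> //; first exact: measurableC.
  by move=> x Nx; rewrite setTD; split=> /= nA; contradict nA; apply/(h x Nx).
- move=> F /= hF.
  have /choice[A_ /choice[N_ hAN]] : forall k, exists A N, [/\ measurable A, measurable N, mu N = 0%E & forall x, ~ N x -> (A x <-> F k x)] by exact: hF.
  exists (\bigcup_k A_ k), (\bigcup_k N_ k); split.
  + by apply: bigcupT_measurable => k; have [] := hAN k.
  + by apply: bigcupT_measurable => k; have [] := hAN k.
  + apply/negligibleP; first by apply: bigcupT_measurable => k; have [] := hAN k.
    by apply: negligible_bigcup => k; have [_ mN N0 _] := hAN k; apply/negligibleP.
  + move=> x Nx; have h k : A_ k x <-> F k x.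
      by have [_ _ _] := hAN k; apply=> Nk; apply: Nx; exists k.
    by split=> -[k _ hk]; exists k => //; apply/h.
Qed.

(** Only the sublevel sets at rational heights are corrected, hence countably many null sets; every
    other sublevel set is a union of those. *)
Lemma completion_measurable (f : T -> R) :
  @measurable_fun _ _ (g_sigma_algebraType (completed_algebra_gen mu)) R setT f ->
  exists g N, [/\ measurable_fun setT g, measurable N, mu N = 0%E & forall x, ~ N x -> g x = f x].
Proof.
move=> mf; pose q_ (k : nat) : R := ratr (odflt 0 (unpickle k) : rat).
have q_dense (a b : R) : a < b -> exists k, a < q_ k < b.
  move=> /rat_in_itvoo[q]; rewrite in_itv/= => h.
  by exists (pickle q); rewrite /q_ pickleK.
have /choice[A_ /choice[N_ hAN]] : forall k : nat, exists A N,
    [/\ measurable A, measurable N, mu N = 0%E & forall x, ~ N x -> (A x <-> f x < q_ k)].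
  move=> k; apply: completion_sub.
  have := mf measurableT `]-oo, q_ k[%classic (measurable_itv _); rewrite setTI.
  by rewrite (_ : f @^-1` _ = [set x | f x < q_ k])//; apply/seteqP; split=> x /=; rewrite in_itv.
pose N := \bigcup_k N_ k.
have mN : measurable N by apply: bigcupT_measurable => k; have [] := hAN k.
have N0 : mu N = 0%E.
  apply/negligibleP => //; apply: negligible_bigcup => k.
  by have [_ mNk Nk0 _] := hAN k; apply/negligibleP.
have hA k x : ~ N x -> (A_ k x <-> f x < q_ k).
  by move=> Nx; have [_ _ _] := hAN k; apply=> Nk; apply: Nx; exists k.
exists (fun x => if x \in N then 0 else f x), N; split=> //; last first.
  by move=> x Nx; rewrite memNset.
apply: (measurability _ (RGenInftyO.measurableE R)).
move=> _ [_ [a ->] <-]; rewrite setTI.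
(* On [N] the new function is [0], so [N] belongs to the sublevel set exactly when [0 < a],
   witnessed by a rational between [0] and [a]. *)
pose P k := if q_ k < a then (A_ k `\` N) `|` (if 0 < q_ k then N else set0) else set0.
rewrite (_ : _ @^-1` _ = \bigcup_k P k).
  apply: bigcupT_measurable => k; rewrite /P; case: ifP => // _.
  apply: measurableU; last by case: ifP.
  by apply: measurableD => //; have [] := hAN k.
apply/seteqP; split=> x /=.
  rewrite in_itv/=; case: ifPn => xN h.
    have [k /andP[k1 k2]] := q_dense _ _ h; exists k => //.
    by rewrite /P k2 k1; right; rewrite inE in xN.
  have [k /andP[k1 k2]] := q_dense _ _ h; exists k => //.
  by rewrite /P k2; left; rewrite notin_setE in xN; split=> //; apply/hA.
move=> [k _]; rewrite /P in_itv/=; case: ifP => // k2 [[h nN]|].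
  by rewrite memNset//; apply: lt_trans k2; apply/hA.
by case: ifP => // k1 xN; rewrite mem_set//; exact: lt_trans k2.
Qed.

End completion.

Section borel_kernel.
Context {R : realType} {n : nat}.
Local Notation leb := (@lebesgue_rV R n).
Local Notation T := 'rV[R]_n.

Lemma borel_Rn_measurable (D : set T) (f : T -> R) : measurable D -> measurable_fun setT f -> Rn_measurable D f.
Proof.
move=> mD mf _ Y mY; apply: sub_sigma_algebra.
exists (D `&` f @^-1` Y); last by exists set0; [exact: negligible_set0|rewrite setU0].
by apply: measurableI => //; rewrite -[X in measurable X]setTI; exact: mf.
Qed.

(** On the null set and on the diagonal the representative is replaced by the model kernel, so that
    the two-sided bound holds everywhere. On the diagonal the form does not see the change, since
    the increment of [phi] is [0]. *)
Lemma borel_kernel (L a : R) (K : T -> T -> R) : 1 <= L -> 0 < n%:R + a -> Rn2_measurable K ->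
  (forall x y, x != y -> L^-1 * enorm (x - y) `^ (- (n%:R + a)) <= K x y <= L * enorm (x - y) `^ (- (n%:R + a))) ->
  exists K' : T * T -> R, [/\ measurable_fun setT K',
    forall z, L^-1 * kern a z <= K' z <= L * kern a z &
    forall Phi u phi, nonlocal_form Phi K u phi =
      (\int[leb \x leb]_z (Phi (u z.1 - u z.2) * (phi z.1 - phi z.2) * K' z)%:E)%E].
Proof.
move=> L1 na mK hK; have [g [N [mg mN N0 gK]]] := completion_measurable mK.
have mk := @measurable_kern R n a; have me := @measurable_enorm R n.
pose D := [set z : T * T | enorm (z.1 - z.2) = 0].
have mD : measurable D.
  rewrite -[D]setTI (_ : D = (fun z : T * T => enorm (z.1 - z.2)) @^-1` [set 0])//.
  by apply: me => //; exact: measurable_set1.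
have mND : measurable (N `|` D) by exact: measurableU.
pose K' z := if z \in N `|` D then kern a z else g z.
have L0 : 0 < L by exact: lt_le_trans L1.
exists K'; split.
- apply: measurable_fun_ifT => //.
  rewrite (_ : (fun z => z \in _) = (fun z => (\1_(N `|` D) z : R) == 1)); last first.
    by apply/funext => z; rewrite indicE; case: (_ \in _); rewrite ?eqxx// eq_sym oner_eq0.
  by apply: measurable_fun_eqr; mfun.
- move=> z; rewrite /K'; case: ifPn => zN.
    have k0 := kern_ge0 a z; rewrite ler_peMl// andbT ler_piMl// invf_le1//.
  rewrite notin_setE in zN; rewrite gK; last by move=> h; apply: zN; left.
  apply: hK; apply/eqP => e; apply: zN; right; rewrite /D/= e subrr.
  by rewrite /enorm big1 ?sqrtr0// => i _; rewrite mxE expr0n.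
- move=> Phi u phi; apply: (integral_eq_off_null mN N0) => z zN; congr EFin.
  rewrite /K'; case: ifPn => zD; last by rewrite gK.
  have [//|zd] : (N `|` D) z by rewrite inE in zD.
  by rewrite (enorm_eq0 zd) !subrr mulr0 !mul0r.
Qed.

End borel_kernel.

(** * Bounded reparametrization and almost everywhere compactness *)

Section softclip.
Context {R : realType}.
Implicit Types a b t : R.

Definition softclip t : R := t / (1 + `|t|).

Lemma softclip_den t : 0 < 1 + `|t|. Proof. by rewrite ltr_pwDl. Qed.

Lemma softclip_increment a b : a <= b -> 0 <= softclip b - softclip a <= b - a.
Proof.
move=> ab; rewrite /softclip.
have ba : 0 <= b - a by rewrite subr_ge0.
have [a0|a0] := leP 0 a.
  have b0 : 0 <= b by exact: le_trans ab.
  rewrite !ger0_norm// (_ : _ - _ = (b - a) / ((1 + a) * (1 + b))); last by field; rewrite !gt_eqF//; lra.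
  have D : 1 <= (1 + a) * (1 + b) by nra.
  by apply/andP; split; [apply: divr_ge0 => //; exact: le_trans D|rewrite ler_pdivrMr ?ler_peMr//; exact: lt_le_trans D].
have [b0|b0] := leP b 0.
  rewrite !ler0_norm ?(ltW a0)// (_ : _ - _ = (b - a) / ((1 - a) * (1 - b))); last by field; rewrite !gt_eqF//; lra.
  have D : 1 <= (1 - a) * (1 - b) by nra.
  by apply/andP; split; [apply: divr_ge0 => //; exact: le_trans D|rewrite ler_pdivrMr ?ler_peMr//; exact: lt_le_trans D].
rewrite (gtr0_norm b0) (ltr0_norm a0) -[X in X - _]mulr1.
have h1 : 0 <= b / (1 + b) <= b.
  by apply/andP; split; [apply: divr_ge0; rewrite ?addr_ge0 ?ltW|rewrite ler_pdivrMr ?addr_gt0// ler_peMr ?lerDl ?ltW].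
have h2 : 0 <= - a / (1 - a) <= - a.
  have a0' : 0 < - a by rewrite oppr_gt0.
  by apply/andP; split; [apply: divr_ge0; rewrite ?addr_ge0 ?ltW|rewrite ler_pdivrMr ?addr_gt0// ler_peMr ?lerDl ?ltW].
move: h1 h2; rewrite mulNr mulr1; move: (b / _) (a / _) => x y; lra.
Qed.

Lemma softclip_contraction : nd_contraction softclip.
Proof.
split=> [a b ab||a b]; first by rewrite -subr_ge0; have /andP[] := softclip_increment ab.
  by rewrite /softclip mul0r.
have [ab|/ltW ab] := leP a b; have /andP[h1 h2] := softclip_increment ab.
  by rewrite distrC ger0_norm// distrC ger0_norm// subr_ge0.
by rewrite ger0_norm// ger0_norm// subr_ge0.
Qed.

Lemma softclip_norm t : `|softclip t| = 1 - (1 + `|t|)^-1.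
Proof.
rewrite /softclip normrM normfV (gtr0_norm (softclip_den t)).
by field; rewrite gt_eqF ?softclip_den.
Qed.

Lemma softclip_le1 t : `|softclip t| <= 1.
Proof. by rewrite softclip_norm gerBl invr_ge0 ltW ?softclip_den. Qed.

Lemma softclipK t : softclip t / (1 - `|softclip t|) = t.
Proof.
by rewrite softclip_norm opprB addrCA subrr addr0 invrK /softclip mulfVK.
Qed.

Lemma softclip_gap t : 1 - `|softclip t| = (1 + `|t|)^-1.
Proof. by rewrite softclip_norm opprB addrCA subrr addr0. Qed.

End softclip.

Section compactness_of_normalized.
Context {R : realType} {n : nat}.
Local Notation leb := (@lebesgue_rV R n).
Local Notation T := 'rV[R]_n.
Variables (s p A d : R) (Omega : set T) (B : nat).
Hypotheses (n0 : (0 < n)%N) (s0 : 0 < s) (p1 : 1 < p) (spn : s * p < n%:R) (A0 : 0 < A).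
Hypotheses (mO : measurable Omega) (hO : forall x, Omega x -> forall i, `|x ord0 i| < B%:R).

Lemma enorm_scale (r : R) (e : R) (z : T * T) : 0 < r ->
  enorm (z.1 - z.2) `^ (- e) = r `^ (- e) * (enorm (z.1 - z.2) / r) `^ (- e).
Proof.
move=> r0; rewrite powRM ?enorm_ge0 ?invr_ge0 ?(ltW r0)//.
rewrite mulrCA -powRM ?invr_ge0 ?(ltW r0)// mulfV ?gt_eqF//.
by rewrite powR1 mulr1.
Qed.

(** A contraction satisfies [|psi a - psi b|^p <= |a - b|^(p - 1) |psi a - psi b|], and the right
    side is the integrand already controlled by [normalized]. *)
Lemma softclip_energy (U : T -> R) : normalized s p A d Omega U ->
  (energy s p (softclip \o U) <= (d `^ (- (n%:R + s * p)) * (A * 1 * (d ^+ n) ^+ 2))%:E)%E.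
Proof.
move=> [_ d0 _ mU _ HE]; have := HE _ _ softclip_contraction softclip_le1.
have [_ _ lip] := @softclip_contraction R.
have ms := nd_contraction_measurable (@softclip_contraction R).
have me := @measurable_enorm R n.
move=> h; rewrite EFinM; apply: le_trans (lee_wpmul2l _ h); last by rewrite lee_fin powR_ge0.
have m1 : measurable_fun setT (fun z : T * T => `|U z.1 - U z.2| `^ (p - 1) * `|softclip (U z.1) - softclip (U z.2)|
       * (enorm (z.1 - z.2) / d) `^ (- (n%:R + s * p))) by mfun.
rewrite -integral_finZ; [|exact: m1|by move=> z; rewrite !mulr_ge0 ?powR_ge0|exact: powR_ge0].
apply: le_integral_fin => z; first by rewrite mulr_ge0 ?powR_ge0.
rewrite /kern (enorm_scale _ _ d0) mulrCA ler_wpM2l ?powR_ge0//.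
rewrite ler_wpM2r ?powR_ge0//=.
have p0 : 0 < p by exact: lt_trans p1.
rewrite -[leLHS](mulr_powRB1 (normr_ge0 _) p0) mulrC ler_wpM2r//.
by apply: ge0_ler_powR; rewrite ?nnegrE ?subr_ge0 ?(ltW p1)//; exact: lip.
Qed.

(** Rellich's theorem yields only a limit [w] of the images under [softclip]. A value [|w| = 1]
    would mean that [U_] escapes to infinity; the uniform moment estimate confines this to a null
    set. *)
Lemma normalized_compact (U_ : nat -> T -> R) : (forall j, normalized s p A d Omega (U_ j)) ->
  exists (sg : nat -> nat) (u : T -> R), [/\ forall m, (sg m < sg m.+1)%N,
    measurable_fun setT u, forall x, ~ Omega x -> u x = 0 &
    {ae leb, forall x, U_ (sg j) x @[j --> \oo] --> u x}].
Proof.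
move=> HU.
have ms := nd_contraction_measurable (@softclip_contraction R).
have mW j : measurable_fun setT (softclip \o U_ j).
  by apply: measurableT_comp => //; have [] := HU j.
have W0 j x : ~ Omega x -> (softclip \o U_ j) x = 0.
  by move=> Ox; have [_ _ _ _ /= h _] := HU j; rewrite /= h// /softclip mul0r.
have [sg [w [sg1 mw w0 wc]]] := rellich s0 p1 n0 mO hO mW W0 (fun j => softclip_energy (HU j)).
(* The inverse of [softclip], written with a power; where [|w| = 1] it takes the default value
   [0]. *)
exists sg, (fun x => w x * (1 - `|w x|) `^ (- 1)); split=> //.
- by mfun.
- by move=> x /w0 ->; rewrite mul0r.
have d0 : 0 < d by have [] := HU 0%N.
pose g := gstar (n := n) s p / 2.
have gs0 : 0 < gstar (n := n) s p.
  by rewrite /gstar divr_gt0 ?subr_gt0// mulr_gt0 ?subr_gt0// ltr0n.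
have g0 : 0 < g by rewrite divr_gt0.
have [|C C0 HC] := @moment_estimate R n s p A n0 s0 p1 spn A0 g.
  by rewrite g0/= /g ltr_pdivrMr// ltr_pMr// ltr1n.
pose N := [set x | `|w x| >= 1].
have mN : measurable N.
  rewrite -[N]setTI (_ : N = (fun x => `|w x|) @^-1` `[1, +oo[%classic); last first.
    by apply/seteqP; split=> x /=; rewrite in_itv/= andbT.
  suff mn : measurable_fun setT (fun x => `|w x|) by apply: mn => //; exact: measurable_itv.
  by mfun.
have wle1 : {ae leb, forall x, `|w x| <= 1}.
  apply: filterS wc => x wx.
  have wx' : `|softclip (U_ (sg j) x)| @[j --> \oo] --> `|w x| by exact: cvg_norm.
  rewrite -(cvg_lim _ wx')//; apply: limr_le; first by apply/cvg_ex; exists `|w x|.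
  by apply: nearW => j; exact: softclip_le1.
(* [f_] is a regularized [(1 + |U_|)^g]. Fatou's lemma bounds the integral of its limit, which
   equals [e^(-g)] on [N] up to a null set, so [N] has measure at most [C d^n e^g] for every
   [e > 0]. *)
have bd (e : R) : 0 < e -> (leb N <= (C * d ^+ n * e `^ g)%:E)%E.
  move=> e0; pose f_ j x := (1 - `|softclip (U_ (sg j) x)| + e) `^ (- g) * \1_Omega x.
  have cf : {ae leb, forall x, f_ j x @[j --> \oo] --> (1 - `|w x| + e) `^ (- g) * \1_Omega x}.
    apply: filterS (filterI wc wle1) => x [wx w1]; apply: cvgMr_tmp.
    have l0 : 0 < 1 - `|w x| + e by rewrite ltr_wpDl// subr_ge0.
    have c1 : (1 - `|softclip (U_ (sg j) x)| + e) @[j --> \oo] --> 1 - `|w x| + e.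
      by apply: cvgD; [apply: cvgB; [exact: cvg_cst|exact: cvg_norm]|exact: cvg_cst].
    have nn j : 0 <= 1 - `|softclip (U_ (sg j) x)| + e by rewrite addr_ge0 ?(ltW e0)// subr_ge0 softclip_le1.
    have c2 := cvg_powR g0 nn c1.
    under eq_fun do rewrite powRN.
    rewrite powRN; apply: cvgV; first by rewrite gt_eqF// powR_gt0.
    exact: c2.
  have := fatou_le (f_ := f_) (c_ := fun=> C * d ^+ n) _ _ cf _ (cvg_cst _).
  move=> H; have {}H : (\int[leb]_x ((1 - `|w x| + e) `^ (- g) * \1_Omega x)%:E <= (C * d ^+ n)%:E)%E.
    apply: H => [j|j x|j].
    - have mUj : measurable_fun setT (U_ (sg j)) by have [] := HU (sg j).
      by rewrite /f_; mfun.
    - by rewrite mulr_ge0 ?powR_ge0.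
    - apply: le_trans (HC _ _ _ (HU (sg j))); apply: le_integral_fin => x; first by rewrite mulr_ge0 ?powR_ge0.
      rewrite ler_wpM2r//; rewrite softclip_gap powRN.
      have X0 := softclip_den (U_ (sg j) x); move: X0; move: (1 + _) => X X0.
      have V0 : 0 < X^-1 by rewrite invr_gt0.
      have Ve : 0 < X^-1 + e by exact: addr_gt0.
      have -> : X `^ g = (X^-1 `^ g)^-1 by rewrite -[X^-1]powR_inv1 ?(ltW X0)// -powRrM mulN1r powRN invrK.
      rewrite lef_pV2 ?posrE ?powR_gt0//.
      by apply: ge0_ler_powR; rewrite ?nnegrE ?(ltW g0) ?(ltW V0) ?(ltW Ve)// lerDl ltW.
  apply: (@le_trans _ _ (\int[leb]_x (\1_N x : R)%:E)%E); first by have := integral_fin_indic leb mN => ->; exact: lexx.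
  have E0 : 0 <= e `^ g by exact: powR_ge0.
  rewrite mulrC EFinM; apply: le_trans (lee_wpmul2l _ H); last by rewrite lee_fin.
  rewrite -integral_finZ; [|by mfun|by move=> x; rewrite mulr_ge0 ?powR_ge0|by []].
  have -> : (\int[leb]_x (\1_N x : R)%:E = \int[leb]_x (if `|w x| <= 1 then \1_N x : R else 0)%:E)%E.
    by apply: integral_eq_ae; apply: filterS wle1 => x ->.
  apply: le_integral_fin => x; first by case: ifP.
  case: ifPn => w1; last by rewrite !mulr_ge0 ?powR_ge0.
  have [Nx|nNx] := pselect (N x); last by rewrite indicE memNset// !mulr_ge0 ?powR_ge0.
  have Ex : `|w x| = 1 by apply/eqP; rewrite eq_le w1.
  have Ox : Omega x by apply: contrapT => /w0 h; move: Ex; rewrite h normr0 => /eqP; rewrite eq_sym oner_eq0.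
  by rewrite !indicE !mem_set// Ex subrr add0r mulr1 powRN mulfV ?gt_eqF ?powR_gt0.
have N0 : leb N = 0%E.
  apply/eqP; rewrite eq_le measure_ge0 andbT; apply/lee_addgt0Pr => e e0; rewrite add0e.
  have X0 : 0 < C * d ^+ n by rewrite mulr_gt0// exprn_gt0.
  have e1 : 0 < e / (C * d ^+ n) by rewrite divr_gt0.
  apply: (le_trans (bd ((e / (C * d ^+ n)) `^ g^-1) _)); first exact: powR_gt0.
  by rewrite lee_fin -powRrM mulVf ?gt_eqF// powRr1 ?(ltW e1)// mulrCA mulfV ?mulr1// gt_eqF.
have wl : {ae leb, forall x, `|w x| < 1}.
  by exists N; split=> // x /= /negP; rewrite -leNgt.
apply: filterS (filterI wc wl) => x [wx w1].
have e j : U_ (sg j) x = softclip (U_ (sg j) x) / (1 - `|softclip (U_ (sg j) x)|) by rewrite softclipK.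
under eq_fun do rewrite e.
rewrite powR_inv1 ?subr_ge0 ?(ltW w1)//.
apply: cvgM => //; apply: cvgV; first by rewrite gt_eqF// subr_gt0.
by apply: cvgB; [exact: cvg_cst|exact: cvg_norm].
Qed.

End compactness_of_normalized.

(** * Estimates in the original scale *)

Section scaled_estimates.
Context {R : realType} {n : nat}.
Local Notation leb := (@lebesgue_rV R n).
Local Notation T := 'rV[R]_n.
Variables (s p A : R).
Hypotheses (n0 : (0 < n)%N) (s0 : 0 < s) (p1 : 1 < p) (spn : s * p < n%:R) (A0 : 0 < A).

Lemma gagliardoE (h q : R) (D : set (T * T)) (f : T -> R) :
  gagliardo h q D f = (\int[leb \x leb]_(z in D) (`|f z.1 - f z.2| `^ q * kern (h * q) z)%:E)%E.
Proof. by apply: eq_integral => z _; rewrite /kern powRN. Qed.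

Lemma measurable_gagliardo (h q : R) (f : T -> R) : measurable_fun setT f ->
  measurable_fun setT (fun z : T * T => `|f z.1 - f z.2| `^ q * kern (h * q) z).
Proof. by move=> mf; have mk := @measurable_kern R n (h * q); mfun. Qed.

Lemma scaled_moment (g : R) : 0 < g < gstar (n := n) s p -> exists2 C : R, 0 < C &
  forall d k Omega (v : T -> R), 0 < k -> measurable_fun setT v ->
  normalized s p A d Omega (fun x => k^-1 * v x) ->
  (\int[leb]_x (`|v x| `^ g)%:E <= (C * k `^ g * d ^+ n)%:E)%E.
Proof.
move=> hg; have /andP[g0 _] := hg; have [C C0 H] := @moment_estimate R n s p A n0 s0 p1 spn A0 g hg.
exists C => // d k Omega v k0 mv nv; have h := H _ _ _ nv; have [mO _ _ _ v0 _] := nv.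
rewrite (mulrC C) -mulrA EFinM; apply: le_trans (lee_wpmul2l _ h); last by rewrite lee_fin powR_ge0.
rewrite -integral_finZ; [|by mfun|by move=> x; rewrite mulr_ge0 ?powR_ge0|exact: powR_ge0].
apply: le_integral_fin => x; first exact: powR_ge0.
have [Ox|nOx] := pselect (Omega x); last first.
  have /eqP := v0 x nOx; rewrite mulf_eq0 invr_eq0 gt_eqF//= => /eqP ->.
  by rewrite normr0 powR0 ?gt_eqF// !mulr_ge0 ?powR_ge0.
rewrite indicE mem_set// mulr1 -powRM ?(ltW k0) ?addr_ge0//.
apply: ge0_ler_powR; rewrite ?nnegrE ?(ltW g0)// ?mulr_ge0 ?addr_ge0 ?(ltW k0)//.
rewrite normrM normfV (gtr0_norm k0) mulrDr mulr1 mulVKf ?gt_eqF//.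
by rewrite lerDr ltW.
Qed.

(** Undoing the normalization, [v = k U] contributes [k^q], and the unit of length turns [(d^n)^2]
    into [d^(n - h q)]. *)
Lemma scaled_gagliardo (h q : R) : 0 < h < s -> 0 < q < qbar n s p -> exists2 C : R, 0 < C &
  forall d k Omega (v : T -> R), 0 < k -> measurable_fun setT v ->
  normalized s p A d Omega (fun x => k^-1 * v x) ->
  (gagliardo h q setT v <= (C * k `^ q * d `^ (n%:R - h * q))%:E)%E.
Proof.
move=> hh hq; have /andP[q0 _] := hq.
have [C C0 H] := @gagliardo_estimate R n s p A n0 s0 p1 spn A0 h q hh hq.
exists C => // d k Omega v k0 mv nv; have H1 := H _ _ _ nv; have [_ d0 _ _ _ _] := nv.
rewrite gagliardoE.
have -> : C * k `^ q * d `^ (n%:R - h * q) = k `^ q * d `^ (- (n%:R + h * q)) * (C * (d ^+ n) ^+ 2).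
  have -> : d `^ (n%:R - h * q) = d `^ (- (n%:R + h * q)) * (d ^+ n) ^+ 2; last by ring.
  rewrite -[d ^+ n]powR_mulrn ?(ltW d0)// -[in RHS]powR_mulrn ?powR_ge0// -powRrM !powR_expR// -expRD.
  by congr expR; ring.
have c0 : 0 <= k `^ q * d `^ (- (n%:R + h * q)) by rewrite mulr_ge0 ?powR_ge0.
rewrite EFinM; apply: le_trans (lee_wpmul2l _ H1); last by rewrite lee_fin.
have me := @measurable_enorm R n.
have m1 : measurable_fun setT (fun z : T * T => `|k^-1 * v z.1 - k^-1 * v z.2| `^ q * (enorm (z.1 - z.2) / d) `^ (- (n%:R + h * q))) by mfun.
rewrite -integral_finZ; [|exact: m1|by move=> z; rewrite mulr_ge0 ?powR_ge0|by []].
apply: le_integral_fin => z; first by rewrite mulr_ge0 ?powR_ge0.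
rewrite /kern (enorm_scale _ _ d0) -mulrBr normrM normfV (gtr0_norm k0).
have -> : `|v z.1 - v z.2| `^ q = k `^ q * (k^-1 * `|v z.1 - v z.2|) `^ q.
  by rewrite -powRM ?mulr_ge0 ?invr_ge0 ?(ltW k0)// mulVKf// gt_eqF.
by rewrite le_eqVlt; apply/orP; left; apply/eqP; ring.
Qed.

End scaled_estimates.

(** * Passage to the limit *)

Section limit_passage.
Context {R : realType} {n : nat}.
Local Notation leb := (@lebesgue_rV R n).
Local Notation T := 'rV[R]_n.
Variables (Omega : set T) (b : R) (v_ : nat -> T -> R) (u : T -> R).
Hypotheses (mO : measurable Omega) (hb : (leb Omega <= b%:E)%E).
Hypotheses (mv : forall j, measurable_fun setT (v_ j)) (mu : measurable_fun setT u).
Hypotheses (v0 : forall j x, ~ Omega x -> v_ j x = 0) (u0 : forall x, ~ Omega x -> u x = 0).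
Hypothesis vu : {ae leb, forall x, v_ j x @[j --> \oo] --> u x}.

Lemma limit_moment (g C : R) : 0 < g -> (forall j, \int[leb]_x (`|v_ j x| `^ g)%:E <= C%:E)%E ->
  (\int[leb]_x (`|u x| `^ g)%:E <= C%:E)%E.
Proof.
move=> g0 H; apply: (fatou_le (f_ := fun j x => `|v_ j x| `^ g) (c_ := fun=> C)).
- by move=> j; have mvj := mv j; mfun.
- by move=> j x; exact: powR_ge0.
- apply: filterS vu => x vx; apply: cvg_powR => //; exact: cvg_norm.
- exact: H.
- exact: cvg_cst.
Qed.

Lemma limit_gagliardo (h q C : R) : 0 < q -> (forall j, gagliardo h q setT (v_ j) <= C%:E)%E ->
  (gagliardo h q setT u <= C%:E)%E.
Proof.
move=> q0 H; rewrite gagliardoE.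
apply: (fatou_le (f_ := fun j z => `|v_ j z.1 - v_ j z.2| `^ q * kern (h * q) z) (c_ := fun=> C)).
- by move=> j; exact: measurable_gagliardo.
- by move=> j x; rewrite mulr_ge0 ?powR_ge0.
- apply: filterS (ae_prod vu) => z [h1 h2]; apply: cvgMr_tmp; apply: cvg_powR => //.
  by apply: cvg_norm; exact: cvgB.
- by move=> j; rewrite -gagliardoE.
- exact: cvg_cst.
Qed.

(** On [Omega], of finite measure, [|v_ j - u|^q] is at most [N + e |v_ j - u|^g]; the moments of
    the larger order [g] are uniformly bounded, and those of [u] by Fatou's lemma. *)
Lemma limit_Lq (q g C : R) : 0 < q < g -> (forall j, \int[leb]_x (`|v_ j x| `^ g)%:E <= C%:E)%E ->
  (\int[leb]_x (`|v_ j x - u x| `^ q)%:E @[j --> \oo] --> 0)%E.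
Proof.
move=> /andP[q0 qg] H; have g0 : 0 < g by exact: lt_trans qg.
have Hu := limit_moment g0 H.
apply: (equiintegrable_cvg0 (b_ := fun j x => `|v_ j x - u x| `^ g) (w := \1_Omega) (C := 2 `^ g * (C + C))).
- by move=> j; have mvj := mv j; mfun.
- by move=> j; have mvj := mv j; mfun.
- by mfun.
- by move=> j x; exact: powR_ge0.
- by move=> j x; exact: powR_ge0.
- by move=> x; exact: indic_nneg.
- apply: filterS vu => x vx; rewrite -[X in _ --> X](powR0 (lt0r_neq0 q0)); apply: cvg_powR => //.
  rewrite -(normr0 R) -(subrr (u x)); apply: cvg_norm; apply: cvgB => //; exact: cvg_cst.
- move=> e e0; have [|N N0 HN] := @powR_le_addZ R q g e _ e0; first by rewrite q0.
  exists N => // j x; have [Ox|nOx] := pselect (Omega x).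
    by rewrite indicE mem_set// mulr1; exact: HN.
  by rewrite v0// u0// subrr normr0 !powR0 ?gt_eqF// mulr0 addr0 mulr_ge0 ?indic_nneg.
- by rewrite integral_fin_indic//; exact: le_lt_trans hb (ltry _).
- move=> j; have mvj := mv j.
  apply: (@le_trans _ _ (\int[leb]_x (2 `^ g * (`|v_ j x| `^ g + `|u x| `^ g))%:E)%E).
    apply: le_integral_fin => x; first exact: powR_ge0.
    apply: le_trans (powR_add_le (ltW g0) (normr_ge0 _) (normr_ge0 _)).
    by apply: ge0_ler_powR; rewrite ?nnegrE ?addr_ge0 ?(ltW g0)//; exact: ler_normB.
  rewrite integral_finZ; [|by mfun|by move=> x; rewrite addr_ge0 ?powR_ge0|exact: powR_ge0].
  rewrite EFinM; apply: lee_wpmul2l; first by rewrite lee_fin powR_ge0.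
  rewrite integral_finD; [|by mfun|by mfun|by move=> x; exact: powR_ge0|by move=> x; exact: powR_ge0].
  rewrite EFinD; exact: leeD (H j) Hu.
Qed.

Variables (s p L : R) (Phi : R -> R) (K : T * T -> R) (phi : T -> R).
Hypotheses (s01 : 0 < s < 1) (p1 : 1 < p) (L1 : 1 <= L).
Hypotheses (cPhi : continuous Phi) (hPhi : forall t, L^-1 * `|t| `^ p <= Phi t * t <= L * `|t| `^ p).
Hypotheses (mK : measurable_fun setT K) (hK : forall z, L^-1 * kern (s * p) z <= K z <= L * kern (s * p) z).
Hypothesis tphi : test_function Omega phi.

(* Young's inequality for [|dv| / |x - y|^h]: the Lipschitz bound on [phi] makes
   the kernel [trunc_kern 1 c] integrable exactly when [0 < c < 1]. *)
Lemma form_young (h q : R) : p - 1 < q -> 0 < s * p - h * (p - 1) < 1 ->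
  exists2 M, 0 <= M & forall e, 0 < e -> exists2 N, 0 <= N & forall (v : T -> R) z,
    `|Phi (v z.1 - v z.2) * (phi z.1 - phi z.2) * K z| <=
    N * ((\1_Omega z.1 + \1_Omega z.2) * trunc_kern 1 (s * p - h * (p - 1)) z) +
    e * (M * (`|v z.1 - v z.2| `^ q * kern (h * q) z)).
Proof.
move=> pq /andP[c0 c1]; have [M M0 hM] := test_function_increment tphi.
have L0 : 0 < L by exact: lt_le_trans L1.
have pm : 0 < p - 1 by rewrite subr_gt0.
exists (L * L * M); first by rewrite !mulr_ge0// ltW.
move=> e e0; have [|N N0 HN] := @powR_le_addZ R (p - 1) q e _ e0; first by rewrite pm.
exists (L * L * M * N); first by rewrite !mulr_ge0// ltW.
move=> v z; set c := s * p - h * (p - 1) in c0 c1 *.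
have K0 : 0 <= K z by apply: le_trans (andP (hK z)).1; rewrite mulr_ge0 ?powR_ge0 ?invr_ge0 ?ltW.
have [h1 h2] := hM z.
set t := `|v z.1 - v z.2|; set r := enorm (z.1 - z.2).
have r0 : 0 <= r by exact: enorm_ge0.
have m0 : 0 <= Num.min r 1 by rewrite le_min r0 ler01.
have rhs0 : 0 <= L * L * M * N * ((\1_Omega z.1 + \1_Omega z.2) * trunc_kern 1 c z) +
    e * (L * L * M * (t `^ q * kern (h * q) z)).
  have LM : 0 <= L * L * M by rewrite !mulr_ge0// ltW.
  have W00 : 0 <= (\1_Omega z.1 + \1_Omega z.2) * trunc_kern 1 c z by rewrite mulr_ge0 ?addr_ge0 ?trunc_kern_ge0.
  have G00 : 0 <= t `^ q * kern (h * q) z by rewrite mulr_ge0 ?powR_ge0.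
  exact: addr_ge0 (mulr_ge0 (mulr_ge0 LM N0) W00) (mulr_ge0 (ltW e0) (mulr_ge0 LM G00)).
have [p0|dp0] := eqVneq (phi z.1 - phi z.2) 0; first by rewrite p0 mulr0 mul0r normr0.
have rp : 0 < r.
  rewrite lt_neqAle r0 andbT eq_sym; apply: contra dp0 => /eqP /enorm_eq0 ->; by rewrite subrr.
have i1 : 1 <= \1_Omega z.1 + \1_Omega z.2 :> R.
  by move: h2; rewrite -ler_pdivrMl ?normr_gt0// mulVf ?normr_eq0.
(* [rho] is the Hölder quotient of order [h]; the powers [p - 1] and [q] are compared for it rather
   than for the increment itself. *)
have [rho [rho0 tE]] : exists rho, 0 <= rho /\ t = rho * r `^ h.
  exists (t / r `^ h); split; last by rewrite mulfVK// gt_eqF// powR_gt0.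
  by apply: divr_ge0; [exact: normr_ge0|exact: powR_ge0].
have step1 : `|Phi (v z.1 - v z.2) * (phi z.1 - phi z.2) * K z| <=
    L * L * M * (rho `^ (p - 1) * (Num.min r 1 * kern c z)).
  rewrite !normrM (ger0_norm K0).
  have g := growth_le cPhi p1 L1 hPhi (v z.1 - v z.2); have /andP[_ k2] := hK z.
  apply: (@le_trans _ _ (L * t `^ (p - 1) * (M * Num.min r 1) * (L * kern (s * p) z))).
    by apply: ler_pM => //; apply: ler_pM.
  rewrite le_eqVlt; apply/orP; left; apply/eqP.
  rewrite tE powRM ?powR_ge0// -powRrM.
  have -> : kern c z = r `^ (h * (p - 1)) * kern (s * p) z.
    rewrite /kern -/r -powRD; last by rewrite (gt_eqF rp) implybT.
    by congr (_ `^ _); rewrite /c; ring.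
  by ring.
apply: (le_trans step1).
have X0 : 0 <= Num.min r 1 * kern c z by rewrite mulr_ge0 ?powR_ge0.
have LM0 : 0 <= L * L * M by rewrite !mulr_ge0// ltW.
have step2 : rho `^ (p - 1) * (Num.min r 1 * kern c z) <=
    N * (Num.min r 1 * kern c z) + e * (rho `^ q * (Num.min r 1 * kern c z)).
  by rewrite [e * _]mulrA -mulrDl ler_wpM2r// HN.
apply: (le_trans (ler_wpM2l LM0 step2)); rewrite mulrDr; apply: lerD.
  rewrite mulrA; apply: ler_wpM2l; first by rewrite mulr_ge0.
  by rewrite /trunc_kern -/r powRr1// ler_peMl.
rewrite mulrCA; apply: ler_wpM2l; first exact: ltW.
apply: ler_wpM2l => //.
rewrite tE powRM ?powR_ge0// -powRrM -mulrA; apply: ler_wpM2l; first exact: powR_ge0.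
have -> : r `^ (h * q) * kern (h * q) z = r `^ (- n%:R).
  rewrite /kern -/r -powRD; last by rewrite (gt_eqF rp) implybT.
  by congr (_ `^ _); ring.
have -> : kern c z = r `^ (- n%:R) * r `^ (- c).
  rewrite /kern -/r -powRD; last by rewrite (gt_eqF rp) implybT.
  by congr (_ `^ _); ring.
have one (a : R) : 1 `^ a = 1 by rewrite powR1.
(* It remains that [min r 1 * r^-c <= 1]: for [r <= 1] because [c < 1], for [r > 1] because
   [0 < c]. *)
rewrite mulrCA ler_piMr ?powR_ge0// minEle; case: ifPn => r1.
  rewrite -[X in X * _](powRr1 r0) -powRD; last by rewrite (gt_eqF rp) implybT.
  rewrite -[leRHS](one (1 - c)); apply: ge0_ler_powR; rewrite ?nnegrE ?subr_ge0 ?(ltW c1)//.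
rewrite mul1r powRN invf_le1 ?powR_gt0// -[leLHS](one c); apply: ge0_ler_powR; rewrite ?nnegrE ?(ltW c0)//.
by rewrite -ltNge in r1; exact: ltW.
Qed.

Lemma measurable_form (v : T -> R) : measurable_fun setT v ->
  measurable_fun setT (fun z : T * T => Phi (v z.1 - v z.2) * (phi z.1 - phi z.2) * K z).
Proof.
move=> mv'; have [/(_ [::])[cphi _] _] := tphi.
have mphi : measurable_fun setT phi by exact: continuous_measurable_rV.
have mPhi : measurable_fun setT Phi by exact: continuous_measurable_fun.
by mfun.
Qed.

(** [form_young], applied to [v_ j] and to [u], gives the differences of the integrands the uniform
    integrability required by [equiintegrable_cvg0]. The same bound makes each form integrable, so
    that the integrals may be subtracted. *)
Lemma form_cvg (h q C : R) : p - 1 < q -> 0 < s * p - h * (p - 1) < 1 ->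
  (forall j, gagliardo h q setT (v_ j) <= C%:E)%E ->
  (\int[leb \x leb]_z (Phi (v_ j z.1 - v_ j z.2) * (phi z.1 - phi z.2) * K z)%:E @[j --> \oo]
    --> \int[leb \x leb]_z (Phi (u z.1 - u z.2) * (phi z.1 - phi z.2) * K z)%:E)%E.
Proof.
move=> pq hc H; have /andP[c0 c1] := hc.
have pm : 0 < p - 1 by rewrite subr_gt0.
have q0 : 0 < q by exact: lt_trans pq.
have Hu := limit_gagliardo q0 H.
have [M M0 HM] := form_young pq hc.
pose D (v : T -> R) (z : T * T) := Phi (v z.1 - v z.2) * (phi z.1 - phi z.2) * K z.
pose W (z : T * T) : R := (\1_Omega z.1 + \1_Omega z.2) * trunc_kern 1 (s * p - h * (p - 1)) z.
pose G (v : T -> R) (z : T * T) := M * (`|v z.1 - v z.2| `^ q * kern (h * q) z).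
have W0 z : 0 <= W z by rewrite mulr_ge0 ?addr_ge0 ?trunc_kern_ge0.
have mW : measurable_fun setT W.
  have mt := @measurable_trunc_kern R n 1 (s * p - h * (p - 1)).
  by rewrite /W; mfun.
have iW : (\int[leb \x leb]_z (W z)%:E < +oo)%E by apply: (trunc_kern_integral mO hb); rewrite c0.
have G0 v z : 0 <= G v z by rewrite !mulr_ge0 ?powR_ge0.
have mG (v : T -> R) : measurable_fun setT v -> measurable_fun setT (G v).
  by move=> mv'; have mg := measurable_gagliardo h q mv'; apply: measurable_funM.
have iG (v : T -> R) : measurable_fun setT v -> (gagliardo h q setT v <= C%:E)%E -> (\int[leb \x leb]_z (G v z)%:E <= (M * C)%:E)%E.
  move=> mv' hv; rewrite /G integral_finZ; [|exact: measurable_gagliardo|by move=> z; rewrite mulr_ge0 ?powR_ge0|by []].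
  by rewrite EFinM; apply: lee_wpmul2l; rewrite ?lee_fin// -gagliardoE.
have iD (v : T -> R) : measurable_fun setT v -> (gagliardo h q setT v <= C%:E)%E -> (leb \x leb)%E.-integrable setT (EFin \o D v).
  move=> mv' hv; apply/integrableP; split; first by apply/measurable_EFinP; exact: measurable_form.
  have [N N0 HN] := HM 1 ltr01.
  apply: (@le_lt_trans _ _ (\int[leb \x leb]_z (N * W z + G v z)%:E)%E).
    apply: ge0_le_integralW => z _ //; rewrite lee_fin; apply: (le_trans (HN v z)).
    by rewrite mul1r.
  have m1 : measurable_fun setT (fun z => N * W z) by exact: measurable_funM.
  rewrite integral_finD; [|exact: m1|exact: mG|by move=> z; exact: mulr_ge0|by []].
  rewrite integral_finZ//; apply: lte_add_pinfty; first by apply: lte_mul_pinfty.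
  exact: le_lt_trans (iG _ mv' hv) (ltry _).
have Z : (\int[leb \x leb]_z `|D (v_ j) z - D u z|%:E @[j --> \oo] --> 0)%E.
  apply: (equiintegrable_cvg0 (b_ := fun j z => G (v_ j) z + G u z) (w := W) (C := M * C + M * C)).
  - move=> j; have m1 : measurable_fun setT (D (v_ j)) by exact: measurable_form.
    have m2 : measurable_fun setT (D u) by exact: measurable_form.
    by mfun.
  - by move=> j; apply: measurable_funD; exact: mG.
  - exact: mW.
  - by [].
  - by move=> j z; exact: addr_ge0.
  - exact: W0.
  - apply: filterS (ae_prod vu) => z [h1 h2].
    rewrite -(normr0 R) -(subrr (D u z)); apply: cvg_norm; apply: cvgB; last exact: cvg_cst.
    rewrite /D; apply: cvgMr_tmp; apply: cvgMr_tmp.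
    have c2 : (v_ j z.1 - v_ j z.2) @[j --> \oo] --> u z.1 - u z.2 by exact: cvgB.
    exact: (cvg_comp _ _ c2 (@cPhi (u z.1 - u z.2))).
  - move=> e e0; have [N N0 HN] := HM e e0; exists (N + N); first exact: addr_ge0.
    move=> j z; apply: (le_trans (ler_normB _ _)).
    have h1 := HN (v_ j) z; have h2 := HN u z.
    have -> : (N + N) * W z + e * (G (v_ j) z + G u z) = (N * W z + e * G (v_ j) z) + (N * W z + e * G u z) by ring.
    exact: lerD.
  - exact: iW.
  - move=> j; rewrite integral_finD; [|exact: mG|exact: mG|by []|by []].
    rewrite EFinD; exact: leeD (iG _ (mv j) (H j)) (iG _ mu Hu).
have f1 j := integrable_fin_num measurableT (iD _ (mv j) (H j)).
have f2 := integrable_fin_num measurableT (iD _ mu Hu).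
apply/(sube_cvg0 _ f2); apply/cvg_abse0P.
apply: (squeeze_cvge _ (cvg_cst 0%E) Z); apply: nearW => j /=; rewrite abse_ge0/=.
rewrite -(integralB measurableT (iD _ (mv j) (H j)) (iD _ mu Hu)).
apply: (le_trans (le_abse_integral _ _ _)) => //.
exact: measurable_int (integrableB measurableT (iD _ (mv j) (H j)) (iD _ mu Hu)).
Qed.

End limit_passage.

Lemma integral_set_le d (T : measurableType d) (R : realType) (m : {measure set T -> \bar R}) (D : set T) (f : T -> \bar R) :
  (forall x, (0 <= f x)%E) -> (\int[m]_(x in D) f x <= \int[m]_x f x)%E.
Proof.
move=> f0; rewrite integral_mkcond; apply: ge0_le_integralW => x _; rewrite patchE; case: ifP => //.
Qed.

Lemma integral_setE d (T : measurableType d) (R : realType) (m : {measure set T -> \bar R}) (D : set T) (f : T -> \bar R) :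
  (forall x, ~ D x -> f x = 0%E) -> (\int[m]_(x in D) f x = \int[m]_x f x)%E.
Proof.
move=> f0; rewrite integral_mkcond; apply: eq_integral => x _; rewrite patchE; case: ifPn => //.
by rewrite notin_setE => /f0.
Qed.

(** * Bounded domains and assembly of the proof *)

Section domains.
Context {R : realType} {n : nat}.
Local Notation leb := (@lebesgue_rV R n).
Local Notation T := 'rV[R]_n.

Lemma bounded_set_coord (Omega : set T) : bounded_set Omega ->
  exists B : nat, forall x, Omega x -> forall i, `|x ord0 i| < B%:R.
Proof.
move=> [M [_ hM]]; pose M1 := Num.max M 0 + 1.
have MM : M < M1 by rewrite (@le_lt_trans _ _ (Num.max M 0))// ?ltrDl// le_max lexx.
exists (Num.truncn (M1 + 1)).+1 => x Ox i.
have h : ball (0 : T) (M1 + 1) x.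
  rewrite -ball_normE/= sub0r normrN; apply: le_lt_trans (hM _ MM x Ox) _.
  by rewrite ltrDl.
have [_ /(_ ord0 i)] := h; rewrite -ball_normE/= !mxE sub0r normrN => hi.
exact: lt_trans hi (truncnS_gt _).
Qed.

(** [sup] is meaningful only for a set bounded above; the coordinate bound supplies this. *)
Lemma diam_ge (Omega : set T) (B : nat) x y : (forall x, Omega x -> forall i, `|x ord0 i| < B%:R) ->
  Omega x -> Omega y -> enorm (x - y) <= diam Omega.
Proof.
move=> hO Ox Oy; apply: ub_le_sup; last by exists (x, y).
exists (n%:R * (B%:R + B%:R)) => _ [[a c] [/= Oa Oc] <-].
apply: enorm_le_coord; first exact: addr_ge0.
move=> i; rewrite !mxE; apply: (le_trans (ler_normB _ _)).
by apply: lerD; apply: ltW; exact: hO.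
Qed.

Lemma diam_gt0 (Omega : set T) (B : nat) : (0 < n)%N -> (forall x, Omega x -> forall i, `|x ord0 i| < B%:R) ->
  Omega !=set0 -> open Omega -> 0 < diam Omega.
Proof.
move=> n0 hO [x Ox] oO; have /nbhs_ballP[e/= e0 eO] : nbhs x Omega by exact: open_nbhs_nbhs.
pose y : T := \row_i (x ord0 i + e / 2).
have Oy : Omega y.
  apply: eO; split=> // i j; rewrite (ord1 i) -ball_normE/= mxE opprD addrA subrr sub0r normrN.
  by rewrite gtr0_norm ?divr_gt0// ltr_pdivrMr// ltr_pMr// ltr1n.
apply: lt_le_trans (diam_ge hO Oy Ox).
apply: lt_le_trans (coord_le_enorm (y - x) (Ordinal n0)).
by rewrite !mxE addrAC subrr add0r gtr0_norm divr_gt0.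
Qed.

Lemma weak_solution_of_solves (s p b : R) (Phi : R -> R) (K : T -> T -> R) (K' : T * T -> R) (Omega : set T) (f v : T -> R) :
  0 < s < 1 -> 1 < p -> (0 < n)%N -> measurable Omega -> 0 < b -> (leb Omega <= b%:E)%E ->
  (forall u phi, nonlocal_form Phi K u phi =
      (\int[leb \x leb]_z (Phi (u z.1 - u z.2) * (phi z.1 - phi z.2) * K' z)%:E)%E) ->
  solves s p Phi K' Omega f v -> weak_solution s p Phi K Omega f v.
Proof.
move=> s01 p1 n0 mO b0 hb EK [av sv]; have [mv v0 ev] := av; have /andP[s0 s1] := s01.
split.
- split; first exact: borel_Rn_measurable.
    have [C C0 HC] := poincare s0 p1 n0 mO b0 hb.
    apply: (@le_lt_trans _ _ (\int[leb]_x (`|v x| `^ p)%:E)%E).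
      by apply: integral_set_le => x; rewrite lee_fin powR_ge0.
    apply: (le_lt_trans (HC v mv v0)); apply: lte_mul_pinfty => //.
    by rewrite lee_fin ltW.
  apply: le_lt_trans ev; rewrite gagliardoE.
  by apply: integral_set_le => z; rewrite lee_fin mulr_ge0 ?powR_ge0.
- exact: aeW.
- move=> phi tphi; have aphi := test_admissible mO hb s01 p1 tphi; have [_ phi0 _] := aphi.
  rewrite EK; have [_ ->] := sv _ aphi.
  by apply/esym; apply: integral_setE => x /phi0 ->; rewrite mulr0.
Qed.

End domains.

Section existence.
Context {R : realType} {n : nat}.
Local Notation leb := (@lebesgue_rV R n).
Local Notation T := 'rV[R]_n.
Variables (s p L : R) (Phi : R -> R) (K : T -> T -> R) (Omega : set T) (mu : {charge set T -> \bar R}).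
Hypotheses (n0 : (0 < n)%N) (s01 : 0 < s < 1) (p1 : 1 < p) (spn : s * p < n%:R) (L1 : 1 <= L).
Hypotheses (cPhi : continuous Phi) (hPhi : forall t, L^-1 * `|t| `^ p <= Phi t * t <= L * `|t| `^ p).
Hypotheses (mK : Rn2_measurable K) (hK : forall x y, x != y ->
  L^-1 * enorm (x - y) `^ (- (n%:R + s * p)) <= K x y <= L * enorm (x - y) `^ (- (n%:R + s * p))).
Hypotheses (bO : bounded_domain Omega) (hmu : finite_radon_measure Omega mu).

(** The approximating family is returned with the solution, because the final estimate is made for
    its members at every scale [k] and only then passed to the limit. The condition on [k] involves
    the mass of [mu] itself, which bounds that of all smoothed data. *)
Lemma existence_family : exists u : T -> R, sola s p Phi K Omega mu u /\
  exists v_ : nat -> T -> R, [/\ (forall j, measurable_fun setT (v_ j)), measurable_fun setT u,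
    {ae leb, forall x, v_ j x @[j --> \oo] --> u x}, 0 < diam Omega &
    forall k j, 0 < k -> fine (charge_tv mu Omega) <= k `^ (p - 1) * diam Omega `^ (n%:R - s * p) ->
      normalized s p (L * L) (diam Omega) Omega (fun x => k^-1 * v_ j x)].
Proof.
have /andP[s0 s1] := s01; have p0 : 0 < p by exact: lt_trans p1.
have L0 : 0 < L by exact: lt_le_trans L1.
have sp0 : 0 < s * p by exact: mulr_gt0.
have pm : 0 < p - 1 by rewrite subr_gt0.
have N0 : 0 < n%:R :> R by rewrite ltr0n.
have [neO oO _ bdO] := bO.
have [B hO] := bounded_set_coord bdO.
have mO : measurable Omega by exact: open_measurable_rV.
have d0 := diam_gt0 n0 hO neO oO.
have hd x y : Omega x -> Omega y -> enorm (x - y) <= diam Omega by exact: diam_ge hO.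
have [b b0 hb] := Omega_measure_lt mO hO.
have na : 0 < n%:R + s * p by rewrite addr_gt0.
have [K' [mK' hK' EK]] := borel_kernel L1 na mK hK.
pose M := fine (charge_tv mu Omega).
have M0 : 0 <= M by apply: fine_ge0; rewrite /charge_tv /charge_variation adde_ge0.
pose r_ (j : nat) : R := j.+1%:R^-1.
have r0 j : 0 < r_ j by rewrite invr_gt0.
pose f_ j := smoothing Omega mu (r_ j).
have mf j : measurable_fun setT (f_ j) by exact: measurable_smoothing.
have fM j : (\int[leb]_x `|f_ j x|%:E <= M%:E)%E.
  by rewrite /M -charge_tv_fine//; exact: (smoothing_mass mO hb hmu (r0 j)).
have foff j x : ~ Omega x -> f_ j x = 0.
  by move=> nx; rewrite /f_ /smoothing indicE memNset// mul0r.
have /choice[v_ sv] : forall j, exists v, solves s p Phi K' Omega (f_ j) v.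
  move=> j; have [Mj hMj] := smoothing_bounded Omega mu (r0 j).
  exact: (weak_existence s0 p1 n0 L1 cPhi hPhi mK' hK' mO hO (mf j) hMj).
have nv k j : 0 < k -> M <= k `^ (p - 1) * diam Omega `^ (n%:R - s * p) ->
    normalized s p (L * L) (diam Omega) Omega (fun x => k^-1 * v_ j x).
  by move=> k0 Mk; apply: (solves_normalized p1 L1 cPhi hPhi mK' hK' mO d0 k0 hd (mf j) (fM j) Mk (sv j)).
pose D := diam Omega `^ (n%:R - s * p).
have D0 : 0 < D by exact: powR_gt0.
(* [M + 1] keeps the scale positive when [mu = 0]; this [k] serves only compactness and finiteness,
   not the constant of the theorem. *)
pose k := ((M + 1) / D) `^ (p - 1)^-1.
have k0 : 0 < k by rewrite powR_gt0// divr_gt0// ltr_wpDl.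
have Mk : M <= k `^ (p - 1) * D.
  rewrite /k -powRrM mulVf ?gt_eqF// powRr1; last by rewrite divr_ge0 ?addr_ge0// ltW.
  by rewrite divfK ?gt_eqF// lerDl.
have A0 : 0 < L * L by exact: mulr_gt0.
have [sg [w [sg1 mw w0 wc]]] := normalized_compact n0 s0 p1 spn A0 mO hO (fun j => nv k j k0 Mk).
pose u x := k * w x.
have mv j : measurable_fun setT (v_ j) by have [[]] := sv j.
have v0 j x : ~ Omega x -> v_ j x = 0 by have [[_ h _] _] := sv j; exact: h.
have muu : measurable_fun setT u by rewrite /u; mfun.
have u0 x : ~ Omega x -> u x = 0 by move=> /w0; rewrite /u => ->; rewrite mulr0.
have vu : {ae leb, forall x, v_ (sg j) x @[j --> \oo] --> u x}.
  apply: filterS wc => x wx.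
  have : k * (k^-1 * v_ (sg j) x) @[j --> \oo] --> k * w x by apply: cvgMl_tmp.
  by under eq_fun do rewrite mulVKf ?gt_eqF//.
have mvs j : measurable_fun setT (v_ (sg j)) by exact: mv.
have v0s j x : ~ Omega x -> v_ (sg j) x = 0 by exact: v0.
have sr0 j : 0 < r_ (sg j) by exact: r0.
have sgm i j : (i <= j)%N -> (sg i <= sg j)%N.
  move=> ij; rewrite -(subnKC ij); elim: (j - i)%N => [|m ih]; first by rewrite addn0.
  by rewrite addnS; apply: (leq_trans ih); exact: ltnW.
have srn i j : (i <= j)%N -> r_ (sg j) <= r_ (sg i).
  by move=> ij; rewrite lef_pV2 ?posrE// ler_nat ltnS sgm.
have src : r_ (sg j) @[j --> \oo] --> 0 by apply: cvg_subseq => //; exact: cvg_invS.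
(* Leaves room for the exponent strictly between [p - 1] and [qbar] that the convergence of the form
   requires. *)
have qbar_gt : p - 1 < qbar n s p.
  have sn : s < n%:R by apply: lt_le_trans s1 _; rewrite ler1n.
  by rewrite /qbar ltr_pdivlMr ?subr_gt0// mulrC ltr_pM2r// gtrBl.
have Hm g : 0 < g < gstar (n := n) s p -> exists C, forall j, (\int[leb]_x (`|v_ (sg j) x| `^ g)%:E <= C%:E)%E.
  move=> hg; have [C C0 H] := scaled_moment n0 s0 p1 spn A0 hg.
  by eexists => j; apply: H; [exact: k0|exact: mv|exact: nv].
have Hg h q : 0 < h < s -> 0 < q < qbar n s p -> exists C, forall j, (gagliardo h q setT (v_ (sg j)) <= C%:E)%E.
  move=> hh hq; have [C C0 H] := scaled_gagliardo n0 s0 p1 spn A0 hh hq.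
  by eexists => j; apply: H; [exact: k0|exact: mv|exact: nv].
exists u; split; last first.
  by exists (fun j => v_ (sg j)); split=> // k' j k'0 Mk'; exact: nv.
split.
- exact: u0.
- move=> h q hh /andP[pq qq]; have q0 : 0 < q by exact: lt_le_trans pq.
  have hq : 0 < q < qbar n s p by rewrite q0.
  have [_ [_ qg]] := qbar_bounds n0 s0 p1 spn hq.
  have [|C1 H1] := Hm q; first by rewrite q0.
  have [C2 H2] := Hg h q hh hq.
  split; first exact: borel_Rn_measurable.
  apply: lte_add_pinfty.
    apply: (@le_lt_trans _ _ (\int[leb]_x (`|u x| `^ q)%:E)%E); last first.
      exact: le_lt_trans (limit_moment mvs vu q0 H1) (ltry _).
    by apply: integral_set_le => x; rewrite lee_fin powR_ge0.
  apply: le_lt_trans (le_lt_trans (limit_gagliardo mvs vu q0 H2) (ltry _)).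
  rewrite !gagliardoE.
  by apply: integral_set_le => z; rewrite lee_fin mulr_ge0 ?powR_ge0.
- move=> phi tphi.
  have [q /andP[q1 q2]] : exists q, p - 1 < q < qbar n s p by exists ((p - 1 + qbar n s p) / 2); lra.
  (* At [h = s] the quantity equals [s < 1], and it is positive for every [h < s]; any [h] close
     enough to [s] works. *)
  have [h hh hc] : exists2 h, 0 < h < s & 0 < s * p - h * (p - 1) < 1.
    have h1 : Num.max 0 ((s * p - 1) / (p - 1)) < s.
      by rewrite gt_max s0 ltr_pdivrMr//; lra.
    exists ((Num.max 0 ((s * p - 1) / (p - 1)) + s) / 2); have m0 : 0 <= Num.max 0 ((s * p - 1) / (p - 1)) by rewrite le_max lexx.
      by apply/andP; split; lra.
    have m1 : (s * p - 1) / (p - 1) <= Num.max 0 ((s * p - 1) / (p - 1)) by rewrite le_max lexx orbT.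
    move: m1; rewrite ler_pdivrMr//; move: (Num.max _ _) h1 m0 => X h1 m0 m1.
    by apply/andP; split; nra.
  have hq : 0 < q < qbar n s p by rewrite q2 andbT (lt_trans pm).
  have [C2 H2] := Hg h q hh hq.
  have F := form_cvg mO hb mvs muu vu p1 L1 cPhi hPhi mK' hK' tphi q1 hc H2.
  have aphi := test_admissible mO hb s01 p1 tphi; have [_ phi0 _] := aphi.
  have [/(_ [::])[cphi _] sphi] := tphi.
  have G := @smoothing_cvg R n Omega mu b mO hb (fun j => r_ (sg j)) phi sr0 src cphi sphi.
  rewrite EK; apply: (cvg_unique _ F) => //.
  apply: cvg_trans G; apply: near_eq_cvg; apply: nearW => j.
  have [_ /(_ _ aphi)[_ E]] := sv (sg j).
  move: E => /= ->; rewrite integral_setE; last by move=> x /phi0 ->; rewrite mul0r.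
  by apply: eq_integral => x _; rewrite mulrC.
- exists (fun j => v_ (sg j)), (fun j => f_ (sg j)); split.
  + move=> j; split; first exact: borel_Rn_measurable.
    have [Mj hMj] := smoothing_bounded Omega mu (sr0 j).
    by exists Mj; apply: aeW => x _; exact: hMj.
  + move=> j; exact: (weak_solution_of_solves s01 p1 n0 mO b0 hb (EK Phi) (sv (sg j))).
  + by apply: filterS vu => x vx _.
  + split.
    * move=> q /andP[pq qq] C _; have q0 : 0 < q by exact: lt_le_trans pq.
      have hq : 0 < q < qbar n s p by rewrite q0.
      have [_ [_ qg]] := qbar_bounds n0 s0 p1 spn hq.
      have [|C1 H1] := Hm ((q + gstar (n := n) s p) / 2); first by apply/andP; split; lra.
      have Z := limit_Lq mO hb mvs muu v0s u0 vu (_ : 0 < q < (q + gstar (n := n) s p) / 2) H1.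
      apply: (squeeze_cvge _ (cvg_cst 0%E) (Z _)); last by rewrite q0; lra.
      apply: nearW => j; rewrite integral_ge0/=; last by move=> x _; rewrite lee_fin powR_ge0.
      by apply: integral_set_le => x; rewrite lee_fin powR_ge0.
    * by move=> psi cpsi spsi; exact: (@smoothing_cvg R n Omega mu b mO hb (fun j => r_ (sg j)) psi sr0 src cpsi spsi).
    * by move=> x r rr; exact: (@smoothing_limsup R n Omega mu b mO hb (fun j => r_ (sg j)) x r sr0 srn src rr).
Qed.

End existence.

Unset Implicit Arguments.

Theorem theorem3p5 (R : realType) (n : nat) (s p Lambda : R) :
  (2 <= n)%N -> 0 < s < 1 -> 1 < p < n%:R / s -> 1 <= Lambda ->
  exists c : R -> R -> R,
    (forall h q : R, 0 < h < s -> 0 < q < qbar n s p -> 0 < c h q) /\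
    forall (Phi : R -> R) (K : 'rV[R]_n -> 'rV[R]_n -> R)
        (Omega : set 'rV[R]_n) (mu : {charge set 'rV[R]_n -> \bar R}),
      continuous Phi ->
      (forall t, Lambda^-1 * `|t| `^ p <= Phi t * t <= Lambda * `|t| `^ p) ->
      Rn2_measurable K ->
      (forall x y, x != y ->
         Lambda^-1 * enorm (x - y) `^ (- (n%:R + s * p)) <= K x y
           <= Lambda * enorm (x - y) `^ (- (n%:R + s * p))) ->
      bounded_domain Omega ->
      finite_radon_measure Omega mu ->
      exists u : 'rV[R]_n -> R,
        sola s p Phi K Omega mu u /\
        forall q h : R, 0 < q < qbar n s p -> 0 < h < s ->
          (gagliardo h q setT u `^ q^-1 <=
            (c h q * diam Omega `^ (n%:R / q - h) *
             (fine (charge_tv mu Omega) / diam Omega `^ (n%:R - s * p))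
               `^ (p - 1)^-1)%:E)%E.
Proof.
move=> n2 s01 /andP[p1 pns] L1; have n0 : (0 < n)%N by exact: leq_trans n2.
have /andP[s0 s1] := s01.
have spn : s * p < n%:R by move: pns; rewrite ltr_pdivlMr// mulrC.
have pm : 0 < p - 1 by rewrite subr_gt0.
pose A := Lambda * Lambda.
have A0 : 0 < A by rewrite mulr_gt0// (lt_le_trans ltr01).
(* The constants are chosen for all pairs at once, ahead of [Phi], [K], [Omega] and [mu]; outside
   the admissible range the value is a default [0]. *)
have /choice[C_ CP] : forall hq : R * R, exists C : R, 0 < hq.1 < s -> 0 < hq.2 < qbar n s p ->
    0 < C /\ forall d k Omega (v : 'rV[R]_n -> R), 0 < k -> measurable_fun setT v ->
      normalized s p A d Omega (fun x => k^-1 * v x) ->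
      (gagliardo hq.1 hq.2 setT v <= (C * k `^ hq.2 * d `^ (n%:R - hq.1 * hq.2))%:E)%E.
  move=> [h q]; have [/andP[/= hh hq]|nh] := boolP ((0 < h < s) && (0 < q < qbar n s p)).
    by have [C C0 H] := scaled_gagliardo n0 s0 p1 spn A0 hh hq; exists C.
  by exists 0 => /= h1 h2; move: nh; rewrite h1 h2.
exists (fun h q => C_ (h, q) `^ q^-1); split.
  by move=> h q hh hq; have [C0 _] := CP (h, q) hh hq; exact: powR_gt0.
move=> Phi K Omega mu cPhi hPhi mK hK bO hmu.
have [u [su [v_ [mv mu' vu d0 nv]]]] := existence_family n0 s01 p1 spn L1 cPhi hPhi mK hK bO hmu.
exists u; split=> // q h hq hh; have /andP[q0 _] := hq.
have [C0 HC] := CP (h, q) hh hq; move: C0 HC => /=; move: (C_ _) => C C0 HC.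
set d := diam Omega in d0 nv *; set M := fine _ in nv *.
have M0 : 0 <= M by apply: fine_ge0; rewrite /charge_tv /charge_variation adde_ge0.
pose D := d `^ (n%:R - s * p); have D0 : 0 < D by exact: powR_gt0.
(* The natural scale, at which the condition on the mass is an equality; it is [0] when [mu] has no
   mass. *)
pose X := (M / D) `^ (p - 1)^-1; have X0 : 0 <= X by exact: powR_ge0.
have XM : X `^ (p - 1) * D = M.
  rewrite /X -powRrM mulVf ?gt_eqF// powRr1 ?divr_ge0 ?(ltW D0)//.
  by rewrite divfK ?gt_eqF.
have G k : 0 < k -> X <= k -> (gagliardo h q setT u <= (C * k `^ q * d `^ (n%:R - h * q))%:E)%E.
  move=> k0 Xk; apply: (limit_gagliardo mv vu q0) => j.
  apply: HC => //; apply: nv => //; rewrite -XM ler_wpM2r ?(ltW D0)//.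
  by apply: ge0_ler_powR; rewrite ?nnegrE ?(ltW pm)// ltW.
have E0 : 0 < C * d `^ (n%:R - h * q) by rewrite mulr_gt0// powR_gt0.
have GX : (gagliardo h q setT u <= (C * X `^ q * d `^ (n%:R - h * q))%:E)%E.
  (* For [X = 0] the estimate holds at every positive scale, and the scale is sent to [0]. *)
  move: X0; rewrite le_eqVlt => /predU1P[X0|X0]; last exact: G.
  rewrite -X0 powR0 ?gt_eqF// mulr0 mul0r; apply/lee_addgt0Pr => e e0; rewrite add0e.
  have e1 : 0 < e / (C * d `^ (n%:R - h * q)) by rewrite divr_gt0.
  apply: (le_trans (G ((e / (C * d `^ (n%:R - h * q))) `^ q^-1) _ _)); rewrite ?powR_gt0// -?X0 ?powR_ge0//.
  rewrite lee_fin -powRrM mulVf ?gt_eqF// powRr1 ?(ltW e1)//.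
  by rewrite mulrAC mulrC divfK// gt_eqF.
have g0 : (0 <= gagliardo h q setT u)%E.
  by rewrite gagliardoE; apply: integral_fin_ge0 => z; rewrite mulr_ge0 ?powR_ge0.
have iq : 0 <= q^-1 by rewrite invr_ge0 ltW.
apply: (@le_trans _ _ ((C * X `^ q * d `^ (n%:R - h * q))%:E `^ q^-1)%E).
  by apply: gt0_ler_poweR; rewrite // in_itv/= ?leey ?andbT// lee_fin !mulr_ge0 ?powR_ge0// ltW.
rewrite poweR_EFin lee_fin -/D -/X !powRM ?mulr_ge0 ?powR_ge0 ?(ltW C0)//.
rewrite -powRrM mulfV ?gt_eqF// powRr1// -powRrM.
rewrite (_ : (n%:R - h * q) / q = n%:R / q - h); last by field; rewrite gt_eqF.
by rewrite mulrAC.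
Qed.
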